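(* Let $f$ be a transcendental entire function of finite order, let $c_1, c_2$ be two nonzero complex numbers such that $f(z+c_1)\not\equiv f(z+c_2)$ (as functions of $z$), and let $q$ be a polynomial that is not identically zero. Then at least one of the two functions $f(z)f(z+c_1)-q(z)$ and $f(z)f(z+c_2)-q(z)$ has infinitely many zeros in $\mathbb{C}$.
   Context: The order of growth of a meromorphic function $f$ on $\mathbb{C}$ is $\rho(f)=\limsup_{r\to\infty}\frac{\log^+ T(r,f)}{\log r}$, where $T(r,f)$ is the Nevanlinna characteristic of $f$; $f$ has finite order if $\rho(f)<\infty$. An entire function is transcendental if it is not a polynomial. *)

(* Defs.v *)
From mathcomp Require Export all_boot all_order all_algebra.
From mathcomp Require Export all_classical all_reals all_analysis.
From mathcomp Require Export complex.
Export Order.TTheory GRing.Theory Num.Theory numFieldNormedType.Exports.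

Set Implicit Arguments.
Unset Strict Implicit.
Unset Printing Implicit Defensive.

Local Open Scope classical_set_scope.
Local Open Scope complex_scope.
Local Open Scope ring_scope.

(* The norm of [R[i]] takes its values in [R[i]]; this is the usual real-valued
   modulus. *)
Definition cmod (R : realType) (z : R[i]) : R := complex.Re `|z|.

(* The library only finds the metric topology of a field [K] under the alias
   [K^o], hence the casts below. *)
Definition entire (R : realType) (f : R[i] -> R[i]) : Prop :=
  forall z : R[i], derivable (f : R[i]^o -> R[i]^o) z 1.

Definition transcendental (R : realType) (f : R[i] -> R[i]) : Prop :=
  ~ exists p : {poly R[i]}, forall z : R[i], f z = p.[z].

(* [ln 0 = 0] in the library, so [logp 0 = 0] as it should. *)
Definition logp (R : realType) (x : R) : R := Num.max (ln x) 0.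

Definition cpolar (R : realType) (r t : R) : R[i] :=
  (r * cos t) +i* (r * sin t).

(* Meromorphic functions are represented by total functions whose values at
   the poles are irrelevant: the definitions below ignore them. *)

(* For [n > 0], [f] has a pole of multiplicity [n] at [a]. *)
Definition has_pole_order (R : realType) (f : R[i] -> R[i]) (a : R[i])
    (n : nat) : Prop :=
  exists2 l : R[i], l != 0 &
    (fun z : R[i]^o => ((z - a) ^+ n * f z : R[i]^o)) @ (a : R[i]^o)^'
      --> (l : R[i]^o).

(* The defining set has at most one element; the value is 0 if [a] is not
   a pole. *)
Definition pole_order (R : realType) (f : R[i] -> R[i]) (a : R[i]) : nat :=
  xget 0%N [set n : nat | (0 < n)%N /\ has_pole_order f a n].

(* Number of poles in the closed disc of radius [t], with multiplicity. *)
Definition pole_count (R : realType) (f : R[i] -> R[i]) (t : R) : nat :=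
  \sum_(a \in [set a : R[i] | cmod a <= t]) pole_order f a.

Definition counting_function (R : realType) (f : R[i] -> R[i]) (r : R) : R :=
  \int[lebesgue_measure]_(t in `]0, r])
    (((pole_count f t)%:R - (pole_count f 0)%:R) / t)
  + (pole_count f 0)%:R * ln r.

Definition proximity_function (R : realType) (f : R[i] -> R[i]) (r : R) : R :=
  (2 * pi)^-1 *
  \int[lebesgue_measure]_(t in `[0, 2 * pi]) logp (cmod (f (cpolar r t))).

Definition characteristic (R : realType) (f : R[i] -> R[i]) (r : R) : R :=
  proximity_function f r + counting_function f r.

Definition growth_order (R : realType) (f : R[i] -> R[i]) : \bar R :=
  limf_esup (fun r : R => (logp (characteristic f r) / ln r)%:E) +oo.

Definition finite_order (R : realType) (f : R[i] -> R[i]) : Prop :=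
  (growth_order f < +oo)%E.

(* Main.v *)
(* If both zero sets were finite, Hadamard's theorem would give
   [f z * f (z + c_i) = q z + p_i z * exp (A_i z) =: G_i z] with polynomials [p_i]
   and [A_i].  A zero of [G_i] is a zero of [f] or of its shift, so adding [c_i] or
   [- c_i] to it yields another zero of [G_i].  The zeros of [q + p exp A] accumulate
   along all the [2 deg A] rays on which the leading term of [A] is imaginary, and
   off the direction of [c_i] this is compatible with such a symmetry only if
   [deg A_i = 1].  Then [p_i] is a multiple of [q], so that
   [G_i = q (1 + kappa_i exp (lambda_i z))] with [exp (lambda_i c_i) = 1].  Finally
   [f z * f (z + c1) * f (z + c2) * f (z + c1 + c2)] equals both
   [G_1 z * G_1 (z + c2)] and [G_2 z * G_2 (z + c1)]; comparing growth gives
   [lambda_1 = lambda_2], then [kappa_1 = kappa_2], hence [G_1 = G_2] and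
   [f z * (f (z + c1) - f (z + c2)) = 0].

   Cauchy's theory on circles is obtained from Goursat's theorem on rectangles in
   the coordinate [w], where [z = exp w]. *)

Require Import Defs.
From mathcomp Require Import ring lra.

Set Implicit Arguments.
Unset Strict Implicit.
Unset Printing Implicit Defensive.

Local Open Scope classical_set_scope.
Local Open Scope complex_scope.
Local Open Scope ring_scope.

(** Transcendence excludes constant [A_i]: otherwise [f z * f (z + c_i)] is a polynomial, [f] has
    finitely many zeros, so [f = P exp B], and the leading terms of [B z] and [B (z + c_i)]
    reinforce each other. For linear [A] the ratio of [exp A] at [z + c] and at [z] is a constant,
    so the exponential can be eliminated between the equations at a zero and at its shift.
    Infinitely many zeros then give a polynomial identity; its leading coefficients yield
    [exp (lambda c) = 1], and it says that [p / q] has period [c], hence is constant. Equality of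
    the [lambda_i] comes from two one-sided comparisons: a number [x] with [Re x >= 1] and
    [Re (1 / x) >= 1] is 1. The analytic tools are all derived from circular means, which shapes
    several proofs: pointwise growth is obtained from the proximity function with a Fejer kernel in
    place of the Poisson kernel, and zeros are located by the mean value of [1 / g] in place of an
    argument principle. Componentwise bounds on complex integrals lose a factor 2, which the
    constants are chosen to absorb. *)

Section Modulus.
Context {R : realType}.
Local Notation C := R[i].
Implicit Types (z w : C) (x y : R).

Lemma cmodC z : `|z| = (cmod z)%:C.
Proof. by rewrite /cmod normc_def. Qed.

Lemma cmodE z : cmod z = Num.sqrt (complex.Re z ^+ 2 + complex.Im z ^+ 2).
Proof. by rewrite /cmod normc_def. Qed.

Lemma cmod_ge0 z : 0 <= cmod z.
Proof. by rewrite cmodE sqrtr_ge0. Qed.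

Lemma cmodM z w : cmod (z * w) = cmod z * cmod w.
Proof. by apply: complexI; rewrite rmorphM /= -!cmodC normrM. Qed.

Lemma ler_cmodD z w : cmod (z + w) <= cmod z + cmod w.
Proof. by rewrite -lecR rmorphD /= -!cmodC ler_normD. Qed.

Lemma cmodN z : cmod (- z) = cmod z.
Proof. by apply: complexI; rewrite -!cmodC normrN. Qed.

Lemma cmodB z w : cmod (z - w) = cmod (w - z).
Proof. by rewrite -opprB cmodN. Qed.

Lemma ler_cmodB z w : cmod (z - w) <= cmod z + cmod w.
Proof. by rewrite -(cmodN w) ler_cmodD. Qed.

Lemma lerB_cmod z w : cmod z - cmod w <= cmod (z - w).
Proof. by rewrite lerBlDr -{1}(subrK w z) ler_cmodD. Qed.

Lemma lerB_cmodD z w : cmod z - cmod w <= cmod (z + w).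
Proof. by rewrite -(cmodN w) -{2}(opprK w) lerB_cmod. Qed.

Lemma cmodr x : cmod x%:C = `|x|.
Proof. by rewrite cmodE /= expr0n addr0 sqrtr_sqr. Qed.

Lemma cmod0 : cmod (0 : C) = 0.
Proof. by rewrite cmodr normr0. Qed.

Lemma cmod1 : cmod (1 : C) = 1.
Proof. by rewrite cmodr normr1. Qed.

Lemma cmodX z n : cmod (z ^+ n) = cmod z ^+ n.
Proof. by elim: n => [|n IH]; rewrite ?expr0 ?cmod1 // !exprS cmodM IH. Qed.

Lemma cmodV z : cmod z^-1 = (cmod z)^-1.
Proof. by apply: complexI; rewrite fmorphV /= -!cmodC normfV. Qed.

Lemma cmod_eq0 z : (cmod z == 0) = (z == 0).
Proof. by rewrite -(inj_eq (@complexI _)) -cmodC normr_eq0. Qed.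

Lemma cmod_gt0 z : (0 < cmod z) = (z != 0).
Proof. by rewrite lt_def cmod_ge0 cmod_eq0 andbT. Qed.

Lemma ler_cmod_sum (I : Type) (s : seq I) (P : pred I) (F : I -> C) :
  cmod (\sum_(i <- s | P i) F i) <= \sum_(i <- s | P i) cmod (F i).
Proof.
elim/big_rec2: _ => [|i y z _ IH]; first by rewrite cmod0.
by apply: (le_trans (ler_cmodD _ _)); rewrite lerD2l.
Qed.

Lemma ler_Re_cmod z : `|complex.Re z| <= cmod z.
Proof. by rewrite -lecR -cmodC normc_ge_Re. Qed.

Lemma ler_Im_cmod z : `|complex.Im z| <= cmod z.
Proof. by rewrite cmodE -sqrtr_sqr ler_wsqrtr // lerDr sqr_ge0. Qed.

Lemma ReD z w : complex.Re (z + w) = complex.Re z + complex.Re w.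
Proof. by case: z w => [a b] [c d]. Qed.

Lemma ImD z w : complex.Im (z + w) = complex.Im z + complex.Im w.
Proof. by case: z w => [a b] [c d]. Qed.

Lemma ReN z : complex.Re (- z) = - complex.Re z.
Proof. by case: z. Qed.

Lemma ImN z : complex.Im (- z) = - complex.Im z.
Proof. by case: z. Qed.

Lemma ReB z w : complex.Re (z - w) = complex.Re z - complex.Re w.
Proof. by rewrite ReD ReN. Qed.

Lemma ImB z w : complex.Im (z - w) = complex.Im z - complex.Im w.
Proof. by rewrite ImD ImN. Qed.

Lemma ReM z w : complex.Re (z * w) =
  complex.Re z * complex.Re w - complex.Im z * complex.Im w.
Proof. by case: z w => [a b] [c d]. Qed.

Lemma ImM z w : complex.Im (z * w) =
  complex.Re z * complex.Im w + complex.Im z * complex.Re w.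
Proof. by case: z w => [a b] [c d]. Qed.

Lemma ler_cmod_ReIm z : cmod z <= `|complex.Re z| + `|complex.Im z|.
Proof.
rewrite [z in cmod z]complexE (le_trans (ler_cmodD _ _))// cmodM !cmodr.
by rewrite [cmod 'i]cmodE /= expr0n add0r expr1n sqrtr1 mul1r.
Qed.

Lemma eqC z w : complex.Re z = complex.Re w -> complex.Im z = complex.Im w ->
  z = w.
Proof. by case: z w => [a b] [c d] /= -> ->. Qed.

Lemma Re_realM x z : complex.Re (x%:C * z) = x * complex.Re z.
Proof. by rewrite ReM /= mul0r subr0. Qed.

Lemma Im_realM x z : complex.Im (x%:C * z) = x * complex.Im z.
Proof. by rewrite ImM /= mul0r addr0. Qed.

End Modulus.
#[global] Hint Resolve cmod_ge0 : core.

(** * Limits and continuity expressed by the real-valued modulus *)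

Section Topology.
Context {R : realType}.
Local Notation C := R[i].

Lemma cvg_cmodP (T : Type) (F : set_system T) (FF : Filter F)
    (f : T -> R[i]^o) (l : R[i]^o) :
  (f @ F --> l) <-> (forall e : R, 0 < e -> \forall t \near F, cmod (f t - l) < e).
Proof.
split=> [/cvgrPdist_lt H e e0|H].
  have := H e%:C; rewrite ltcR => /(_ e0); apply: filterS => t /=.
  by rewrite cmodC ltcR cmodB.
apply/cvgrPdist_lt => e e0.
have {e0} [e' e'0 ->] : exists2 e' : R, 0 < e' & e = e'%:C.
  case: e e0 => a b; rewrite ltcE /= => /andP[/eqP -> a0]; by exists a.
by apply: filterS (H _ e'0) => t; rewrite cmodC ltcR cmodB.
Qed.

Lemma near_cmodP (z : C) (P : C -> Prop) :
  (\forall w \near (z : R[i]^o), P w) <->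
  exists2 d : R, 0 < d & forall w, cmod (w - z) < d -> P w.
Proof.
split.
  move=> /nbhs_ballP[e e0 H].
  have {e0} [d d0 e_eq] : exists2 d : R, 0 < d & e = d%:C.
    case: e e0 {H} => a b; rewrite /= ltcE /= => /andP[/eqP -> a0]; by exists a.
  exists d => // w wz; apply: H; rewrite e_eq /ball /= /ball_ /= cmodC ltcR.
  by rewrite cmodB.
move=> [d d0 H]; apply/nbhs_ballP; exists d%:C; rewrite /= ?ltcR // => w.
by rewrite /ball /= /ball_ /= cmodC ltcR cmodB => /H.
Qed.

Lemma near_realP (t : R) (P : R -> Prop) :
  (\forall s \near t, P s) <->
  exists2 d : R, 0 < d & forall s, `|s - t| < d -> P s.
Proof.
split.
  move=> /nbhs_ballP[e e0 H]; exists e => // s st; apply: H.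
  by rewrite /ball /= distrC.
move=> [d d0 H]; apply/nbhs_ballP; exists d => // s.
by rewrite /ball /= distrC => /H.
Qed.

Lemma continuous_Re : continuous (@complex.Re R : R[i]^o -> R).
Proof.
move=> z; apply/(@cvgrPdist_lt _ _ _ (nbhs (z : R[i]^o))) => e e0; apply/near_cmodP; exists e => // w wz.
by rewrite distrC -ReB (le_lt_trans (ler_Re_cmod _)).
Qed.

Lemma continuous_Im : continuous (@complex.Im R : R[i]^o -> R).
Proof.
move=> z; apply/(@cvgrPdist_lt _ _ _ (nbhs (z : R[i]^o))) => e e0; apply/near_cmodP; exists e => // w wz.
by rewrite distrC -ImB (le_lt_trans (ler_Im_cmod _)).
Qed.

Lemma continuous_cmod : continuous (@cmod R : R[i]^o -> R).
Proof.
move=> z; apply/(@cvgrPdist_lt _ _ _ (nbhs (z : R[i]^o))) => e e0; apply/near_cmodP; exists e => // w wz.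
rewrite ltr_norml ltrNl opprB (le_lt_trans (lerB_cmod _ _) wz) /=.
by rewrite (le_lt_trans (lerB_cmod _ _)) // cmodB.
Qed.

Lemma continuous_realC : continuous (fun x : R => x%:C : R[i]^o).
Proof.
move=> z; apply/cvg_cmodP => e e0; apply/near_realP; exists e => // w wz.
by rewrite -rmorphB cmodr.
Qed.

Lemma continuous_Complex (T : topologicalType) (f g : T -> R) (t : T) :
  {for t, continuous f} -> {for t, continuous g} ->
  {for t, continuous (fun s => f s +i* g s : R[i]^o)}.
Proof.
move=> /cvgrPdist_lt cf /cvgrPdist_lt cg; apply/cvg_cmodP => e e0.
have e20 : 0 < e / 2 by rewrite divr_gt0.
near=> s; apply: (le_lt_trans (ler_cmod_ReIm _)).
rewrite ReB ImB /= (splitr e) ltrD // distrC; near: s; [exact: cf|exact: cg].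
Unshelve. all: by end_near. Qed.

Section Rules.
Context {T : topologicalType}.
Implicit Types (f g : T -> R[i]^o) (t : T).

Lemma continuousCD f g t : {for t, continuous f} -> {for t, continuous g} ->
  {for t, continuous (fun s => f s + g s : R[i]^o)}.
Proof. by move=> cf cg; apply: cvgD; [exact: cf|exact: cg]. Qed.

Lemma continuousCM f g t : {for t, continuous f} -> {for t, continuous g} ->
  {for t, continuous (fun s => f s * g s : R[i]^o)}.
Proof. by move=> cf cg; apply: cvgM; [exact: cf|exact: cg]. Qed.

Lemma continuousCV f t : f t != 0 -> {for t, continuous f} ->
  {for t, continuous (fun s => (f s)^-1 : R[i]^o)}.
Proof. by move=> f0 cf; apply: cvgV. Qed.

Lemma continuousCN f t : {for t, continuous f} ->
  {for t, continuous (fun s => - f s : R[i]^o)}.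
Proof. by move=> cf; apply: cvgN; exact: cf. Qed.

End Rules.

End Topology.

(** * Complex derivatives through continuous slopes *)

Section Derivative.
Context {R : realType}.
Local Notation C := R[i].
Implicit Types (f g : C -> C) (z w l : C).

(** Radii are kept in [R] through [cmod], whereas the balls of [R[i]^o] have radii in [R[i]];
    [ccontP] relates the two. *)
Definition ccont f z := forall e : R, 0 < e ->
  exists2 d : R, 0 < d & forall w, cmod (w - z) < d -> cmod (f w - f z) < e.

(** Caratheodory's form of the derivative. Product and chain rules become ring identities between
    slopes, without quotients. *)
Definition cderiv f z l := exists phi : C -> C,
  [/\ phi z = l, ccont phi z & forall w, f w = f z + phi w * (w - z)].

Definition cdiff f := forall z, exists l, cderiv f z l.

Lemma ccontP f z :
  ccont f z <-> {for (z : R[i]^o), continuous (f : R[i]^o -> R[i]^o)}.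
Proof.
have P := @cvg_cmodP R _ (nbhs (z : R[i]^o)) _ f (f z).
split=> [H|/P H e /H /near_cmodP //].
by apply/P => e /H /near_cmodP.
Qed.

Lemma ccont_near f g z : (\forall w \near (z : R[i]^o), f w = g w) ->
  ccont f z -> ccont g z.
Proof.
move=> /near_cmodP[d d0 fg] cf e /cf[d' d'0 H].
exists (Num.min d d'); first by rewrite lt_min d0.
move=> w; rewrite lt_min => /andP[wd wd'].
by rewrite -fg // -fg ?subrr ?cmod0 //; exact: H.
Qed.

Lemma ccont_cst l z : ccont (fun=> l) z.
Proof. by move=> e e0; exists 1 => // w _; rewrite subrr cmod0. Qed.

Lemma ccont_id z : ccont id z.
Proof. by move=> e e0; exists e. Qed.

Lemma ccontD f g z : ccont f z -> ccont g z -> ccont (fun w => f w + g w) z.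
Proof. by move=> /ccontP cf /ccontP cg; apply/ccontP; exact (@continuousCD R R[i]^o f g z cf cg). Qed.

Lemma ccontM f g z : ccont f z -> ccont g z -> ccont (fun w => f w * g w) z.
Proof. by move=> /ccontP cf /ccontP cg; apply/ccontP; exact (@continuousCM R R[i]^o f g z cf cg). Qed.

Lemma ccontV f z : f z != 0 -> ccont f z -> ccont (fun w => (f w)^-1) z.
Proof. by move=> f0 /ccontP cf; apply/ccontP; exact (@continuousCV R R[i]^o f z f0 cf). Qed.

Lemma ccontN f z : ccont f z -> ccont (fun w => - f w) z.
Proof. by move=> /ccontP cf; apply/ccontP; exact (@continuousCN R R[i]^o f z cf). Qed.

Lemma ccont_comp f g z : ccont f z -> ccont g (f z) -> ccont (fun w => g (f w)) z.
Proof.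
move=> cf cg e /cg[d d0 Hd].
by have [d' d'0 Hd'] := cf _ d0; exists d' => // w /Hd'/Hd.
Qed.

Lemma cderiv_ccont f z l : cderiv f z l -> ccont f z.
Proof.
move=> [phi [_ cphi E]].
rewrite (_ : f = fun w => f z + phi w * (w - z)); last exact/funext.
apply: ccontD; first exact: ccont_cst.
apply: ccontM => //; apply: ccontD; [exact: ccont_id|exact: ccont_cst].
Qed.

(** Slopes suit algebra, remainders suit estimates; this passes between them. Off [z] the slope is
    the difference quotient. *)
Lemma cderivP f z l : cderiv f z l <-> forall e : R, 0 < e ->
  exists2 d : R, 0 < d & forall w, cmod (w - z) < d ->
    cmod (f w - f z - l * (w - z)) <= e * cmod (w - z).
Proof.
split=> [[phi [<- cphi E]] e e0|H].
  have [d d0 H] := cphi _ e0; exists d => // w wd.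
  have -> : f w - f z - phi z * (w - z) = (phi w - phi z) * (w - z).
    by rewrite [f w]E; ring.
  by rewrite cmodM ler_wpM2r ?cmod_ge0 ?ltW ?H.
exists (fun w => if w == z then l else (f w - f z) / (w - z)); split.
- by rewrite eqxx.
- move=> e e0; have e20 : 0 < e / 2 by rewrite divr_gt0.
  have [d d0 Hd] := H _ e20.
  exists d => // w wd; rewrite eqxx; case: eqVneq => [_|wz].
    by rewrite subrr cmod0.
  have wz0 : 0 < cmod (w - z) by rewrite cmod_gt0 subr_eq0.
  rewrite -(ltr_pM2r wz0) -cmodM mulrBl divfK ?subr_eq0 //.
  apply: (le_lt_trans (Hd _ wd)); rewrite ltr_pM2r //.
  by rewrite ltr_pdivrMr // mulr_natr mulr2n ltrDl.
- move=> w; case: eqVneq => [->|wz]; first by rewrite subrr mulr0 addr0.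
  by rewrite divfK ?subr_eq0 // addrC subrK.
Qed.

Lemma cderiv_near f g z l : (\forall w \near (z : R[i]^o), f w = g w) ->
  cderiv f z l -> cderiv g z l.
Proof.
move=> /near_cmodP[d d0 fg] /cderivP cf; apply/cderivP => e /cf[d' d'0 H].
exists (Num.min d d'); first by rewrite lt_min d0.
move=> w; rewrite lt_min => /andP[wd wd'].
by rewrite -fg // -fg ?subrr ?cmod0 //; exact: H.
Qed.

Lemma cderiv_unique f z l l' : cderiv f z l -> cderiv f z l' -> l = l'.
Proof.
move=> /cderivP H /cderivP H'; apply/eqP; rewrite -subr_eq0 -cmod_eq0.
rewrite eq_le cmod_ge0 andbT; apply/ler_addgt0Pr => e e0; rewrite add0r.
have e20 : 0 < e / 2 by rewrite divr_gt0.
have [d d0 {}H] := H _ e20; have [d' d'0 {}H'] := H' _ e20.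
set m := Num.min d d' / 2.
have m0 : 0 < m by rewrite divr_gt0 // lt_min d0.
have mm : m < Num.min d d'.
  by rewrite ltr_pdivrMr // mulr_natr mulr2n ltrDl lt_min d0.
have E : cmod (z + m%:C - z) = m by rewrite addrC addKr cmodr gtr0_norm.
have {}H := H (z + m%:C); have {}H' := H' (z + m%:C).
move: H H'; rewrite E => /(_ (lt_le_trans mm _)).
rewrite ge_min lexx => /(_ isT) H /(_ (lt_le_trans mm _)).
rewrite ge_min lexx orbT => /(_ isT) H'.
rewrite -(ler_pM2r m0) -[in X in X <= _]E -cmodM.
have -> : (l - l') * (z + m%:C - z) =
    (f (z + m%:C) - f z - l' * (z + m%:C - z)) -
    (f (z + m%:C) - f z - l * (z + m%:C - z)) by ring.
apply: (le_trans (ler_cmodB _ _)); rewrite (splitr e) mulrDl lerD //.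
Qed.

Lemma cderiv_cst a z : cderiv (fun=> a) z 0.
Proof.
exists (fun=> 0); split => //; first exact: ccont_cst.
by move=> w; rewrite mul0r addr0.
Qed.

Lemma cderiv_id z : cderiv id z 1.
Proof.
exists (fun=> 1); split => //; first exact: ccont_cst.
by move=> w; rewrite mul1r addrC subrK.
Qed.

Lemma cderivD f g z l m : cderiv f z l -> cderiv g z m ->
  cderiv (fun w => f w + g w) z (l + m).
Proof.
move=> [phi [<- cphi E]] [psi [<- cpsi F]].
exists (fun w => phi w + psi w); split => //; first exact: ccontD.
by move=> w; rewrite (E w) (F w); ring.
Qed.

Lemma cderivM f g z l m : cderiv f z l -> cderiv g z m ->
  cderiv (fun w => f w * g w) z (l * g z + f z * m).
Proof.
move=> cf cg; have cg' := cderiv_ccont cg.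
case: cf cg => [phi [<- cphi E]] [psi [<- cpsi F]].
exists (fun w => phi w * g w + f z * psi w); split => //.
  apply: ccontD; apply: ccontM => //; exact: ccont_cst.
by move=> w; rewrite (E w) (F w); ring.
Qed.

Lemma cderiv_comp f g z l m : cderiv f z l -> cderiv g (f z) m ->
  cderiv (fun w => g (f w)) z (m * l).
Proof.
move=> cf cg; have cf' := cderiv_ccont cf.
case: cf cg => [phi [<- cphi E]] [psi [<- cpsi F]].
exists (fun w => psi (f w) * phi w); split => //.
  by apply: ccontM => //; exact: ccont_comp.
by move=> w; rewrite (F (f w)) {2}(E w); ring.
Qed.

Lemma cderivV z : z != 0 -> cderiv (fun w => w^-1) z (- (z * z)^-1).
Proof.
(* The slope identity must hold at every [w], including [0], where [0^-1 = 0]. The function is first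
   changed at [0] to the value predicted by the slope [- (z * z)^-1]; this is harmless because
   derivatives are local and [z != 0]. *)
move=> z0; apply: (@cderiv_near (fun w => if w == 0 then z^-1 + (z^-1)^+2 * z else w^-1)).
  apply/near_cmodP; exists (cmod z); rewrite ?cmod_gt0 // => w.
  by case: eqVneq => // ->; rewrite sub0r cmodN ltxx.
exists (fun w => if w == 0 then - (z * z)^-1 else - (z * w)^-1); split.
- by rewrite (negbTE z0).
- apply: (@ccont_near (fun w => - (z * w)^-1)).
    by near=> w; case: eqVneq => // w0; exfalso; move: w0; apply/eqP;
       near: w; apply/near_cmodP; exists (cmod z); rewrite ?cmod_gt0 // => w;
       apply: contraTneq => ->; rewrite sub0r cmodN ltxx.
  apply: ccontN; apply: ccontV; first by rewrite mulf_neq0.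
  by apply: ccontM; [exact: ccont_cst|exact: ccont_id].
- move=> w; rewrite (negbTE z0); case: eqVneq => [->|w0]; field; rewrite ?z0 ?w0.
Unshelve. all: by end_near. Qed.

Lemma cderivN f z l : cderiv f z l -> cderiv (fun w => - f w) z (- l).
Proof.
move=> /(cderivM (cderiv_cst (-1) z)); rewrite mul0r add0r mulN1r.
by rewrite (_ : (fun w => -1 * f w) = fun w => - f w) //; apply/funext=> w; rewrite mulN1r.
Qed.

Lemma cdiff_cst a : cdiff (fun=> a).
Proof. by move=> z; exists 0; exact: cderiv_cst. Qed.

Lemma cdiff_id : cdiff id.
Proof. by move=> z; exists 1; exact: cderiv_id. Qed.

Lemma cdiffD f g : cdiff f -> cdiff g -> cdiff (fun w => f w + g w).
Proof.
by move=> cf cg z; have [l Hl] := cf z; have [m Hm] := cg z; exists (l + m); exact: cderivD.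
Qed.

Lemma cdiffM f g : cdiff f -> cdiff g -> cdiff (fun w => f w * g w).
Proof.
move=> cf cg z; have [l Hl] := cf z; have [m Hm] := cg z.
by eexists; apply: cderivM; eassumption.
Qed.

Lemma cdiffN f : cdiff f -> cdiff (fun w => - f w).
Proof. by move=> cf z; have [l Hl] := cf z; eexists; apply: cderivN Hl. Qed.

Lemma cdiffB f g : cdiff f -> cdiff g -> cdiff (fun w => f w - g w).
Proof. by move=> cf /cdiffN; exact: cdiffD. Qed.

Lemma cdiffX f n : cdiff f -> cdiff (fun w => f w ^+ n).
Proof.
move=> cf; elim: n => [|n IH]; first exact: cdiff_cst.
rewrite (_ : (fun w => _) = fun w => f w * f w ^+ n); first exact: cdiffM.
by apply/funext => w; rewrite exprS.
Qed.

Lemma cdiff_comp f g : cdiff f -> cdiff g -> cdiff (fun w => g (f w)).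
Proof.
move=> cf cg z; have [l Hl] := cf z; have [m Hm] := cg (f z).
by eexists; apply: cderiv_comp; eassumption.
Qed.

Lemma cdiff_sum (I : Type) (s : seq I) (F : I -> C -> C) :
  (forall i, cdiff (F i)) -> cdiff (fun w => \sum_(i <- s) F i w).
Proof.
move=> H; elim: s => [|i s IH].
  by rewrite (_ : (fun w => _) = fun=> 0); [exact: cdiff_cst|apply/funext => w; rewrite big_nil].
rewrite (_ : (fun w => _) = fun w => F i w + \sum_(j <- s) F j w); first exact: cdiffD.
by apply/funext => w; rewrite big_cons.
Qed.

Lemma cdiff_poly (p : {poly C}) : cdiff (fun w => p.[w]).
Proof.
rewrite (_ : (fun w => _) = fun w => \sum_(i <- enum 'I_(size p)) p`_i * w ^+ i).
  apply: cdiff_sum => i; apply: cdiffM; first exact: cdiff_cst.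
  exact/cdiffX/cdiff_id.
by apply/funext => w; rewrite horner_coef big_enum.
Qed.

Lemma cdiff_shift f a : cdiff f -> cdiff (fun w => f (a + w)).
Proof.
by apply: cdiff_comp; apply: cdiffD; [exact: cdiff_cst|exact: cdiff_id].
Qed.

Lemma cdiff_shiftr f a : cdiff f -> cdiff (fun w => f (w + a)).
Proof.
by apply: cdiff_comp; apply: cdiffD; [exact: cdiff_id|exact: cdiff_cst].
Qed.

Lemma cdiff_scale f a : cdiff f -> cdiff (fun w => f (a * w)).
Proof.
by apply: cdiff_comp; apply: cdiffM; [exact: cdiff_cst|exact: cdiff_id].
Qed.

Lemma cdiff_ccont f z : cdiff f -> ccont f z.
Proof. by move=> /(_ z)[l]; exact: cderiv_ccont. Qed.

Lemma dnbhs_cmodP z (P : C -> Prop) :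
  (\forall w \near ((z : R[i]^o)^')%classic, P w) <->
  exists2 d : R, 0 < d & forall w, w != z -> cmod (w - z) < d -> P w.
Proof.
split.
  rewrite -[X in X -> _]/(\forall w \near (z : R[i]^o), w != z -> P w).
  by move=> /near_cmodP[d d0 H]; exists d => // w w0 wd; exact: H.
move=> [d d0 H].
suff : \forall w \near (z : R[i]^o), w != z -> P w by [].
by apply/near_cmodP; exists d => // w wd w0; exact: H.
Qed.

Lemma entireP f : entire f <-> cdiff f.
Proof.
pose q z := fun h : R[i]^o => h^-1 *: (f (h *: 1 + z) - f z : R[i]^o) : R[i]^o.
have qE z l h : h != 0 ->
    cmod (q z h - l) * cmod h = cmod (f (z + h) - f z - l * (z + h - z)).
  move=> h0; rewrite /q -cmodM; congr cmod.
  rewrite /GRing.scale /= mulr1 [h + z]addrC; by field.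
have P z l := @cvg_cmodP R _ (0 : R[i]^o)^' _ (q z) l.
split=> H z.
  have [l /P Hl] : exists l : R[i]^o, q z @ (0 : R[i]^o)^' --> l.
    by exists (lim (q z @ (0 : R[i]^o)^')); exact: (H z).
  exists l; apply/cderivP => e /Hl/dnbhs_cmodP[d d0 Hd]; exists d => // w wd.
  have [->|wz] := eqVneq w z; first by rewrite !subrr mulr0 subr0 cmod0 mulr0.
  have h0 : w - z != 0 by rewrite subr_eq0.
  have := qE z l _ h0; rewrite [z + _]addrC subrK => <-.
  by rewrite ler_wpM2r ?cmod_ge0 ?ltW ?Hd ?subr0.
have [l /cderivP Hl] := H z.
suff /P Q : forall e : R, 0 < e ->
    \forall h \near (0 : R[i]^o)^', cmod (q z h - l) < e.
  exact (@cvgP R[i]^o _ l Q).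
move=> e e0; apply/dnbhs_cmodP.
have e20 : 0 < e / 2 by rewrite divr_gt0.
have [d d0 Hd] := Hl _ e20; exists d => // h h0; rewrite subr0 => hd.
have := Hd (z + h); rewrite -qE // [z + h]addrC addrK => /(_ hd).
rewrite ler_pM2r ?cmod_gt0 // => /le_lt_trans; apply.
by rewrite ltr_pdivrMr // mulr_natr mulr2n ltrDl.
Qed.

End Derivative.

(** * The complex exponential, its surjectivity and its derivative *)

Section Exponential.
Context {R : realType}.
Local Notation C := R[i].
Implicit Types (z w : C) (s t x y : R).

Definition cis t : C := cos t +i* sin t.

Definition cexp z : C := (expR (complex.Re z))%:C * cis (complex.Im z).

Lemma cis0 : cis 0 = 1.
Proof. by rewrite /cis cos0 sin0. Qed.

Lemma cisD s t : cis (s + t) = cis s * cis t.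
Proof. by apply: eqC; rewrite ?ReM ?ImM /= ?cosD ?sinD //; ring. Qed.

Lemma cmod_cis t : cmod (cis t) = 1.
Proof. by rewrite cmodE cos2Dsin2 sqrtr1. Qed.

Lemma cis_neq0 t : cis t != 0.
Proof. by rewrite -cmod_eq0 cmod_cis oner_eq0. Qed.

Lemma cisN t : cis (- t) = (cis t)^-1.
Proof. by apply: (mulIf (cis_neq0 t)); rewrite -cisD addNr cis0 mulVf ?cis_neq0. Qed.

Lemma cisMn t n : cis (t *+ n) = cis t ^+ n.
Proof. by elim: n => [|n IH]; rewrite ?mulr0n ?cis0 // mulrS exprS cisD IH. Qed.

Lemma cis_2pi : cis (2 * pi) = 1.
Proof. by rewrite /cis mulr_natl cos2pi sin2pi. Qed.

Lemma cisNi t : cis (- t) = (cis t)^*.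
Proof. by rewrite /cis cosN sinN. Qed.

Lemma cpolarE r t : cpolar r t = r%:C * cis t.
Proof. by apply: eqC; rewrite ?ReM ?ImM /=; ring. Qed.

Lemma cexp0 : cexp 0 = 1.
Proof. by rewrite /cexp /= expR0 cis0 mulr1. Qed.

Lemma cexpD z w : cexp (z + w) = cexp z * cexp w.
Proof. by rewrite /cexp ReD ImD expRD cisD rmorphM /= mulrACA. Qed.

Lemma cmod_cexp z : cmod (cexp z) = expR (complex.Re z).
Proof. by rewrite /cexp cmodM cmod_cis mulr1 cmodr ger0_norm // expR_ge0. Qed.

Lemma cexp_neq0 z : cexp z != 0.
Proof. by rewrite -cmod_eq0 cmod_cexp expR_eq0. Qed.

Lemma cexpN z : cexp (- z) = (cexp z)^-1.
Proof.
by apply: (mulIf (cexp_neq0 z)); rewrite -cexpD addNr cexp0 mulVf ?cexp_neq0.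
Qed.

Lemma cexpB z w : cexp (z - w) = cexp z / cexp w.
Proof. by rewrite cexpD cexpN. Qed.

Lemma cexpMn z n : cexp (z *+ n) = cexp z ^+ n.
Proof. by elim: n => [|n IH]; rewrite ?mulr0n ?cexp0 // mulrS exprS cexpD IH. Qed.

Lemma cexp_i t : cexp (0 +i* t) = cis t.
Proof. by rewrite /cexp /= expR0 mul1r. Qed.

Lemma cexp_2pii : cexp (0 +i* (2 * pi)) = 1.
Proof. by rewrite cexp_i cis_2pi. Qed.

Lemma cexp_ln r t : 0 < r -> cexp (ln r +i* t) = r%:C * cis t.
Proof. by move=> r0; rewrite /cexp /= lnK // posrE. Qed.

Lemma cis_onto z : cmod z = 1 -> exists2 t, 0 <= t <= 2 * pi & cis t = z.
Proof.
case: z => a b; rewrite cmodE /= => /(congr1 (fun x => x ^+ 2)).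
rewrite sqr_sqrtr ?addr_ge0 ?sqr_ge0 // expr1n => ab.
have a1 : -1 <= a <= 1.
  by rewrite -ler_norml -[`|a|]ger0_norm // -sqrtr_sqr -sqrtr1 ler_wsqrtr // real_normK ?num_real // -ab lerDl sqr_ge0.
have [b0|b0] := leP 0 b.
  exists (acos a).
    rewrite acos_ge0 //= (le_trans (acos_lepi a1)) // ler_peMl ?pi_ge0 //.
    by rewrite ler1n.
  rewrite /cis acosK ?in_itv //= sin_acos // (_ : 1 - a^+2 = b ^+ 2); last by lra.
  by rewrite sqrtr_sqr ger0_norm.
exists (2 * pi - acos a).
  rewrite subr_ge0 gerBl acos_ge0 // andbT (le_trans (acos_lepi a1)) //.
  by rewrite ler_peMl ?pi_ge0 // ler1n.
rewrite addrC cisD cis_2pi mulr1 /cis cosN sinN acosK ?in_itv //= sin_acos //.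
rewrite (_ : 1 - a^+2 = b ^+ 2); last by lra.
by rewrite sqrtr_sqr ltr0_norm // opprK.
Qed.

Lemma cexp_onto z : z != 0 -> exists w, cexp w = z.
Proof.
move=> z0; have r0 : 0 < cmod z by rewrite cmod_gt0.
have rC0 : (cmod z)%:C != 0 by rewrite -cmod_eq0 cmodr normr_eq0 gt_eqF.
have [|t _ tE] := @cis_onto (z / (cmod z)%:C).
  by rewrite cmodM cmodV cmodr gtr0_norm // divff // gt_eqF.
by exists (ln (cmod z) +i* t); rewrite cexp_ln // tE mulrC divfK.
Qed.

Lemma continuous_cis : continuous (cis : R -> R[i]^o).
Proof.
by move=> t; apply: continuous_Complex; [exact: continuous_cos|exact: continuous_sin].
Qed.

Lemma is_derive_estimate (f : R -> R) x l : is_derive x 1 f l ->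
  forall e, 0 < e -> exists2 d, 0 < d &
    forall h, `|h| < d -> `|f (x + h) - f x - l * h| <= e * `|h|.
Proof.
move=> [df <-] e e0.
have /cvgrPdist_lt /(_ _ e0) := df.
rewrite -[X in X -> _]/(\forall h \near (0 : R), h != 0 -> _).
move=> /near_realP[d d0 H]; exists d => // h hd.
have [->|h0] := eqVneq h 0; first by rewrite addr0 subrr mulr0 subr0 normr0 mulr0.
have := H h; rewrite subr0 => /(_ hd h0).
rewrite -[X in `|X - _|]/('D_1 f x) /GRing.scale /= mulr1 => Hh.
have -> : f (x + h) - f x - 'D_1 f x * h = - (('D_1 f x - h^-1 * (f (h + x) - f x)) * h).
  by rewrite [h + x]addrC; field.
by rewrite normrN normrM ler_wpM2r // ltW.
Qed.

Lemma cderiv_cexp0 : cderiv cexp 0 1.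
Proof.
apply/cderivP => e e0.
(* The total remainder is at most [e1 * |x| + 5 * e1 * |y|], hence the 6; two of its terms carry the
   factor [expR x], bounded by 2. *)
pose e1 := Num.min 1 (e / 6).
have e10 : 0 < e1 by rewrite lt_min ltr01 divr_gt0.
have e11 : e1 <= 1 by rewrite ge_min lexx.
have e16 : 6 * e1 <= e by rewrite -ler_pdivlMl // mulrC ge_min lexx orbT.
have [d1 d10 H1] := is_derive_estimate (is_derive_expR 0) e10.
have [d2 d20 H2] := is_derive_estimate (is_derive_sin 0) e10.
have [d3 d30 H3] := is_derive_estimate (is_derive_cos 0) e10.
(* [|x| < e1 / 2] gives [|expR x - 1| <= 2 * |x| <= e1], which controls the cross term
   [(E - 1) * y]. *)
pose d := Num.min (Num.min d1 (e1 / 2)) (Num.min d2 d3).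
exists d; first by rewrite !lt_min d10 d20 d30 divr_gt0.
move=> [x y]; rewrite !subr0 !lt_min cexp0 mul1r => /andP[/andP[w1 we] /andP[w2 w3]].
set w := x +i* y in w1 we w2 w3 *.
have xw : `|x| <= cmod w := ler_Re_cmod w.
have yw : `|y| <= cmod w := ler_Im_cmod w.
have {H1} := H1 x (le_lt_trans xw w1).
have {H2} := H2 y (le_lt_trans yw w2).
have {H3} := H3 y (le_lt_trans yw w3).
rewrite expR0 sin0 cos0 !add0r oppr0 mul0r !subr0 !mul1r addr0 => H3 H2 H1.
apply: (le_trans (ler_cmod_ReIm _)).
rewrite !ReB !ImB ReM ImM /= !mul0r subr0 addr0.
set E := expR x in H1 *.
have xe : `|x| < e1 / 2 by apply: le_lt_trans xw we.
have e1m : e1 * `|x| <= 1 * `|x| by apply: ler_wpM2r.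
have El : `|E - 1| <= e1.
  rewrite -[E - 1](subrK x); apply: (le_trans (ler_normD _ _)); lra.
have E2 : `|E| <= 2.
  by rewrite -[E](subrK 1); apply: (le_trans (ler_normD _ _)); rewrite normr1; lra.
have -> : E * cos y - 1 - x = E * (cos y - 1) + (E - 1 - x) by ring.
have -> : E * sin y - 0 - y = E * (sin y - y) + (E - 1) * y by ring.
have B1 : `|E * (cos y - 1)| <= 2 * (e1 * `|y|) by rewrite normrM ler_pM.
have B2 : `|E * (sin y - y)| <= 2 * (e1 * `|y|) by rewrite normrM ler_pM.
have B3 : `|(E - 1) * y| <= e1 * `|y| by rewrite normrM ler_pM.
have B4 := ler_normD (E * (cos y - 1)) (E - 1 - x).
have B5 := ler_normD (E * (sin y - y)) ((E - 1) * y).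
have B6 : e1 * `|x| <= e1 * cmod w by rewrite ler_wpM2l // ltW.
have B7 : e1 * `|y| <= e1 * cmod w by rewrite ler_wpM2l // ltW.
have B8 : 6 * e1 * cmod w <= e * cmod w by rewrite ler_wpM2r // cmod_ge0.
lra.
Qed.

Lemma cderiv_cexp z : cderiv cexp z (cexp z).
Proof.
have H : cderiv (fun w => w - z) z 1.
  by rewrite -[1]addr0; apply: cderivD; [exact: cderiv_id|exact: cderiv_cst].
have H0 : cderiv cexp (z - z) 1 by rewrite subrr; exact: cderiv_cexp0.
have := cderivM (cderiv_cst (cexp z) z) (cderiv_comp H H0).
rewrite mul0r add0r !mulr1.
rewrite (_ : (fun w => _) = cexp) //; apply/funext => w.
by rewrite -cexpD addrC subrK.
Qed.

Lemma cdiff_cexp : cdiff cexp.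
Proof. by move=> z; exists (cexp z); exact: cderiv_cexp. Qed.

End Exponential.

(** * Continuity of complex-valued functions of a real variable *)

Section RealCurves.
Context {R : realType}.
Local Notation C := R[i].
Implicit Types (g h : R -> C) (t : R).

Definition rcont g t := forall e : R, 0 < e ->
  exists2 d : R, 0 < d & forall s, `|s - t| < d -> cmod (g s - g t) < e.

Lemma rcontP g t : rcont g t <-> {for t, continuous (g : R -> R[i]^o)}.
Proof.
have P := @cvg_cmodP R _ (nbhs t) _ g (g t).
split=> [H|/P H e /H /near_realP //].
by apply/P => e /H /near_realP.
Qed.

Lemma rcont_cst (a : C) t : rcont (fun=> a) t.
Proof. by move=> e e0; exists 1 => // s _; rewrite subrr cmod0. Qed.

Lemma rcontD g h t : rcont g t -> rcont h t -> rcont (fun s => g s + h s) t.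
Proof. by move=> /rcontP cg /rcontP ch; apply/rcontP; exact (continuousCD cg ch). Qed.

Lemma rcontN g t : rcont g t -> rcont (fun s => - g s) t.
Proof. by move=> /rcontP cg; apply/rcontP; exact (continuousCN cg). Qed.

Lemma rcontB g h t : rcont g t -> rcont h t -> rcont (fun s => g s - h s) t.
Proof. by move=> cg /rcontN; exact: rcontD. Qed.

Lemma rcontM g h t : rcont g t -> rcont h t -> rcont (fun s => g s * h s) t.
Proof. by move=> /rcontP cg /rcontP ch; apply/rcontP; exact (continuousCM cg ch). Qed.

Lemma rcont_comp (F : C -> C) g t :
  ccont F (g t) -> rcont g t -> rcont (fun s => F (g s)) t.
Proof.
move=> cF cg e /cF[d d0 Hd]; have [d' d'0 Hd'] := cg _ d0.
by exists d' => // s /Hd'/Hd.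
Qed.

Lemma rcont_cis t : rcont (@cis R) t.
Proof. by apply/rcontP; exact: continuous_cis. Qed.

Lemma rcont_real (f : R -> R) t : {for t, continuous f} ->
  rcont (fun s => (f s)%:C) t.
Proof.
move=> cf; apply/rcontP.
apply: (@continuous_comp R R R[i]^o f (fun x => x%:C : R[i]^o)) => //.
exact: continuous_realC.
Qed.

Lemma rcont_horizontal (y t : R) : rcont (fun s => s +i* y) t.
Proof.
move=> e e0; exists e => // s st; apply: le_lt_trans st.
by apply: (le_trans (ler_cmod_ReIm _)); rewrite /= subrr normr0 addr0.
Qed.

Lemma rcont_vertical (x t : R) : rcont (fun s => x +i* s) t.
Proof.
move=> e e0; exists e => // s st; apply: le_lt_trans st.
by apply: (le_trans (ler_cmod_ReIm _)); rewrite /= subrr normr0 add0r.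
Qed.

Lemma rcont_Re g t : rcont g t -> {for t, continuous (fun s => complex.Re (g s))}.
Proof.
move=> /rcontP cg.
by apply: (@continuous_comp R R[i]^o R g (@complex.Re R)) => //; exact: continuous_Re.
Qed.

Lemma rcont_Im g t : rcont g t -> {for t, continuous (fun s => complex.Im (g s))}.
Proof.
move=> /rcontP cg.
by apply: (@continuous_comp R R[i]^o R g (@complex.Im R)) => //; exact: continuous_Im.
Qed.

Lemma rcont_cmod g t : rcont g t -> {for t, continuous (fun s => cmod (g s))}.
Proof.
move=> /rcontP cg.
by apply: (@continuous_comp R R[i]^o R g (@cmod R)) => //; exact: continuous_cmod.
Qed.

End RealCurves.

(** * Integrals of continuous real functions over a segment *)

Section RealIntegral.
Context {R : realType}.
Implicit Types (a b c M : R) (f g : R -> R).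

Definition rint a b f := \int[lebesgue_measure]_(t in `[a, b]) f t.

Definition segment_continuous a b f :=
  forall t, a <= t <= b -> {for t, continuous f}.

Lemma segment_integrable a b f : segment_continuous a b f ->
  lebesgue_measure.-integrable `[a, b] (EFin \o f).
Proof.
move=> cf; apply: continuous_compact_integrable; first exact: segment_compact.
by apply: continuous_in_subspaceT => t; rewrite inE /= in_itv => /cf.
Qed.

Lemma eq_rint a b f g : (forall t, a <= t <= b -> f t = g t) ->
  rint a b f = rint a b g.
Proof. by move=> fg; apply: eq_Rintegral => t; rewrite inE /= in_itv => /fg. Qed.

Lemma rint_cst a b c : a <= b -> rint a b (fun=> c) = c * (b - a).
Proof.
move=> ab; rewrite /rint Rintegral_cst //= lebesgue_measure_itv /= lte_fin.
by move: ab; rewrite le_eqVlt => /predU1P[->|->] //=; rewrite ltxx subrr.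
Qed.

Lemma rintD a b f g : segment_continuous a b f -> segment_continuous a b g ->
  rint a b (fun t => f t + g t) = rint a b f + rint a b g.
Proof. by move=> cf cg; apply: RintegralD => //; exact: segment_integrable. Qed.

Lemma rintB a b f g : segment_continuous a b f -> segment_continuous a b g ->
  rint a b (fun t => f t - g t) = rint a b f - rint a b g.
Proof. by move=> cf cg; apply: RintegralB => //; exact: segment_integrable. Qed.

Lemma rintZ a b c f : segment_continuous a b f ->
  rint a b (fun t => c * f t) = c * rint a b f.
Proof. by move=> cf; apply: RintegralZl => //; exact: segment_integrable. Qed.

Lemma ler_rint a b f g : segment_continuous a b f -> segment_continuous a b g ->
  (forall t, a <= t <= b -> f t <= g t) -> rint a b f <= rint a b g.
Proof.
move=> cf cg fg; apply: le_Rintegral => //; exact: segment_integrable.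
Qed.

Lemma rint_ge0 a b f : (forall t, a <= t <= b -> 0 <= f t) -> 0 <= rint a b f.
Proof. by move=> f0; apply: Rintegral_ge0 => t /=; rewrite in_itv => /f0. Qed.

Lemma rint_split a b c f : a <= c -> c <= b -> segment_continuous a b f ->
  rint a b f = rint a c f + rint c b f.
Proof.
move=> ac cb cf; apply/eqP; rewrite addrC -subr_eq; apply/eqP.
rewrite /rint Rintegral_itvB ?bnd_simp //; last exact: segment_integrable.
apply: Rintegral_itv_obnd_cbnd.
apply: integrableS (segment_integrable cf) => //.
by apply: subset_itvr; rewrite bnd_simp.
Qed.

Lemma ler_norm_rint a b f M : a <= b -> segment_continuous a b f ->
  (forall t, a <= t <= b -> `|f t| <= M) -> `|rint a b f| <= M * (b - a).
Proof.
move=> ab cf fM; rewrite -rint_cst // ler_norml; apply/andP; split.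
  rewrite -mulN1r -rintZ; last by move=> t _; exact: cst_continuous.
  apply: ler_rint => //; first by move=> t _; exact: cst_continuous.
  by move=> t /fM; rewrite mulN1r ler_norml => /andP[].
apply: ler_rint => //; first by move=> t _; exact: cst_continuous.
by move=> t /fM; rewrite ler_norml => /andP[].
Qed.

End RealIntegral.

(** * Componentwise integrals of complex-valued functions *)

Section ComplexIntegral.
Context {R : realType}.
Local Notation C := R[i].
Implicit Types (a b c M : R) (g h : R -> C) (z : C).

Definition cint a b g : C :=
  rint a b (fun t => complex.Re (g t)) +i* rint a b (fun t => complex.Im (g t)).

Definition curve a b g := forall t, a <= t <= b -> rcont g t.

Lemma curve_Re a b g : curve a b g ->
  segment_continuous a b (fun t => complex.Re (g t)).
Proof. by move=> cg t /cg /rcont_Re. Qed.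

Lemma curve_Im a b g : curve a b g ->
  segment_continuous a b (fun t => complex.Im (g t)).
Proof. by move=> cg t /cg /rcont_Im. Qed.

Lemma eq_cint a b g h : (forall t, a <= t <= b -> g t = h t) ->
  cint a b g = cint a b h.
Proof. by move=> gh; congr Complex; apply: eq_rint => t /gh ->. Qed.

Lemma cint_cst a b z : a <= b -> cint a b (fun=> z) = (b - a)%:C * z.
Proof.
by move=> ab; apply: eqC; rewrite ?Re_realM ?Im_realM /= rint_cst // mulrC.
Qed.

Lemma cintD a b g h : curve a b g -> curve a b h ->
  cint a b (fun t => g t + h t) = cint a b g + cint a b h.
Proof.
move=> cg ch; apply: eqC; rewrite ?ReD ?ImD /=.
  rewrite -rintD; try exact: curve_Re.
  by apply: eq_rint => t _; rewrite ReD.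
rewrite -rintD; try exact: curve_Im.
by apply: eq_rint => t _; rewrite ImD.
Qed.

Lemma cintZ a b z g : curve a b g ->
  cint a b (fun t => z * g t) = z * cint a b g.
Proof.
move=> cg; have cR := curve_Re cg; have cI := curve_Im cg.
have sc (r : R) f : segment_continuous a b f ->
    segment_continuous a b (fun t => r * f t).
  by move=> cf t /cf ?; apply: continuousM => //; exact: cst_continuous.
apply: eqC; rewrite ?ReM ?ImM /=.
  rewrite -!rintZ // -rintB; try exact: sc.
  by apply: eq_rint => t _; rewrite ReM.
rewrite -!rintZ // -rintD; try exact: sc.
by apply: eq_rint => t _; rewrite ImM.
Qed.

Lemma curveD a b g h : curve a b g -> curve a b h -> curve a b (fun t => g t + h t).
Proof. by move=> cg ch t abt; apply: rcontD; [exact: cg|exact: ch]. Qed.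

Lemma curveM a b g h : curve a b g -> curve a b h -> curve a b (fun t => g t * h t).
Proof. by move=> cg ch t abt; apply: rcontM; [exact: cg|exact: ch]. Qed.

Lemma curve_cst a b z : curve a b (fun=> z).
Proof. by move=> t _; exact: rcont_cst. Qed.

Lemma cintB a b g h : curve a b g -> curve a b h ->
  cint a b (fun t => g t - h t) = cint a b g - cint a b h.
Proof.
move=> cg ch; rewrite -[- cint a b h]mulN1r -cintZ // -cintD //.
  by apply: eq_cint => t _; rewrite mulN1r.
by apply: curveM => //; exact: curve_cst.
Qed.

Lemma cint_split a b c g : a <= c -> c <= b -> curve a b g ->
  cint a b g = cint a c g + cint c b g.
Proof.
move=> ac cb cg; apply: eqC; rewrite ?ReD ?ImD /=; apply: rint_split => //.
  exact: curve_Re.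
exact: curve_Im.
Qed.

(* The factor 2 comes from bounding the real and imaginary parts separately. *)
Lemma ler_cmod_cint a b g M : a <= b -> curve a b g ->
  (forall t, a <= t <= b -> cmod (g t) <= M) ->
  cmod (cint a b g) <= 2 * M * (b - a).
Proof.
move=> ab cg gM; apply: (le_trans (ler_cmod_ReIm _)) => /=.
rewrite -mulrA mulrDl mul1r lerD //; apply: ler_norm_rint => //.
- exact: curve_Re.
- by move=> t /gM; apply: le_trans; exact: ler_Re_cmod.
- exact: curve_Im.
- by move=> t /gM; apply: le_trans; exact: ler_Im_cmod.
Qed.

Lemma cint_approx a b g z e : a <= b -> curve a b g ->
  (forall t, a <= t <= b -> cmod (g t - z) <= e) ->
  cmod (cint a b g - (b - a)%:C * z) <= 2 * e * (b - a).
Proof.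
move=> ab cg ge; rewrite -cint_cst // -cintB //; last exact: curve_cst.
apply: ler_cmod_cint => //.
by move=> t abt; apply: rcontB; [exact: cg|exact: rcont_cst].
Qed.

Lemma curve_sum a b (I : Type) (s : seq I) (F : I -> R -> C) :
  (forall i, curve a b (F i)) -> curve a b (fun t => \sum_(i <- s) F i t).
Proof.
move=> cF; elim: s => [|i s IH].
  rewrite (_ : (fun t => _) = fun=> 0); first exact: curve_cst.
  by apply/funext => t; rewrite big_nil.
rewrite (_ : (fun t => _) = fun t => F i t + \sum_(j <- s) F j t).
  exact: curveD.
by apply/funext => t; rewrite big_cons.
Qed.

Lemma cint_sum a b (I : Type) (s : seq I) (F : I -> R -> C) :
  a <= b -> (forall i, curve a b (F i)) ->
  cint a b (fun t => \sum_(i <- s) F i t) = \sum_(i <- s) cint a b (F i).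
Proof.
move=> ab cF; elim: s => [|i s IH].
  rewrite big_nil -[RHS](mulr0 (b - a)%:C) -cint_cst //.
  by apply: eq_cint => t _; rewrite big_nil.
rewrite big_cons -IH -cintD //; last exact: curve_sum.
by apply: eq_cint => t _; rewrite big_cons.
Qed.

Lemma cint_conj a b g : curve a b g ->
  cint a b (fun t => (g t)^*) = (cint a b g)^*.
Proof.
move=> cg; apply: eqC => /=; first by apply: eq_rint => t _; case: (g t).
rewrite -mulN1r -rintZ; last exact: curve_Im.
by apply: eq_rint => t _; rewrite mulN1r; case: (g t).
Qed.

End ComplexIntegral.

(** * Goursat's theorem on rectangles *)

Section Goursat.
Context {R : realType}.
Local Notation C := R[i].
Implicit Types (F : C -> C) (x y a b : R) (w : C).

Lemma rcontH F y t : ccont F (t +i* y) -> rcont (fun s => F (s +i* y)) t.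
Proof. by move=> cF; apply: rcont_comp cF _; exact: rcont_horizontal. Qed.

Lemma rcontV_line F x t : ccont F (x +i* t) -> rcont (fun s => F (x +i* s)) t.
Proof. by move=> cF; apply: rcont_comp cF _; exact: rcont_vertical. Qed.

(** The contour integral along the counterclockwise boundary, with opposite sides paired so that
    only differences of [F] are integrated. *)
Definition rectint F x1 x2 y1 y2 : C :=
  cint x1 x2 (fun s => F (s +i* y1) - F (s +i* y2)) +
  'i * cint y1 y2 (fun t => F (x2 +i* t) - F (x1 +i* t)).

Definition rect_continuous F x1 x2 y1 y2 := forall x y,
  x1 <= x <= x2 -> y1 <= y <= y2 -> ccont F (x +i* y).

Lemma curveH F x1 x2 y1 y2 y y' : rect_continuous F x1 x2 y1 y2 ->
  y1 <= y <= y2 -> y1 <= y' <= y2 ->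
  curve x1 x2 (fun s => F (s +i* y) - F (s +i* y')).
Proof. by move=> cF hy hy' s hs; apply: rcontB; apply: rcontH; exact: cF. Qed.

Lemma curveV F x1 x2 y1 y2 x x' : rect_continuous F x1 x2 y1 y2 ->
  x1 <= x <= x2 -> x1 <= x' <= x2 ->
  curve y1 y2 (fun t => F (x +i* t) - F (x' +i* t)).
Proof. by move=> cF hx hx' t ht; apply: rcontB; apply: rcontV_line; exact: cF. Qed.

Lemma rectint_splitx F c x1 x2 y1 y2 : x1 <= c -> c <= x2 -> y1 <= y2 ->
  rect_continuous F x1 x2 y1 y2 ->
  rectint F x1 x2 y1 y2 = rectint F x1 c y1 y2 + rectint F c x2 y1 y2.
Proof.
move=> xc cx y12 cF; have x12 := le_trans xc cx.
rewrite /rectint (cint_split xc cx); last by apply: (curveH cF); rewrite ?lexx ?y12.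
rewrite addrACA -mulrDr -cintD; try by apply: (curveV cF); rewrite ?lexx ?xc ?cx ?x12.
by congr (_ + _ * _); apply: eq_cint => t _; ring.
Qed.

Lemma rectint_splity F c x1 x2 y1 y2 : x1 <= x2 -> y1 <= c -> c <= y2 ->
  rect_continuous F x1 x2 y1 y2 ->
  rectint F x1 x2 y1 y2 = rectint F x1 x2 y1 c + rectint F x1 x2 c y2.
Proof.
move=> x12 yc cy cF; have y12 := le_trans yc cy.
rewrite /rectint (cint_split yc cy); last by apply: (curveV cF); rewrite ?lexx ?x12.
rewrite addrACA -mulrDr -cintD; try by apply: (curveH cF); rewrite ?lexx ?yc ?cy ?y12.
by congr (_ + _); apply: eq_cint => t _; ring.
Qed.

Lemma rect_continuousS F x1 x2 y1 y2 x1' x2' y1' y2' :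
  x1 <= x1' -> x2' <= x2 -> y1 <= y1' -> y2' <= y2 ->
  rect_continuous F x1 x2 y1 y2 -> rect_continuous F x1' x2' y1' y2'.
Proof.
move=> h1 h2 h3 h4 cF x y /andP[a1 a2] /andP[b1 b2]; apply: cF.
  by rewrite (le_trans h1 a1) (le_trans a2 h2).
by rewrite (le_trans h3 b1) (le_trans b2 h4).
Qed.

Lemma pick_half (u v : C) : cmod (u + v) <= 2 * cmod u \/ cmod (u + v) <= 2 * cmod v.
Proof.
have H := ler_cmodD u v.
by case: (leP (cmod u) (cmod v)) => uv; [right|left]; lra.
Qed.

(** Halving in [x] and then in [y] costs a factor 2 each time, so a choice between only two pieces
    is ever made. *)
Lemma rectint_bisect F x y a b : 0 <= a -> 0 <= b ->
  rect_continuous F x (x + (a + a)) y (y + (b + b)) ->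
  exists p : R * R, [/\ x <= p.1 <= x + a, y <= p.2 <= y + b &
    cmod (rectint F x (x + (a + a)) y (y + (b + b))) <=
    4 * cmod (rectint F p.1 (p.1 + a) p.2 (p.2 + b))].
Proof.
move=> a0 b0 cF.
have [x' hx' Hx] : exists2 x', x <= x' <= x + a &
    cmod (rectint F x (x + (a + a)) y (y + (b + b))) <=
    2 * cmod (rectint F x' (x' + a) y (y + (b + b))).
  rewrite (@rectint_splitx _ (x + a)) ?lerD2l ?lerDl ?addr_ge0 //.
  case: (pick_half (rectint F x (x + a) y (y + (b + b)))
                   (rectint F (x + a) (x + (a + a)) y (y + (b + b)))) => H.
    by exists x => //; rewrite lexx lerDl.
  by exists (x + a); [rewrite lexx lerDl a0|rewrite -(addrA x)].
have cF' : rect_continuous F x' (x' + a) y (y + (b + b)).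
  by apply: rect_continuousS cF => //; lra.
have [y' hy' Hy] : exists2 y', y <= y' <= y + b &
    cmod (rectint F x' (x' + a) y (y + (b + b))) <=
    2 * cmod (rectint F x' (x' + a) y' (y' + b)).
  rewrite (@rectint_splity _ (y + b)) ?lerD2l ?lerDl ?addr_ge0 //.
  case: (pick_half (rectint F x' (x' + a) y (y + b))
                   (rectint F x' (x' + a) (y + b) (y + (b + b)))) => H.
    by exists y => //; rewrite lexx lerDl.
  by exists (y + b); [rewrite lexx lerDl b0|rewrite -(addrA y)].
exists (x', y'); split => //=; apply: (le_trans Hx).
by rewrite [4](_ : _ = 2 * 2) -?mulrA ?ler_wpM2l //; ring.
Qed.

(** On paired sides the affine part of [F] contributes constants, [l] times ['i * (y1 - y2)] and [l]
    times [x2 - x1]; after integration these cancel and only remainders are left. Two remainders per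
    pair and the 2 of the complex integral bound make the 4. *)
Lemma rectint_small F x1 x2 y1 y2 w l e D : x1 <= x2 -> y1 <= y2 ->
  rect_continuous F x1 x2 y1 y2 ->
  (forall x y, x1 <= x <= x2 -> y1 <= y <= y2 ->
    cmod (F (x +i* y) - F w - l * (x +i* y - w)) <= e * D) ->
  cmod (rectint F x1 x2 y1 y2) <= 4 * e * D * ((x2 - x1) + (y2 - y1)).
Proof.
move=> x12 y12 cF H.
set r := fun z => F z - F w - l * (z - w).
have H1 : cmod (cint x1 x2 (fun s => F (s +i* y1) - F (s +i* y2)) -
    (x2 - x1)%:C * (l * (0 +i* (y1 - y2)))) <= 2 * (2 * e * D) * (x2 - x1).
  apply: cint_approx => //; first by apply: (curveH cF); rewrite ?lexx ?y12.
  move=> s hs.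
  have -> : F (s +i* y1) - F (s +i* y2) - l * (0 +i* (y1 - y2)) =
      r (s +i* y1) - r (s +i* y2).
    have -> : 0 +i* (y1 - y2) = s +i* y1 - (s +i* y2) by apply: eqC; rewrite ?ReB ?ImB /= ?subrr.
    by rewrite /r; ring.
  apply: (le_trans (ler_cmodB _ _)); rewrite -!mulrA mulr_natl mulr2n lerD //.
    by apply: H; rewrite ?hs ?lexx ?y12.
  by apply: H; rewrite ?hs ?lexx ?y12.
have H2 : cmod (cint y1 y2 (fun t => F (x2 +i* t) - F (x1 +i* t)) -
    (y2 - y1)%:C * (l * (x2 - x1)%:C)) <= 2 * (2 * e * D) * (y2 - y1).
  apply: cint_approx => //; first by apply: (curveV cF); rewrite ?lexx ?x12.
  move=> s hs.
  have -> : F (x2 +i* s) - F (x1 +i* s) - l * (x2 - x1)%:C =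
      r (x2 +i* s) - r (x1 +i* s).
    have -> : (x2 - x1)%:C = x2 +i* s - (x1 +i* s) by apply: eqC; rewrite ?ReB ?ImB /= ?subrr.
    by rewrite /r; ring.
  apply: (le_trans (ler_cmodB _ _)); rewrite -!mulrA mulr_natl mulr2n lerD //.
    by apply: H; rewrite ?hs ?lexx ?x12.
  by apply: H; rewrite ?hs ?lexx ?x12.
rewrite /rectint.
set I1 := cint x1 x2 _ in H1 *; set I2 := cint y1 y2 _ in H2 *.
have -> : I1 + 'i * I2 = (I1 - (x2 - x1)%:C * (l * (0 +i* (y1 - y2)))) +
    'i * (I2 - (y2 - y1)%:C * (l * (x2 - x1)%:C)).
  have -> : 0 +i* (y1 - y2) = 'i * (y1 - y2)%:C.
    by apply: eqC; rewrite ?ReM ?ImM /=; ring.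
  by rewrite !rmorphB /=; ring.
apply: (le_trans (ler_cmodD _ _)); rewrite cmodM.
have -> : cmod ('i : C) = 1 by rewrite cmodE /= expr0n expr1n add0r sqrtr1.
lra.
Qed.

Lemma nested_intervals (u v : nat -> R) :
  (forall n, u n <= u n.+1) -> (forall n, v n.+1 <= v n) ->
  (forall n, u n <= v n) -> exists X, forall n, u n <= X <= v n.
Proof.
move=> uS vS uv.
have um m n : (m <= n)%N -> u m <= u n.
  by move=> /subnK <-; elim: (n - m)%N => [|k IH] //; apply: le_trans IH (uS _).
have vm m n : (m <= n)%N -> v n <= v m.
  by move=> /subnK <-; elim: (n - m)%N => [|k IH] //; apply: le_trans IH; exact: vS.
have ub m n : u m <= v n.
  apply: (le_trans (um _ _ (leq_maxl m n))); apply: le_trans (uv _) _.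
  exact: (vm _ _ (leq_maxr m n)).
exists (sup (range u)) => n; apply/andP; split.
  apply: ub_le_sup; last by exists n.
  by exists (v 0%N) => _ [m _ <-]; exact: ub.
by apply: ge_sup; [exists (u 0%N), 0%N|move=> _ [m _ <-]; exact: ub].
Qed.

(* Bisection into quarters, keeping one whose integral has at least a quarter
   of the modulus. *)
Theorem goursat F x1 x2 y1 y2 : x1 <= x2 -> y1 <= y2 ->
  (forall x y, x1 <= x <= x2 -> y1 <= y <= y2 -> exists l, cderiv F (x +i* y) l) ->
  rectint F x1 x2 y1 y2 = 0.
Proof.
move=> x12 y12 dF.
have cF : rect_continuous F x1 x2 y1 y2.
  by move=> x y hx hy; have [l] := dF _ _ hx hy; exact: cderiv_ccont.
pose a n := (x2 - x1) / 2 ^+ n; pose b n := (y2 - y1) / 2 ^+ n.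
have aS n : a n = a n.+1 + a n.+1.
  by rewrite /a exprSr; field; rewrite expf_neq0.
have bS n : b n = b n.+1 + b n.+1.
  by rewrite /b exprSr; field; rewrite expf_neq0.
have a0 n : 0 <= a n by rewrite divr_ge0 ?subr_ge0 ?exprn_ge0.
have b0 n : 0 <= b n by rewrite divr_ge0 ?subr_ge0 ?exprn_ge0.
pose ok n (p : R * R) :=
  [/\ x1 <= p.1, p.1 + a n <= x2, y1 <= p.2 & p.2 + b n <= y2].
pose I n (p : R * R) := rectint F p.1 (p.1 + a n) p.2 (p.2 + b n).
(* The validity of the rectangle sits inside the existential, so that [choice] gives a function on
   all pairs and the sequence can be built before it is proved valid. *)
have step (q : nat * (R * R)) : exists p : R * R, ok q.1 q.2 ->
    [/\ q.2.1 <= p.1 <= q.2.1 + a q.1.+1, q.2.2 <= p.2 <= q.2.2 + b q.1.+1 &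
      cmod (I q.1 q.2) <= 4 * cmod (I q.1.+1 p)].
  case: q => n [x y] /=.
  have [H|H] := pselect (ok n (x, y)); last by exists (0, 0).
  case: (H) => /= h1 h2 h3 h4.
  have [|p [p1 p2 p3]] := @rectint_bisect F x y _ _ (a0 n.+1) (b0 n.+1).
    by rewrite -aS -bS; apply: rect_continuousS cF.
  by exists p => _; split => //; rewrite /I /= aS bS.
have [s Hs] := choice step.
pose p := fix p n := if n is m.+1 then s (m, p m) else (x1, y1).
have okp n : ok n (p n).
  elim: n => [|n IH]; first by split; rewrite /= /a /b ?divr1 ?subrKC.
  have [/= /andP[h1 h2] /andP[h3 h4] _] := Hs (n, p n) IH.
  case: IH => i1 i2 i3 i4; have := aS n; have := bS n.
  by move=> e1 e2; split => /=; lra.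
have pS n : [/\ (p n).1 <= (p n.+1).1 <= (p n).1 + a n.+1,
    (p n).2 <= (p n.+1).2 <= (p n).2 + b n.+1 &
    cmod (I n (p n)) <= 4 * cmod (I n.+1 (p n.+1))].
  exact: (Hs (n, p n) (okp n)).
have [X HX] : exists X, forall n, (p n).1 <= X <= (p n).1 + a n.
  apply: nested_intervals => n; last by rewrite lerDl.
    by case: (pS n) => /andP[].
  by case: (pS n) => /andP[_ h] _ _; have := aS n; lra.
have [Y HY] : exists Y, forall n, (p n).2 <= Y <= (p n).2 + b n.
  apply: nested_intervals => n; last by rewrite lerDl.
    by case: (pS n) => _ /andP[].
  by case: (pS n) => _ /andP[_ h] _; have := bS n; lra.
have I0 : rectint F x1 x2 y1 y2 = I 0%N (p 0%N).
  by rewrite /I /= /a /b !divr1 !subrKC.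
have I4 n : cmod (I 0%N (p 0%N)) <= 4 ^+ n * cmod (I n (p n)).
  elim: n => [|n IH]; first by rewrite mul1r.
  apply: (le_trans IH); rewrite exprSr -mulrA ler_wpM2l ?exprn_ge0 //.
  by case: (pS n).
have [l /cderivP Hl] : exists l, cderiv F (X +i* Y) l.
  have := HX 0%N; have := HY 0%N; rewrite /= /a /b !divr1 !subrKC.
  by move=> h1 h2; exact: dF.
apply/eqP; rewrite I0 -cmod_eq0 eq_le cmod_ge0 andbT.
pose S := (x2 - x1) + (y2 - y1).
have S0 : 0 <= S by rewrite addr_ge0 ?subr_ge0.
apply/ler_addgt0Pr => e e0; rewrite add0r.
(* [4 ^+ n] will cancel against two factors [S / 2 ^+ n], leaving [4 * e1 * S ^+ 2]; the added 1
   covers a degenerate rectangle. *)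
pose e1 := e / (4 * S ^+ 2 + 1).
have q0 : 0 < 4 * S ^+ 2 + 1 by rewrite ltr_wpDl // mulr_ge0 // sqr_ge0.
have e10 : 0 < e1 by rewrite divr_gt0.
have [d d0 Hd] := Hl _ e10.
have [n Hn] : exists n, S / 2 ^+ n < d.
  exists (Num.bound (S / d)).
  rewrite ltr_pdivrMr ?exprn_gt0 // mulrC -ltr_pdivrMr //.
  apply: (lt_trans (archi_boundP _)); first by rewrite divr_ge0 // ltW.
  by rewrite -natrX ltr_nat ltn_expl.
have abS : a n + b n = S / 2 ^+ n by rewrite -mulrDl.
have wn x y : (p n).1 <= x <= (p n).1 + a n -> (p n).2 <= y <= (p n).2 + b n ->
    cmod (x +i* y - X +i* Y) <= S / 2 ^+ n.
  move=> hx hy; apply: (le_trans (ler_cmod_ReIm _)); rewrite -abS ReB ImB /=.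
  have := HX n; have := HY n.
  by move=> hX hY; apply: lerD; rewrite ler_norml; lra.
have := @rectint_small F (p n).1 ((p n).1 + a n) (p n).2 ((p n).2 + b n)
  (X +i* Y) l e1 (S / 2 ^+ n).
rewrite !lerDl a0 b0 => /(_ isT isT) B.
have {}B : cmod (I n (p n)) <= 4 * e1 * (S / 2 ^+ n) * (S / 2 ^+ n).
  rewrite -[X in _ <= _ * X]abS.
  have -> : a n + b n = ((p n).1 + a n - (p n).1) + ((p n).2 + b n - (p n).2) by ring.
  apply: B.
    by case: (okp n) => *; apply: rect_continuousS cF.
  move=> x y hx hy; have wxy := wn _ _ hx hy.
  apply: (le_trans (Hd _ (le_lt_trans wxy Hn))).
  by rewrite ler_wpM2l // ltW.
apply: (le_trans (I4 n)); apply: (le_trans (ler_wpM2l _ B)).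
  by rewrite exprn_ge0.
have -> : 4 ^+ n * (4 * e1 * (S / 2 ^+ n) * (S / 2 ^+ n)) = e1 * (4 * S ^+ 2).
  have -> : (4 : R) ^+ n = 2 ^+ n * 2 ^+ n by rewrite -exprMn; congr (_ ^+ _); ring.
  by field; rewrite expf_neq0.
by rewrite /e1 mulrAC ler_pdivrMr // ler_wpM2l ?ltW // ltrDl.
Qed.

End Goursat.

(** * Circular means and Cauchy's formula *)

Section Cauchy.
Context {R : realType}.
Local Notation C := R[i].
Implicit Types (f : C -> C) (z w : C) (r s t : R).

(** Compactness of the segment turns pointwise radii into a single one; this provides uniform
    continuity along a circle. *)
Lemma segment_tube a b (P : R -> R -> Prop) :
  (forall t, a <= t <= b -> exists2 d : R, 0 < d &
     forall s h, `|s - t| < d -> `|h| < d -> P h s) ->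
  exists2 d : R, 0 < d & forall h s, `|h| < d -> a <= s <= b -> P h s.
Proof.
move=> H.
have /compact_near_coveringP K := @segment_compact R a b.
have /near_realP[d d0 Hd] : \forall h \near (0 : R), `[a, b]%classic `<=` P h.
  apply: (K R (nbhs (0 : R)) P) => t; rewrite /= in_itv /= => /H[d d0 Hd].
  exists ([set s | `|s - t| < d], [set h | `|h| < d]) => /=.
    split; apply/near_realP; exists d => // s; by rewrite subr0.
  by move=> [s h] /= [] hs hh; exact: Hd.
exists d => // h s hd hs; apply: Hd; first by rewrite subr0.
by rewrite /= in_itv.
Qed.

Lemma twopi_ge0 : 0 <= 2 * pi :> R.
Proof. by rewrite mulr_ge0 ?pi_ge0. Qed.

Lemma twopi_gt0 : 0 < 2 * pi :> R.
Proof. by rewrite mulr_gt0 ?pi_gt0. Qed.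

Lemma twopi_div (e : R) : 2 * (e / (4 * pi)) * (2 * pi) = e.
Proof.
have : (pi : R) != 0 by rewrite gt_eqF ?pi_gt0.
by move: (pi : R) => p p0; field.
Qed.

(** This is [2 * pi] times the circular mean, that is, integration against [dz / (i z)]; hence the
    factor [w] in the integrand of Cauchy's formula below. *)
Definition circ f r : C := cint 0 (2 * pi) (fun t => f (r%:C * cis t)).

Lemma cmod_circle r t : 0 <= r -> cmod (r%:C * cis t : C) = r.
Proof. by move=> r0; rewrite cmodM cmod_cis mulr1 cmodr ger0_norm. Qed.

Lemma rcont_circle f r t : ccont f (r%:C * cis t) ->
  rcont (fun s => f (r%:C * cis s)) t.
Proof.
move=> cf; apply: rcont_comp cf _.
by apply: rcontM; [exact: rcont_cst|exact: rcont_cis].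
Qed.

Definition circle_continuous f r := forall z, cmod z = r -> ccont f z.

Lemma curve_circle f r : 0 <= r -> circle_continuous f r ->
  curve 0 (2 * pi) (fun t => f (r%:C * cis t)).
Proof. by move=> r0 cf t _; apply: rcont_circle; apply: cf; exact: cmod_circle. Qed.

Lemma eq_circ f g r : 0 <= r -> (forall z, cmod z = r -> f z = g z) ->
  circ f r = circ g r.
Proof. by move=> r0 fg; apply: eq_cint => t _; rewrite fg ?cmod_circle. Qed.

Lemma circ_cst z r : circ (fun=> z) r = (2 * pi)%:C * z.
Proof. by rewrite /circ cint_cst ?twopi_ge0 // subr0. Qed.

Lemma circD f g r : 0 <= r -> circle_continuous f r -> circle_continuous g r ->
  circ (fun z => f z + g z) r = circ f r + circ g r.
Proof. by move=> r0 cf cg; apply: cintD; exact: curve_circle. Qed.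

Lemma circZ f a r : 0 <= r -> circle_continuous f r ->
  circ (fun z => a * f z) r = a * circ f r.
Proof. by move=> r0 cf; apply: cintZ; exact: curve_circle. Qed.

(** [4 * pi] is the length [2 * pi] times the 2 of [ler_cmod_cint]. *)
Lemma ler_circ f r M : 0 <= r -> circle_continuous f r ->
  (forall z, cmod z = r -> cmod (f z) <= M) -> cmod (circ f r) <= 4 * pi * M.
Proof.
move=> r0 cf fM; have H : forall t, 0 <= t <= 2 * pi -> cmod (f (r%:C * cis t)) <= M.
  by move=> t _; apply: fM; rewrite cmod_circle.
apply: (le_trans (ler_cmod_cint twopi_ge0 (curve_circle r0 cf) H)).
by rewrite subr0 le_eqVlt; apply/orP; left; apply/eqP; ring.
Qed.

(** In the coordinate [w] the annulus is a rectangle of height [2 * pi]: its horizontal sides cancel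
    by periodicity of [cexp], and its vertical sides are the two circles. *)
Lemma circ_const f r1 r2 : 0 < r1 -> r1 <= r2 ->
  (forall z, r1 <= cmod z <= r2 -> exists l, cderiv f z l) ->
  circ f r2 = circ f r1.
Proof.
move=> r10 r12 df; have r20 := lt_le_trans r10 r12.
pose F w := f (cexp w).
have l12 : ln r1 <= ln r2 by rewrite ler_ln ?posrE.
have df' (x y : R) : ln r1 <= x <= ln r2 -> exists l, cderiv F (x +i* y) l.
  move=> /andP[x1 x2].
  have [|l Hl] := df (cexp (x +i* y)).
    by rewrite cmod_cexp /= -[r1]lnK ?posrE // -[r2]lnK ?posrE // !ler_expR x1.
  by exists (l * cexp (x +i* y)); apply: cderiv_comp Hl; exact: cderiv_cexp.
have cV (x : R) : ln r1 <= x <= ln r2 -> curve 0 (2 * pi) (fun t => F (x +i* t)).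
  move=> hx t _; apply: rcontV_line; have [l] := df' x t hx.
  exact: cderiv_ccont.
have /eqP := goursat l12 twopi_ge0 (fun x y hx _ => df' x y hx).
rewrite /rectint (_ : cint (ln r1) _ _ = 0); last first.
  rewrite -[RHS](mulr0 (ln r2 - ln r1)%:C) -cint_cst //; apply: eq_cint => t _.
  by rewrite /F /cexp /= cis_2pi cis0 subrr.
rewrite add0r cintB; try by apply: cV; rewrite ?lexx ?l12.
rewrite mulf_eq0 subr_eq0 => /orP[|/eqP E].
  by rewrite eq_complex /= oner_eq0 andbF.
rewrite /circ (eq_cint (h := fun t => F (ln r2 +i* t))); last first.
  by move=> t _; rewrite /F cexp_ln.
by rewrite E; apply: eq_cint => t _; rewrite /F cexp_ln.
Qed.

Lemma cmod_small z : (forall e : R, 0 < e -> cmod z <= e) -> z = 0.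
Proof.
move=> H; apply/eqP; rewrite -cmod_eq0 eq_le cmod_ge0 andbT.
by apply/ler_addgt0Pr => e /H; rewrite add0r.
Qed.

(** The integral is the same on arbitrarily small circles, where [f] is close to [f 0]. *)
Theorem mean_value f r : 0 < r ->
  (forall z, cmod z <= r -> exists l, cderiv f z l) ->
  circ f r = (2 * pi)%:C * f 0.
Proof.
move=> r0 df; apply/eqP; rewrite -subr_eq0; apply/eqP; apply: cmod_small => e e0.
have pi0 : 0 < 4 * pi :> R by rewrite mulr_gt0 ?pi_gt0.
have [l /cderiv_ccont cf] := df 0 (ltac:(by rewrite cmod0 ltW)).
have [d d0 Hd] := cf _ (divr_gt0 e0 pi0).
pose m := Num.min r (d / 2).
have m0 : 0 < m by rewrite lt_min r0 divr_gt0.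
have mr : m <= r by rewrite ge_min lexx.
have md : m < d by rewrite gt_min; apply/orP; right; lra.
rewrite (circ_const m0 mr); last by move=> z /andP[_]; exact: df.
have cm : circle_continuous f m.
  by move=> z zm; have [|k] := df z; [rewrite zm|exact: cderiv_ccont].
have := @cint_approx R 0 (2 * pi) _ (f 0) (e / (4 * pi)) twopi_ge0 (curve_circle (ltW m0) cm).
rewrite subr0 => H; apply: (le_trans (H _)).
  move=> t _; apply/ltW/Hd; rewrite subr0 cmod_circle //; exact: ltW.
by rewrite twopi_div.
Qed.

(** Used to cross the circle through the point [z] of Cauchy's formula, where the slope of [f] is
    only known to be continuous. *)
Lemma circ_continuous f r e : 0 < e -> circle_continuous f r -> 0 < r ->
  exists2 d : R, 0 < d & forall s, 0 < s -> `|s - r| < d ->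
    circle_continuous f s -> cmod (circ f s - circ f r) <= e.
Proof.
move=> e0 cf r0; have r0' := ltW r0.
have pi0 : 0 < 4 * pi :> R by rewrite mulr_gt0 ?pi_gt0.
pose e1 := e / (4 * pi); have e10 : 0 < e1 by rewrite divr_gt0.
have [|d d0 Hd] := @segment_tube 0 (2 * pi)
    (fun h t => cmod (f ((r + h)%:C * cis t) - f (r%:C * cis t)) < e1).
  have e120 : 0 < e1 / 2 by rewrite divr_gt0.
  move=> t _; have [d d0 Hd] := cf _ (cmod_circle t r0') _ e120.
  have := @continuous_cis R t; move/rcontP.
  (* With [r + d] in the denominator, [r] times this is below [d / 2] whatever the size of [r]. *)
  have dr : 0 < d / (2 * (r + d)) by rewrite divr_gt0 // mulr_gt0 // addr_gt0.
  move=> /(_ _ dr)[d' d'0 Hd'].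
  exists (Num.min d' (d / 2)); first by rewrite lt_min d'0 divr_gt0.
  move=> s h; rewrite !lt_min => /andP[s1 _] /andP[_ h2].
  have {s1} := Hd' s s1 => s1.
  have K k : `|k| < d / 2 -> cmod ((r + k)%:C * cis s - r%:C * cis t) < d.
    move=> kd.
    have -> : (r + k)%:C * cis s - r%:C * cis t = k%:C * cis s + r%:C * (cis s - cis t).
      by rewrite rmorphD /=; ring.
    apply: (le_lt_trans (ler_cmodD _ _)); rewrite !cmodM cmod_cis mulr1 !cmodr.
    rewrite (ger0_norm r0') (splitr d) ltr_leD //.
    apply: (le_trans (ler_wpM2l r0' (ltW s1))).
    have rd : 0 < r + d by rewrite addr_gt0.
    have -> : r * (d / (2 * (r + d))) = d / 2 * (r / (r + d)).
      by field; rewrite gt_eqF.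
    rewrite ler_piMr ?divr_ge0 ?ltW // ltr_pdivrMr // mul1r ltrDl //.
  have := Hd _ (K h h2); have := K 0; rewrite normr0 divr_gt0 // addr0 => /(_ isT) /Hd.
  set A := f _; set B := f (r%:C * cis t); set D := f _ => AB DB.
  have -> : D - A = (D - B) - (A - B) by ring.
  by apply: (le_lt_trans (ler_cmodB _ _)); rewrite (splitr e1) ltrD.
exists d => // s s0 sr cs; have s0' := ltW s0.
rewrite /circ -cintB; try exact: curve_circle.
have cc : curve 0 (2 * pi) (fun t => f (s%:C * cis t) - f (r%:C * cis t)).
  by move=> t ht; apply: rcontB; [exact: (curve_circle s0' cs)|exact: (curve_circle r0' cf)].
apply: (le_trans (ler_cmod_cint (M := e1) twopi_ge0 cc _)).
  by move=> t ht; have := Hd _ _ sr ht; rewrite subrKC => /ltW.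
by rewrite subr0 /e1 twopi_div.
Qed.

Lemma cderiv_sub_inv z w : w != z -> cderiv (fun v => (v - z)^-1) w (- ((w - z) * (w - z))^-1).
Proof.
move=> wz.
have H : cderiv (fun v => v - z) w 1.
  by rewrite -[1]addr0; apply: cderivD; [exact: cderiv_id|exact: cderiv_cst].
rewrite -[X in cderiv _ _ X]mulr1.
apply: (cderiv_comp (g := fun v => v^-1) H).
by apply: cderivV; rewrite subr_eq0.
Qed.

(** Beyond [cmod z] the integral does not depend on the radius, and it tends to 0 as the radius
    grows; at radius [s] the integrand is at most [e / (4 * pi)]. *)
Lemma circ_inv z r : cmod z < r -> circ (fun w => (w - z)^-1) r = 0.
Proof.
move=> zr; have r0 : 0 < r by apply: le_lt_trans zr; exact: cmod_ge0.
apply: cmod_small => e e0.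
have pi0 : 0 < 4 * pi :> R by rewrite mulr_gt0 ?pi_gt0.
pose s := r + 4 * pi / e.
have q0 : 0 < 4 * pi / e by rewrite divr_gt0.
have rs : r <= s by rewrite lerDl ltW.
have s0 : 0 < s by apply: lt_le_trans rs.
have wz w : r <= cmod w -> w != z.
  by move=> h; apply: contraTneq h => ->; rewrite -ltNge.
rewrite -(circ_const r0 rs); last first.
  by move=> w /andP[/wz h _]; eexists; exact: cderiv_sub_inv.
apply: (le_trans (ler_circ (M := e / (4 * pi)) (ltW s0) _ _)).
- move=> w ws; have h : w != z by apply: wz; rewrite ws.
  exact: (cderiv_ccont (cderiv_sub_inv h)).
- move=> w ws; rewrite cmodV -[e / _]invrK lef_pV2 ?posrE ?invr_gt0 ?divr_gt0 //; last first.
    by rewrite cmod_gt0 subr_eq0 wz // ws.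
  rewrite invf_div; apply: le_trans (lerB_cmod _ _); rewrite ws /s.
  by rewrite addrAC lerDr subr_ge0 ltW.
- by rewrite mulrC divfK // gt_eqF.
Qed.

(* The slope of [f] at [z] is holomorphic off [z] and continuous at [z]; its
   circular means are constant on either side of the circle through [z], and
   agree there by continuity. *)
Theorem cauchy_formula f z r : cdiff f -> cmod z < r ->
  circ (fun w => f w * w / (w - z)) r = (2 * pi)%:C * f z.
Proof.
move=> df zr; have r0 : 0 < r by apply: le_lt_trans zr; exact: cmod_ge0.
have [l [phi [_ cphi E]]] := df z.
have dphi w : w != z -> exists l, cderiv phi w l.
  move=> wz; have [k Hk] := df w.
  have H := cderivM (cderivD Hk (cderiv_cst (- f z) w)) (cderiv_sub_inv wz).
  eexists; apply: (cderiv_near _ H).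
  apply/near_cmodP; exists (cmod (w - z)); first by rewrite cmod_gt0 subr_eq0.
  move=> v vw; have vz : v != z by apply: contraTneq vw => ->; rewrite cmodB ltxx.
  by rewrite E addrC addKr mulfK // subr_eq0.
have cphi' w : ccont phi w.
  have [->//|/dphi[k]] := eqVneq w z; exact: cderiv_ccont.
pose psi w := phi w * w.
have dpsi w : w != z -> exists l, cderiv psi w l.
  by move=> /dphi[k Hk]; eexists; apply: cderivM Hk (cderiv_id _).
have cpsi w : ccont psi w by apply: ccontM => //; exact: ccont_id.
(* [psi] contains the factor [w], so its mean on a circle inside the one through [z] is
   [psi 0 = 0]. *)
have small s : 0 < s -> s < cmod z -> circ psi s = 0.
  move=> s0 sz; rewrite mean_value //; first by rewrite /psi !mulr0.
  by move=> w ws; apply: dpsi; apply: contraTneq ws => ->; rewrite -ltNge.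
have key : circ psi r = 0.
  have [z0|z0] := eqVneq z 0.
    rewrite (eq_circ (g := fun w => f w - f z) (ltW r0)); last first.
      by move=> w _; rewrite /psi E z0 subr0 addrC addKr.
    rewrite mean_value //; first by rewrite z0 subrr mulr0.
    by move=> w _; have [k Hk] := df w; eexists; apply: cderivD Hk (cderiv_cst _ _).
  have z0' : 0 < cmod z by rewrite cmod_gt0.
  apply: cmod_small => e e0; have e20 : 0 < e / 2 by rewrite divr_gt0.
  have [d d0 Hd] := circ_continuous e20 (fun w _ => cpsi w) z0'.
  (* The radii [cmod z - m] and [cmod z + m] avoid [z], lie between 0 and [r], and are within [d] of
     [cmod z]. *)
  pose m := Num.min (d / 2) (Num.min (cmod z / 2) (r - cmod z)).
  have m0 : 0 < m by rewrite !lt_min !divr_gt0 //= subr_gt0.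
  have md : m < d by rewrite gt_min; apply/orP; left; lra.
  have mz : m < cmod z by rewrite !gt_min; apply/orP; right; apply/orP; left; lra.
  have mr : cmod z + m <= r by rewrite -lerBrDl !ge_min lexx !orbT.
  have H1 := Hd (cmod z - m); have H2 := Hd (cmod z + m).
  rewrite subr_gt0 mz addrAC subrr add0r normrN gtr0_norm // in H1.
  rewrite addrAC subrr add0r gtr0_norm // addr_gt0 // in H2.
  have {}H1 := H1 isT md (fun w _ => cpsi w).
  have {}H2 := H2 isT md (fun w _ => cpsi w).
  rewrite small ?subr_gt0 // in H1; last by rewrite gtrBl.
  rewrite (circ_const (r1 := cmod z + m)) //; first last.
  - move=> w /andP[h _]; apply: dpsi; apply: contraTneq h => ->.
    by rewrite -ltNge ltrDl.
  - by rewrite addr_gt0.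
  rewrite -[circ _ _](subrK (circ psi (cmod z))).
  apply: (le_trans (ler_cmodD _ _)); rewrite (splitr e) lerD //.
  by rewrite -cmodN -[- _]add0r.
have wz w : cmod w = r -> w != z.
  by move=> wr; apply: contraTneq zr => <-; rewrite wr ltxx.
have cinv : circle_continuous (fun w => (w - z)^-1) r.
  by move=> w /wz h; exact: (cderiv_ccont (cderiv_sub_inv h)).
have r0' := ltW r0.
(* As [w / (w - z) = 1 + z / (w - z)], there remain besides [psi] a constant and a multiple of the
   kernel killed by [circ_inv]. *)
rewrite (eq_circ (g := fun w => psi w + (f z + f z * z * (w - z)^-1)) r0'); last first.
  by move=> w /wz h; rewrite /psi E; field; rewrite subr_eq0.
have cc : circle_continuous (fun w => f z * z * (w - z)^-1) r.
  by move=> w hw; apply: ccontM; [exact: ccont_cst|exact: cinv].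
rewrite circD //; last by move=> w hw; apply: ccontD; [exact: ccont_cst|exact: cc].
rewrite key add0r circD //; last by move=> w _; exact: ccont_cst.
by rewrite circ_cst circZ // circ_inv // mulr0 addr0.
Qed.

End Cauchy.

(** * Maximum modulus, higher derivatives and orders of zeros *)

Section EntireFunctions.
Context {R : realType}.
Local Notation C := R[i].
Implicit Types (f g : C -> C) (z w a : C) (r s t M : R).

Lemma unbounded_powers (q K : R) : 1 < q -> exists n, K < q ^+ n.
Proof.
move=> q1; have q0 : 0 < q - 1 by rewrite subr_gt0.
have bern n : 1 + n%:R * (q - 1) <= q ^+ n.
  elim: n => [|n IH]; first by rewrite mul0r addr0.
  rewrite exprS; apply: (@le_trans _ _ (q * (1 + n%:R * (q - 1)))); last first.
    by rewrite ler_wpM2l // (le_trans ler01) // ltW.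
  rewrite -subr_ge0 [X in 0 <= X](_ : _ = n%:R * (q - 1) * (q - 1)).
    by rewrite !mulr_ge0 ?ler0n // ltW.
  by rewrite -natr1; ring.
exists (Num.bound (`|K| / (q - 1))); apply: lt_le_trans (bern _).
rewrite ltr_pwDl // (le_trans (ler_norm K)) // -ler_pdivrMr // ltW //.
by apply: archi_boundP; rewrite divr_ge0 // ltW.
Qed.

(* Cauchy's formula for the powers of [f]: the constant it brings in disappears
   on taking [n]-th roots. *)
Theorem maximum_modulus f r M z : cdiff f ->
  (forall w, cmod w = r -> cmod (f w) <= M) -> cmod z < r -> cmod (f z) <= M.
Proof.
move=> df fM zr; have r0 : 0 < r by apply: le_lt_trans zr; exact: cmod_ge0.
have M0 : 0 <= M.
  by apply: le_trans (fM r%:C _); rewrite ?cmod_ge0 // cmodr gtr0_norm.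
have rz : 0 < r - cmod z by rewrite subr_gt0.
have wz w : cmod w = r -> w - z != 0.
  move=> wr; rewrite subr_eq0; apply: contraTneq zr => <-.
  by rewrite wr ltxx.
pose K := 2 * r / (r - cmod z).
have H n : cmod (f z) ^+ n <= K * M ^+ n.
  have := cauchy_formula (cdiffX n df) zr => E.
  have : cmod (circ (fun w => f w ^+ n * w / (w - z)) r) <=
      4 * pi * (M ^+ n * r * (r - cmod z)^-1).
    apply: ler_circ; first exact: ltW.
      move=> w wr; apply: ccontM.
        by apply: ccontM; [apply: cdiff_ccont; exact: cdiffX|exact: ccont_id].
      apply: ccontV; first exact: wz.
      by apply: ccontD; [exact: ccont_id|exact: ccont_cst].
    move=> w wr; rewrite !cmodM cmodX cmodV wr ler_pM //.
    - by rewrite mulr_ge0 ?exprn_ge0 ?cmod_ge0 ?(ltW r0).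
    - by rewrite invr_ge0 cmod_ge0.
    - by rewrite ler_wpM2r ?(ltW r0) // lerXn2r ?nnegrE ?cmod_ge0 ?fM.
    - rewrite lef_pV2 ?posrE ?cmod_gt0 ?wz // -wr; exact: lerB_cmod.
  rewrite E cmodM cmodX cmodr ger0_norm ?twopi_ge0 //.
  have -> : 4 * pi * (M ^+ n * r * (r - cmod z)^-1) = 2 * pi * (K * M ^+ n).
    by rewrite /K; move: (pi : R) => p; field; rewrite gt_eqF.
  by rewrite ler_pM2l // twopi_gt0.
rewrite leNgt; apply/negP => Mf.
have [M00|M00] := eqVneq M 0.
  by have := H 1%N; rewrite !expr1 M00 mulr0 leNgt -{1}M00 Mf.
have Mp : 0 < M by rewrite lt_def M00.
have [|n Hn] := @unbounded_powers (cmod (f z) / M) K.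
  by rewrite ltr_pdivlMr // mul1r.
have := H n; rewrite -ler_pdivrMr ?exprn_gt0 // -expr_div_n leNgt.
by rewrite Hn.
Qed.

Lemma circle_bounded f r : 0 <= r -> circle_continuous f r ->
  exists2 M, 0 < M & forall w, cmod w = r -> cmod (f w) <= M.
Proof.
move=> r0 cf.
have [|c _ Hc] := @EVT_max R (fun t => cmod (f (r%:C * cis t))) 0 (2 * pi) twopi_ge0.
  apply: continuous_in_subspaceT => t; rewrite inE /= in_itv => ht.
  by apply: rcont_cmod; exact: (curve_circle r0 cf).
exists (cmod (f (r%:C * cis c)) + 1); first by rewrite ltr_wpDl ?cmod_ge0.
move=> w wr; have [r00|r00] := eqVneq r 0.
  move/eqP: wr; rewrite r00 cmod_eq0 => /eqP ->.
  by rewrite mul0r lerDl.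
have rC : r%:C != 0 by rewrite -cmod_eq0 cmodr normr_eq0.
have [|t ht tw] := @cis_onto R (w / r%:C).
  by rewrite cmodM cmodV wr cmodr ger0_norm // divff.
have := Hc t; rewrite in_itv tw [_ * (w / _)]mulrC divfK // => /(_ ht).
by move=> /le_trans; apply; rewrite lerDl.
Qed.

(** Differentiation under the integral sign: a remainder quadratic in [h], uniformly on the unit
    circle, integrates to a remainder quadratic in [h]. *)
Lemma cderiv_circ u (k : C -> C -> C) (k' : C -> C) z (d B : R) :
  circle_continuous u 1 -> 0 < d ->
  (forall h, cmod h < d -> circle_continuous (fun w => k w (z + h)) 1) ->
  circle_continuous k' 1 ->
  (forall w h, cmod w = 1 -> cmod h < d ->
    cmod (k w (z + h) - k w z - k' w * h) <= B * cmod h ^+ 2) ->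
  cderiv (fun v => circ (fun w => u w * k w v) 1) z (circ (fun w => u w * k' w) 1).
Proof.
move=> cu d0 ck ck' H; have [M M0 HM] := circle_bounded ler01 cu.
apply/cderivP => e e0.
pose L := 4 * pi * (M * `|B|) + 1.
have L0 : 0 < L by rewrite ltr_wpDl ?cmod_ge0 // mulr_ge0 ?mulr_ge0 ?pi_ge0 // ltW.
exists (Num.min d (e / L)); first by rewrite lt_min d0 divr_gt0.
move=> v; rewrite lt_min; set h := v - z => /andP[hd he].
have -> : v = z + h by rewrite /h subrKC.
have cz : circle_continuous (fun w => k w z) 1.
  by have := ck 0; rewrite addr0 cmod0; apply.
have cA := ck h hd.
have cuM (G : C -> C) : circle_continuous G 1 -> circle_continuous (fun w => u w * G w) 1.
  by move=> cG w hw; apply: ccontM; [exact: cu|exact: cG].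
have cN (G : C -> C) a : circle_continuous G 1 -> circle_continuous (fun w => a * G w) 1.
  by move=> cG w hw; apply: ccontM; [exact: ccont_cst|exact: cG].
have -> : circ (fun w => u w * k w (z + h)) 1 - circ (fun w => u w * k w z) 1 -
    circ (fun w => u w * k' w) 1 * h =
    circ (fun w => u w * (k w (z + h) - k w z - k' w * h)) 1.
  rewrite -[- circ (fun w => u w * k w z) 1]mulN1r -[circ (fun w => u w * k' w) 1 * h]mulrC.
  rewrite -mulNr -!circZ // ?ler01 -?circD //; try exact: cuM.
  - by apply: eq_circ => // w _; ring.
  - by move=> w hw; apply: ccontD; [exact: cuM|apply: cN => //; exact: cuM].
  - by apply: cN; exact: cuM.
  - by apply: cN; exact: cuM.
apply: (le_trans (ler_circ (M := M * (`|B| * cmod h ^+ 2)) ler01 _ _)).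
- apply: cuM => w hw; apply: ccontD; last first.
    apply: ccontN; apply: ccontM; [exact: ck'|exact: ccont_cst].
  by apply: ccontD; [exact: cA|apply: ccontN; exact: cz].
- move=> w hw; rewrite cmodM ler_pM ?exprn_ge0 ?cmod_ge0 //; first exact: HM.
  apply: (le_trans (H _ _ hw hd)); rewrite ler_wpM2r ?exprn_ge0 ?cmod_ge0 //.
  exact: ler_norm.
rewrite mulrA expr2 !mulrA ler_wpM2r ?exprn_ge0 ?cmod_ge0 //.
rewrite -(mulrA (4 * pi)); apply: (@le_trans _ _ (L * cmod h)).
  by rewrite ler_wpM2r ?exprn_ge0 ?cmod_ge0 // lerDl.
by rewrite mulrC -ler_pdivlMr // ltW.
Qed.

Lemma circle_continuous_inv z r : cmod z < r ->
  circle_continuous (fun w => (w - z)^-1) r.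
Proof.
move=> zr w wr; have h : w != z by apply: contraTneq zr => <-; rewrite wr ltxx.
exact: (cderiv_ccont (cderiv_sub_inv h)).
Qed.

Lemma cmod_sub_half z w : cmod w = 1 -> cmod z <= 1/2 -> 1/2 <= cmod (w - z).
Proof. by move=> w1 z1; apply: le_trans (lerB_cmod _ _); rewrite w1; lra. Qed.

Lemma cderiv_cauchy_kernel u z : circle_continuous u 1 -> cmod z < 1/2 ->
  cderiv (fun v => circ (fun w => u w * (w - v)^-1) 1) z
         (circ (fun w => u w * ((w - z)^-1 ^+ 2)) 1).
Proof.
move=> cu z1.
have small h : cmod h < 1/2 - cmod z -> cmod (z + h) < 1/2.
  by move=> hd; apply: le_lt_trans (ler_cmodD _ _) _; lra.
(* The remainder is [h ^+ 2] times three inverses of numbers of modulus at least [1/2], hence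
   [8 = 2 ^+ 3]. *)
apply: (@cderiv_circ _ (fun w v => (w - v)^-1) _ _ (1/2 - cmod z) 8) => //.
- by rewrite subr_gt0.
- by move=> h /small hh; apply: circle_continuous_inv; apply: lt_trans hh _; lra.
- move=> w hw; have : ccont (fun w => (w - z)^-1) w.
    by apply: (@circle_continuous_inv _ 1) => //; lra.
  by move=> cc; exact: (ccontM cc cc).
- move=> w h w1 hd.
  have a2 : 1/2 <= cmod (w - z) by apply: cmod_sub_half; rewrite // ltW.
  have b2 : 1/2 <= cmod (w - (z + h)) by apply: cmod_sub_half; rewrite // ltW // small.
  have a0 : w - z != 0 by rewrite -cmod_gt0; lra.
  have b0 : w - (z + h) != 0 by rewrite -cmod_gt0; lra.
  have -> : (w - (z + h))^-1 - (w - z)^-1 - (w - z)^-1 ^+ 2 * h =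
      (w - z)^-1 ^+ 2 * (w - (z + h))^-1 * h ^+ 2.
    by field; rewrite a0 b0.
  rewrite 2!cmodM !cmodX !cmodV ler_wpM2r ?exprn_ge0 ?cmod_ge0 //.
  have i1 : (cmod (w - z))^-1 <= 2 by rewrite -[2]invrK lef_pV2 ?posrE; lra.
  have i2 : (cmod (w - (z + h)))^-1 <= 2 by rewrite -[2]invrK lef_pV2 ?posrE; lra.
  rewrite [8](_ : _ = 2 ^+ 2 * 2); last by ring.
  by rewrite ler_pM ?exprn_ge0 ?invr_ge0 ?cmod_ge0 ?lerXn2r ?nnegrE ?invr_ge0 ?cmod_ge0.
Qed.

Lemma cderiv_cauchy_kernel2 u : circle_continuous u 1 ->
  cderiv (fun v => circ (fun w => u w * ((w - v)^-1 ^+ 2)) 1) 0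
         (circ (fun w => u w * (2 * w^-1 ^+ 3)) 1).
Proof.
move=> cu.
(* [16 = 4 * 2 ^+ 2]: on the unit circle [3 * w - 2 * h] has modulus at most 4, and [(w - h)^-1] at
   most 2. *)
apply: (@cderiv_circ _ (fun w v => (w - v)^-1 ^+ 2) _ _ (1/2) 16) => //.
- by move=> h hh w hw; have : ccont (fun w => (w - (0 + h))^-1) w;
     [apply: (@circle_continuous_inv _ 1) => //; rewrite add0r; lra|move=> cc; exact: (ccontM cc cc)].
- move=> w hw; apply: ccontM; first exact: ccont_cst.
  have cc : ccont (fun w => w^-1) w.
    by apply: ccontV; [rewrite -cmod_gt0 hw|exact: ccont_id].
  apply: (@ccontM _ _ (fun w => w^-1 ^+ 2)) => //.
  exact: (ccontM cc cc).
- move=> w h w1 hd; rewrite add0r subr0.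
  have b2 : 1/2 <= cmod (w - h) by apply: cmod_sub_half; rewrite // ltW.
  have a0 : w != 0 by rewrite -cmod_gt0 w1.
  have b0 : w - h != 0 by rewrite -cmod_gt0; lra.
  have -> : (w - h)^-1 ^+ 2 - w^-1 ^+ 2 - 2 * w^-1 ^+ 3 * h =
      (3 * w - 2 * h) * w^-1 ^+ 3 * (w - h)^-1 ^+ 2 * h ^+ 2.
    by field; rewrite a0 b0.
  rewrite 3!cmodM !cmodX !cmodV ler_wpM2r ?exprn_ge0 ?cmod_ge0 // w1 invr1 expr1n mulr1.
  have i1 : (cmod (w - h))^-1 <= 2 by rewrite -[2]invrK lef_pV2 ?posrE; lra.
  rewrite [16](_ : _ = 4 * 2 ^+ 2); last by ring.
  rewrite ler_pM ?exprn_ge0 ?invr_ge0 ?cmod_ge0 //; last by rewrite lerXn2r ?nnegrE ?invr_ge0 ?cmod_ge0.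
  apply: (le_trans (ler_cmodB _ _)); rewrite !cmodM w1.
  have -> : cmod (3 : C) = 3 by rewrite -[3](rmorph_nat (real_complex R)) cmodr normr_nat.
  have -> : cmod (2 : C) = 2 by rewrite -[2](rmorph_nat (real_complex R)) cmodr normr_nat.
  by lra.
Qed.

Lemma twopiC_neq0 : (2 * pi)%:C != 0 :> C.
Proof. by rewrite -cmod_eq0 cmodr normr_eq0 gt_eqF ?twopi_gt0. Qed.

(** After translation of the base point to [0], the derivative is near there a circular integral
    with kernel [(w - v)^-1 ^+ 2], which can be differentiated once more. *)
Theorem cdiff_derivative f : cdiff f ->
  exists2 f', cdiff f' & forall z, cderiv f z (f' z).
Proof.
move=> df; have [f' Hf'] := choice df; exists f' => // a.
pose g w := f (a + w); have dg : cdiff g by exact: cdiff_shift.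
pose u w := g w * w.
have cu : circle_continuous u 1.
  by move=> w _; apply: ccontM; [exact: cdiff_ccont|exact: ccont_id].
have gE v : cmod v < 1 -> circ (fun w => u w * (w - v)^-1) 1 = (2 * pi)%:C * g v.
  by move=> v1; rewrite -(cauchy_formula dg v1).
have g'E v : cmod v < 1/2 ->
    circ (fun w => u w * ((w - v)^-1 ^+ 2)) 1 = (2 * pi)%:C * f' (a + v).
  move=> v1; have := cderiv_cauchy_kernel cu v1.
  have H1 : cderiv g v (f' (a + v)).
    rewrite -[f' _]mulr1; apply: (cderiv_comp (g := f)) (Hf' _).
    by rewrite -[1]add0r; apply: cderivD; [exact: cderiv_cst|exact: cderiv_id].
  have := cderivM (cderiv_cst (2 * pi)%:C v) H1; rewrite mul0r add0r => H2 H3.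
  apply: (cderiv_unique H3); apply: (cderiv_near _ H2).
  apply/near_cmodP; exists (1/2) => // w wv; rewrite gE //.
  by rewrite -[w](subrK v) (le_lt_trans (ler_cmodD _ _)) //; lra.
have H := cderivM (cderiv_cst (2 * pi)%:C^-1 0) (cderiv_cauchy_kernel2 cu).
have {}H : exists l, cderiv (fun v => f' (a + v)) 0 l.
  eexists; apply: (cderiv_near _ H).
  apply/near_cmodP; exists (1/2) => // w; rewrite subr0 => w1.
  by rewrite g'E // mulKf // twopiC_neq0.
have [l Hl] := H; exists (l * 1).
have H1 : cderiv (fun w => w - a) a 1.
  by rewrite -[1]addr0; apply: cderivD; [exact: cderiv_id|exact: cderiv_cst].
have H2 : cderiv (fun v => f' (a + v)) (a - a) l by rewrite subrr.
have := cderiv_comp H1 H2.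
by rewrite (_ : (fun w => _) = f') //; apply/funext => w; rewrite subrKC.
Qed.

(** Removable singularity: since the mean of [f] is [f 0 = 0], Cauchy's formula expresses [f v / v]
    by the mean of [f w / (w - v)], without the factor [w], and this mean is also differentiable at
    [v = 0]. *)
Lemma cdiff_divide0 f : cdiff f -> f 0 = 0 ->
  exists2 g, cdiff g & forall z, f z = z * g z.
Proof.
move=> df f0.
have cu : circle_continuous f 1 by move=> w _; exact: cdiff_ccont.
pose H v := (2 * pi)%:C^-1 * circ (fun w => f w * (w - v)^-1) 1.
have [l Hl] : exists l, cderiv H 0 l.
  have z0 : cmod (0 : C) < 1/2 by rewrite cmod0.
  by eexists; apply: cderivM (cderiv_cst _ _) (cderiv_cauchy_kernel cu z0).
have HE v : v != 0 -> cmod v < 1 -> H v = f v / v.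
  move=> v0 v1; apply: (mulfI twopiC_neq0); rewrite /H mulVKf ?twopiC_neq0 //.
  rewrite mulrA -(cauchy_formula df v1).
  have cv := circle_continuous_inv v1.
  have cfv : circle_continuous (fun w => f w * (w - v)^-1) 1.
    by move=> w hw; apply: ccontM; [exact: cu|exact: cv].
  apply: (mulfI v0); rewrite mulrC -[X in _ = X]mulrC -mulrA mulVf // mulr1.
  rewrite mulrC -circZ //.
  have -> : circ (fun w => f w * w / (w - v)) 1 =
      circ (fun w => v * (f w * (w - v)^-1) + f w) 1.
    apply: eq_circ => // w w1; have wv : w - v != 0.
      by rewrite subr_eq0; apply: contraTneq v1 => <-; rewrite w1 ltxx.
    by field.
  rewrite circD //; last first.
    by move=> w hw; apply: ccontM; [exact: ccont_cst|exact: cfv].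
  rewrite [circ f 1]mean_value //.
  by rewrite f0 mulr0 addr0.
exists (fun z => if z == 0 then H 0 else f z / z); last first.
  by move=> z; case: eqVneq => [->|z0]; rewrite ?f0 ?mul0r // mulrC divfK.
move=> z; have [->|z0] := eqVneq z 0.
  exists l; apply: (cderiv_near _ Hl); apply/near_cmodP; exists 1 => // w.
  by rewrite subr0 => w1; case: eqVneq => [->//|w0]; exact: HE.
have [k Hk] := df z; eexists; apply: (cderiv_near _ (cderivM Hk (cderivV z0))).
apply/near_cmodP; exists (cmod z); first by rewrite cmod_gt0.
by move=> w; case: eqVneq => // ->; rewrite sub0r cmodN ltxx.
Qed.

(* If [f] vanishes to infinite order at [0], then [f z = z ^+ n * f_n z] with
   [|f_n| <= M / r ^+ n] on [|z| = r], hence on the disc. *)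
Lemma cdiff_order0 f : cdiff f -> (exists z, f z != 0) ->
  exists n g, [/\ cdiff g, g 0 != 0 & forall z, f z = z ^+ n * g z].
Proof.
move=> df [z0 fz0]; apply: contrapT => Hno.
have H n : exists2 g, cdiff g & forall z, f z = z ^+ n * g z.
  elim: n => [|n [g dg Hg]]; first by exists f => // z; rewrite mul1r.
  have g0 : g 0 = 0.
    by apply/eqP/negP => /negP g0; apply: Hno; exists n, g.
  have [h dh Hh] := cdiff_divide0 dg g0.
  by exists h => // z; rewrite Hg Hh exprSr mulrA.
pose r := cmod z0 + 1; have r0 : 0 < r by rewrite ltr_wpDl ?cmod_ge0.
have [M M0 HM] := circle_bounded (ltW r0) (fun w _ => cdiff_ccont w df).
have zr : cmod z0 < r by rewrite ltrDl.
have [z00|z00] := eqVneq z0 0.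
  by have [g _ Hg] := H 1%N; move: fz0; rewrite Hg z00 mul0r eqxx.
have f0 : 0 < cmod (f z0) by rewrite cmod_gt0.
have [|n Hn] := @unbounded_powers (r / cmod z0) (M / cmod (f z0)).
  by rewrite ltr_pdivlMr ?cmod_gt0 // mul1r.
have [g dg Hg] := H n.
have : cmod (g z0) <= M / r ^+ n.
  apply: maximum_modulus zr => // w wr; rewrite ler_pdivlMr ?exprn_gt0 //.
  by rewrite -wr -cmodX -cmodM mulrC -Hg; exact: HM.
rewrite ler_pdivlMr ?exprn_gt0 // => B.
move: Hn; rewrite ltr_pdivrMr // expr_div_n Hg cmodM cmodX mulrA.
rewrite divfK ?expf_neq0 ?cmod_eq0 // ltNge => /negP; apply.
by rewrite mulrC.
Qed.

Lemma ccont_zero_off0 f : ccont f 0 -> (forall z, z != 0 -> f z = 0) -> f 0 = 0.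
Proof.
move=> cf H; apply: cmod_small => e /cf[d d0 Hd]; apply/ltW.
have := Hd (d / 2)%:C; rewrite subr0 cmodr gtr0_norm ?divr_gt0 // H; last first.
  by rewrite -cmod_eq0 cmodr normr_eq0 gt_eqF // divr_gt0.
by rewrite sub0r cmodN; apply; lra.
Qed.

(** Powers of [z] are split off. The remaining factors are nonzero at [0], whereas their product
    vanishes off [0] and so, by continuity, at [0]. *)
Theorem cdiff_integral f g : cdiff f -> cdiff g -> (forall z, f z * g z = 0) ->
  (forall z, f z = 0) \/ (forall z, g z = 0).
Proof.
move=> df dg fg.
have [Hf|Hf] := pselect (exists z, f z != 0); last first.
  left=> z; apply/eqP/negP => /negP h; by apply: Hf; exists z.
have [Hg|Hg] := pselect (exists z, g z != 0); last first.
  right=> z; apply/eqP/negP => /negP h; by apply: Hg; exists z.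
have [n [f1 [df1 f10 Ef]]] := cdiff_order0 df Hf.
have [m [g1 [dg1 g10 Eg]]] := cdiff_order0 dg Hg.
have : f1 0 * g1 0 = 0.
  apply: (@ccont_zero_off0 (fun z => f1 z * g1 z)).
    by apply: cdiff_ccont; exact: cdiffM.
  move=> z z0; apply: (@mulfI _ (z ^+ n * z ^+ m)).
    by rewrite mulf_neq0 // expf_neq0.
  by rewrite mulr0 mulrACA -Ef -Eg fg.
by move/eqP; rewrite mulf_eq0 (negbTE f10) (negbTE g10).
Qed.

Lemma cderiv_exp n z : cderiv (fun w => w ^+ n) z (n%:R * z ^+ n.-1).
Proof.
elim: n => [|n IH]; first by rewrite mul0r; exact: cderiv_cst.
rewrite (_ : (fun w => _) = fun w => w * w ^+ n); last first.
  by apply/funext => w; rewrite exprS.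
have -> : n.+1%:R * z ^+ n.+1.-1 = 1 * z ^+ n + z * (n%:R * z ^+ n.-1).
  case: n {IH} => [|n]; first by rewrite /= mul0r mulr0 addr0.
  by rewrite /= mulrCA -exprS -[in LHS]natr1; ring.
exact: cderivM (cderiv_id z) IH.
Qed.

(** If [f z - f 0 = z ^+ n * g z] with [g 0 != 0], then [n > 0] and the derivative is [z ^+ n.-1]
    times [n * g z + z * g' z]; dividing and letting [z] tend to [0] gives [n * g 0 = 0]. *)
Theorem cderiv0_cst f : (forall z, cderiv f z 0) -> forall z, f z = f 0.
Proof.
move=> df0; have df : cdiff f by move=> z; exists 0.
pose h z := f z - f 0.
have dh : cdiff h by apply: cdiffB => //; exact: cdiff_cst.
have dh0 z : cderiv h z 0 by rewrite -[0]addr0; apply: cderivD => //; exact: cderiv_cst.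
have [H|H] := pselect (exists z, h z != 0); last first.
  move=> z; apply/eqP/negP => /negP hz; apply: H; exists z.
  by rewrite /h subr_eq0.
have [n [g [dg g0 E]]] := cdiff_order0 dh H.
have [g' dg' Hg'] := cdiff_derivative dg.
have n0 : n != 0%N.
  by apply: contraNneq g0 => n0; have := E 0; rewrite n0 mul1r /h subrr => <-.
have : n%:R * g 0 + 0 * g' 0 = 0.
  apply: (@ccont_zero_off0 (fun z => n%:R * g z + z * g' z)).
    apply: cdiff_ccont; apply: cdiffD; apply: cdiffM => //; first exact: cdiff_cst.
    exact: cdiff_id.
  move=> z z0; apply: (@mulfI _ (z ^+ n.-1)); first by rewrite expf_neq0.
  have := cderivM (cderiv_exp n z) (Hg' z).
  rewrite (_ : (fun w => _) = h); last by apply/funext => w; rewrite E.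
  move=> /(cderiv_unique (dh0 z)); rewrite mulr0 => ->.
  by rewrite -[in X in _ = _ + X](prednK (n := n)) ?lt0n // exprSr; ring.
move/eqP; rewrite mul0r addr0 mulf_eq0 (negbTE g0) orbF.
by rewrite -[n%:R](rmorph_nat (real_complex R)) -cmod_eq0 cmodr normr_eq0 pnatr_eq0 (negbTE n0).
Qed.

End EntireFunctions.

(** * Primitives and logarithms of entire functions *)

Section Primitive.
Context {R : realType}.
Local Notation C := R[i].
Implicit Types (f g : C -> C) (z w : C) (a b r s t x y M : R).

Definition prim (g : R -> C) x : C :=
  if 0 <= x then cint 0 x g else - cint x 0 g.

Lemma prim_diff (g : R -> C) a b : (forall t, rcont g t) -> a <= b ->
  prim g b - prim g a = cint a b g.
Proof.
move=> cg ab; have cc u v : curve u v g by move=> t _.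
rewrite /prim; case: (leP 0 a) => a0.
  by rewrite (le_trans a0 ab) (cint_split a0 ab (cc _ _)) addrC addKr.
case: (leP 0 b) => b0.
  by rewrite opprK addrC -cint_split // ltW.
by rewrite opprK (cint_split ab (ltW b0) (cc _ _)) addrC addrK.
Qed.

Lemma prim_approx (g : R -> C) a b z e : (forall t, rcont g t) ->
  (forall t, `|t - a| <= `|b - a| -> cmod (g t - z) <= e) ->
  cmod (prim g b - prim g a - (b - a)%:C * z) <= 2 * e * `|b - a|.
Proof.
move=> cg H; have cc u v : curve u v g by move=> t _.
case: (leP a b) => ab.
  have ba : `|b - a| = b - a by rewrite ger0_norm ?subr_ge0.
  rewrite prim_diff // ba; apply: cint_approx => // t /andP[t1 t2].
  by apply: H; rewrite ba ger0_norm ?subr_ge0 // lerD2r.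
have ba : `|b - a| = a - b by rewrite distrC ger0_norm // subr_ge0 ltW.
have -> : prim g b - prim g a - (b - a)%:C * z =
    - (prim g a - prim g b - (a - b)%:C * z).
  by rewrite !rmorphB /=; ring.
rewrite cmodN (prim_diff cg (ltW ab)) ba; apply: cint_approx => //; first exact: ltW.
move=> t /andP[t1 t2]; apply: H; rewrite ba distrC ger0_norm ?subr_ge0 //.
by rewrite lerD2l lerN2.
Qed.

(** The path from [0] to [z] follows the real axis, then the vertical line through [z]. *)
Definition cprim f z : C :=
  prim (fun s => f (s +i* 0)) (complex.Re z) +
  'i * prim (fun t => f (complex.Re z +i* t)) (complex.Im z).

(** Goursat on the rectangle between the heights [0] and [y] moves the horizontal part of the path
    from the real axis to height [y]. *)
Lemma cprim_horizontal f x x' y : cdiff f ->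
  cprim f (x' +i* y) - cprim f (x +i* y) =
  prim (fun s => f (s +i* y)) x' - prim (fun s => f (s +i* y)) x.
Proof.
move=> df.
have cH y0 t : rcont (fun s => f (s +i* y0)) t by apply: rcontH; exact: cdiff_ccont.
have cV x0 t : rcont (fun s => f (x0 +i* s)) t by apply: rcontV_line; exact: cdiff_ccont.
have curv (g : R -> C) a b : (forall t, rcont g t) -> curve a b g by move=> cg t _.
wlog xx' : x x' / x <= x'.
  move=> H; case: (leP x x') => [|/ltW] /H // E.
  by rewrite -opprB E opprB.
rewrite [RHS]prim_diff // /cprim /=.
have -> : prim (fun s => f (s +i* 0)) x' + 'i * prim (fun t => f (x' +i* t)) y -
  (prim (fun s => f (s +i* 0)) x + 'i * prim (fun t => f (x +i* t)) y) =
  cint x x' (fun s => f (s +i* 0)) + 'i * (prim (fun t => f (x' +i* t)) y -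
    prim (fun t => f (x +i* t)) y).
  by rewrite -prim_diff //; ring.
apply/eqP; rewrite -subr_eq0; apply/eqP; rewrite /prim; case: (leP 0 y) => y0.
  have := goursat xx' y0 (fun x y _ _ => df (x +i* y)).
  rewrite /rectint !cintB; try exact: curv.
  by move=> <-; ring.
have := goursat xx' (ltW y0) (fun x y _ _ => df (x +i* y)).
rewrite /rectint !cintB; try exact: curv.
by move=> /(congr1 -%R); rewrite oppr0 => <-; ring.
Qed.

(** The increment splits into a horizontal step at height [y] and a vertical step at abscissa [x'];
    both stay near [z], so continuity of [f] at [z] bounds them. *)
Theorem cderiv_cprim f z : cdiff f -> cderiv (cprim f) z (f z).
Proof.
move=> df.
have cH y0 t : rcont (fun s => f (s +i* y0)) t by apply: rcontH; exact: cdiff_ccont.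
have cV x0 t : rcont (fun s => f (x0 +i* s)) t by apply: rcontV_line; exact: cdiff_ccont.
apply/cderivP => e e0; have e40 : 0 < e / 4 by rewrite divr_gt0.
have [d d0 Hd] := cdiff_ccont z df e40.
exists (d / 2); first by rewrite divr_gt0.
case: z Hd => x y Hd [x' y']; set z := x +i* y; set z' := x' +i* y' => zd.
have hx : `|x' - x| <= cmod (z' - z) by rewrite -[x' - x]/(complex.Re (z' - z)) ler_Re_cmod.
have hy : `|y' - y| <= cmod (z' - z) by rewrite -[y' - y]/(complex.Im (z' - z)) ler_Im_cmod.
have -> : cprim f z' - cprim f z - f z * (z' - z) =
    (prim (fun s => f (s +i* y)) x' - prim (fun s => f (s +i* y)) x - (x' - x)%:C * f z) +
    'i * (prim (fun t => f (x' +i* t)) y' - prim (fun t => f (x' +i* t)) y -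
      (y' - y)%:C * f z).
  rewrite -cprim_horizontal // [in RHS]/cprim /= /cprim /=.
  have -> : z' - z = (x' - x)%:C + 'i * (y' - y)%:C.
    by apply: eqC; rewrite ?ReD ?ImD ?ReM ?ImM /=; ring.
  by ring.
apply: (le_trans (ler_cmodD _ _)); rewrite cmodM.
have -> : cmod ('i : C) = 1 by rewrite cmodE /= expr0n expr1n add0r sqrtr1.
rewrite mul1r.
have H1 : cmod (prim (fun s => f (s +i* y)) x' - prim (fun s => f (s +i* y)) x -
    (x' - x)%:C * f z) <= 2 * (e / 4) * `|x' - x|.
  apply: prim_approx => // t ht; apply/ltW/Hd; apply: le_lt_trans (ler_cmod_ReIm _) _.
  by rewrite ReB ImB /= subrr normr0; lra.
have H2 : cmod (prim (fun t => f (x' +i* t)) y' - prim (fun t => f (x' +i* t)) y -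
    (y' - y)%:C * f z) <= 2 * (e / 4) * `|y' - y|.
  apply: prim_approx => // t ht; apply/ltW/Hd; apply: le_lt_trans (ler_cmod_ReIm _) _.
  by rewrite ReB ImB /=; lra.
have H3 : e * `|x' - x| <= e * cmod (z' - z) by rewrite ler_wpM2l // ltW.
have H4 : e * `|y' - y| <= e * cmod (z' - z) by rewrite ler_wpM2l // ltW.
lra.
Qed.

(** [H] is a primitive of the logarithmic derivative, so [f * exp (- H)] is constant; [cexp mu]
    absorbs the constant. *)
Theorem nonvanishing_exp f : cdiff f -> (forall z, f z != 0) ->
  exists2 h, cdiff h & forall z, f z = cexp (h z).
Proof.
move=> df f0; have [f' df' Hf'] := cdiff_derivative df.
pose L z := f' z * (f z)^-1.
have dL : cdiff L.
  apply: cdiffM => // z; have [l Hl] := df z.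
  by eexists; apply: (cderiv_comp (g := fun v => v^-1)) Hl (cderivV (f0 z)).
pose H := cprim L; have dH z : cderiv H z (L z) := cderiv_cprim z dL.
have K : forall z, f z * cexp (- H z) = f 0 * cexp (- H 0).
  apply: (@cderiv0_cst _ (fun z => f z * cexp (- H z))) => z.
  have := cderivM (Hf' z) (cderiv_comp (cderivN (dH z)) (cderiv_cexp (- H z))).
  rewrite (_ : f' z * _ + _ = 0) //.
  by rewrite /L; field; exact: f0.
have [mu Hmu] := cexp_onto (mulf_neq0 (f0 0) (cexp_neq0 (- H 0))).
exists (fun z => mu + H z).
  by apply: cdiffD; [exact: cdiff_cst|move=> z; exists (L z)].
by move=> z; rewrite cexpD Hmu -(K z) -mulrA -cexpD addNr cexp0 mulr1.
Qed.

End Primitive.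

(** * Functions whose real part grows at most polynomially *)

Section PolynomialGrowth.
Context {R : realType}.
Local Notation C := R[i].
Implicit Types (f g h : C -> C) (z w : C) (a b r s t x y M : R).

(** Meant for the weight [M - Re h], nonnegative and with integral known from the mean value
    property: only an upper bound of [Re h] then enters, not one of its modulus. *)
Lemma ler_cmod_cint_weight a b (sigma : R -> R) (u : R -> C) M :
  a <= b -> segment_continuous a b sigma -> curve a b u ->
  (forall t, a <= t <= b -> 0 <= sigma t) ->
  (forall t, a <= t <= b -> cmod (u t) <= M) ->
  cmod (cint a b (fun t => (sigma t)%:C * u t)) <= 2 * M * rint a b sigma.
Proof.
move=> ab cs cu s0 uM.
have sc k (f : R -> R) : segment_continuous a b f ->
    segment_continuous a b (fun t => k * f t).
  by move=> cf t /cf ?; apply: continuousM => //; exact: cst_continuous.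
have key (f : R -> R) : segment_continuous a b f ->
    (forall t, a <= t <= b -> `|f t| <= M) ->
    `|rint a b (fun t => sigma t * f t)| <= M * rint a b sigma.
  move=> cf fM; have csf : segment_continuous a b (fun t => sigma t * f t).
    by move=> t ht; apply: continuousM; [exact: cs|exact: cf].
  rewrite ler_norml -mulNr -!rintZ //; apply/andP; split; apply: ler_rint => //;
    try exact: sc.
    move=> t ht; have := fM t ht; rewrite ler_norml => /andP[h1 _].
    by rewrite mulrC ler_wpM2l // s0.
  move=> t ht; have := fM t ht; rewrite ler_norml => /andP[_ h1].
  by rewrite [X in _ <= X]mulrC ler_wpM2l // s0.
apply: (le_trans (ler_cmod_ReIm _)) => /=; rewrite -mulrA mulrDl mul1r.
rewrite (eq_rint (g := fun t => sigma t * complex.Re (u t))); last first.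
  by move=> t _; rewrite Re_realM.
rewrite [X in _ + `|X|](eq_rint (g := fun t => sigma t * complex.Im (u t))); last first.
  by move=> t _; rewrite Im_realM.
apply: lerD; apply: key.
- exact: curve_Re.
- by move=> t /uM; apply: le_trans; exact: ler_Re_cmod.
- exact: curve_Im.
- by move=> t /uM; apply: le_trans; exact: ler_Im_cmod.
Qed.

Lemma ccont_conj z : ccont (fun w => w^*) z.
Proof.
move=> e e0; exists e => // w wz.
suff -> : cmod (w^* - z^*) = cmod (w - z) by [].
by rewrite !cmodE; case: w z {wz} => [a b] [c d] /=; congr (Num.sqrt (_ + _)); ring.
Qed.

Lemma ccontX f n z : ccont f z -> ccont (fun w => f w ^+ n) z.
Proof.
move=> cf; elim: n => [|n IH]; first exact: ccont_cst.
rewrite (_ : (fun w => _) = fun w => f w * f w ^+ n); first exact: ccontM.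
by apply/funext => w; rewrite exprS.
Qed.

Lemma circ_conj f r : 0 <= r -> circle_continuous f r ->
  circ (fun w => (f w)^*) r = (circ f r)^*.
Proof. by move=> r0 cf; apply: cint_conj; exact: curve_circle. Qed.

Lemma circ_conjX n r : (0 < n)%N -> 0 < r -> circ (fun w => w^* ^+ n) r = 0.
Proof.
move=> n0 r0; have dX : cdiff (fun w : C => w ^+ n) by apply: cdiffX; exact: cdiff_id.
rewrite (eq_circ (g := fun w => (w ^+ n)^*) (ltW r0)); last by move=> w _; rewrite rmorphXn.
rewrite circ_conj ?ltW //; last by move=> w _; exact: cdiff_ccont.
by rewrite mean_value // expr0n (gtn_eqF n0) mulr0n mulr0; exact: conjc0.
Qed.

Lemma mul_conjc z : z * z^* = (cmod z ^+ 2)%:C.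
Proof. by rewrite -sqr_normc cmodC rmorphXn. Qed.

Lemma cmod_conj z : cmod z^* = cmod z.
Proof. by rewrite !cmodE; case: z => a b /=; rewrite sqrrN. Qed.

(** On the circle [w * w^* = r ^+ 2], so the terms of degree below [n] become positive powers of
    [w^*], of mean 0, and the mean of [g] is left. *)
Lemma circ_coef (p : {poly C}) g n r : (size p <= n)%N -> cdiff g -> 0 < r ->
  circ (fun w => (p.[w] + w ^+ n * g w) * w^* ^+ n) r =
  (2 * pi)%:C * ((r ^+ n) ^+ 2)%:C * g 0.
Proof.
move=> pn dg r0; have r0' := ltW r0.
have cK m w : ccont (fun w => w^* ^+ m) w by apply: ccontX; exact: ccont_conj.
rewrite (eq_circ (g := fun w => \sum_(i <- enum 'I_(size p))
    p`_i * (r ^+ i ^+ 2)%:C * w^* ^+ (n - i) + ((r ^+ n) ^+ 2)%:C * g w) r0'); last first.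
  move=> w wr; rewrite mulrDl; congr (_ + _).
    rewrite horner_coef mulr_suml big_enum /=; apply: eq_bigr => i _.
    have -> : w^* ^+ n = w^* ^+ i * w^* ^+ (n - i).
      by rewrite -exprD subnKC // ltnW // (leq_trans (ltn_ord i)).
    by rewrite mulrA -(mulrA p`_i) -exprMn mul_conjc wr -rmorphXn /= exprAC.
  by rewrite mulrAC -exprMn mul_conjc wr -rmorphXn /= exprAC.
have cT (i : 'I_(size p)) w : ccont (fun w => p`_i * (r ^+ i ^+ 2)%:C * w^* ^+ (n - i)) w.
  by apply: ccontM => //; exact: ccont_cst.
rewrite circD //; last 2 first.
- move=> w _; elim: (enum _) => [|i s IH].
    by rewrite (_ : (fun w => _) = fun=> 0); [exact: ccont_cst|apply/funext => v; rewrite big_nil].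
  rewrite (_ : (fun w => _) = fun w => p`_i * (r ^+ i ^+ 2)%:C * w^* ^+ (n - i) +
    \sum_(j <- s) p`_j * (r ^+ j ^+ 2)%:C * w^* ^+ (n - j)).
    exact: ccontD.
  by apply/funext => v; rewrite big_cons.
- by move=> w _; apply: ccontM; [exact: ccont_cst|exact: cdiff_ccont].
rewrite {1}/circ cint_sum ?twopi_ge0 //; last first.
  by move=> i; apply: (@curve_circle _ (fun w => p`_i * (r ^+ i ^+ 2)%:C * w^* ^+ (n - i))).
rewrite big1_seq ?add0r; last first.
  move=> i _; rewrite -[LHS]/(circ (fun w => p`_i * (r ^+ i ^+ 2)%:C * w^* ^+ (n - i)) r).
  rewrite circZ // circ_conjX ?mulr0 // subn_gt0.
  exact: leq_trans (ltn_ord i) pn.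
rewrite circZ //; last by move=> w _; exact: cdiff_ccont.
by rewrite mean_value // mulrA [_%:C * _%:C]mulrC.
Qed.

(* The conjugate of [h] has no Fourier coefficients of positive index, so those
   of [h] are determined by its real part. *)
Lemma coef_bound h (p : {poly C}) g n r M : (0 < n)%N -> (size p <= n)%N ->
  cdiff g -> (forall z, h z = p.[z] + z ^+ n * g z) -> 0 < r ->
  (forall z, cmod z = r -> complex.Re (h z) <= M) ->
  r ^+ n * cmod (g 0) <= 4 * (M - complex.Re (h 0)).
Proof.
move=> n0 pn dg E r0 hM; have r0' := ltW r0.
have dh : cdiff h.
  rewrite (_ : h = fun z => p.[z] + z ^+ n * g z); last exact/funext.
  by apply: cdiffD; [exact: cdiff_poly|apply: cdiffM => //; apply: cdiffX; exact: cdiff_id].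
have cK m w : ccont (fun w => w^* ^+ m) w by apply: ccontX; exact: ccont_conj.
have cX : cdiff (fun w : C => w ^+ n) by apply: cdiffX; exact: cdiff_id.
pose sigma t := M - complex.Re (h (r%:C * cis t)).
pose u t : C := (r%:C * cis t)^* ^+ n.
have ch : curve 0 (2 * pi) (fun t => h (r%:C * cis t)).
  by apply: curve_circle => // w _; exact: cdiff_ccont.
have cs : segment_continuous 0 (2 * pi) sigma.
  move=> t ht; apply: continuousB; first exact: cst_continuous.
  exact: rcont_Re (ch t ht).
have cu : curve 0 (2 * pi) u.
  by apply: (@curve_circle _ (fun w => w^* ^+ n)).
(* The classical factor 2 becomes 4 through the componentwise bound of this integral. *)
have := @ler_cmod_cint_weight 0 (2 * pi) sigma u (r ^+ n) twopi_ge0 cs cu.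
have -> : rint 0 (2 * pi) sigma = 2 * pi * (M - complex.Re (h 0)).
  rewrite rintB; last 2 first.
  - by move=> t _; exact: cst_continuous.
  - exact: curve_Re.
  rewrite rint_cst ?twopi_ge0 // subr0 mulrBr mulrC; congr (_ - _).
  have := mean_value r0 (fun w _ => dh w) => /(congr1 (@complex.Re R)).
  by rewrite Re_realM.
have -> : cint 0 (2 * pi) (fun t => (sigma t)%:C * u t) =
    - ((2 * pi)%:C * ((r ^+ n) ^+ 2)%:C * g 0 / 2).
  (* [Re h] is replaced by half the sum of [h] and its conjugate. Against [u] the constant and the
     conjugate part have mean 0, the latter because [h w * w ^+ n] vanishes at [0]. *)
  have -> : cint 0 (2 * pi) (fun t => (sigma t)%:C * u t) =
      circ (fun w => M%:C * w^* ^+ n + (-2^-1) * (h w * w^* ^+ n + (h w * w ^+ n)^*)) r.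
    apply: eq_cint => t _; rewrite /sigma /u; set w := _ * cis t.
    have -> : (h w * w ^+ n)^* = (h w)^* * w^* ^+ n by rewrite rmorphM rmorphXn.
    rewrite rmorphB /=.
    have -> : (complex.Re (h w))%:C = (h w + (h w)^*) / 2 by exact: ReJ_add.
    by field.
  have c1 : circle_continuous (fun w => h w * w^* ^+ n) r.
    by move=> w _; apply: ccontM => //; exact: cdiff_ccont.
  have c2 : circle_continuous (fun w => h w * w ^+ n) r.
    by move=> w _; apply: ccontM; exact: cdiff_ccont.
  have c2' : circle_continuous (fun w => (h w * w ^+ n)^*) r.
    by move=> w hw; apply: ccont_comp (c2 w hw) _; exact: ccont_conj.
  have c12 : circle_continuous (fun w => h w * w^* ^+ n + (h w * w ^+ n)^*) r.
    by move=> w hw; apply: ccontD; [exact: c1|exact: c2'].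
  rewrite circD //; last 2 first.
  - by move=> w _; apply: ccontM => //; exact: ccont_cst.
  - by move=> w hw; apply: ccontM; [exact: ccont_cst|exact: c12].
  rewrite !circZ //.
  rewrite circ_conjX // mulr0 add0r circD // circ_conj //.
  rewrite [circ (fun w => h w * w ^+ n) r]mean_value //; last first.
    by move=> w _; exact: (cdiffM dh cX).
  rewrite expr0n (gtn_eqF n0) mulr0n !mulr0 [(0 : C)^*]conjc0 addr0.
  rewrite (eq_circ (g := fun w => (p.[w] + w ^+ n * g w) * w^* ^+ n) r0'); last first.
    by move=> w _; rewrite E.
  by rewrite circ_coef //; field.
rewrite cmodN 3!cmodM cmodV !cmodr.
have -> : cmod (2 : C) = 2 by rewrite -[2](rmorph_nat (real_complex R)) cmodr normr_nat.
rewrite !ger0_norm ?exprn_ge0 ?twopi_ge0 // => H.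
have {}H : 2 * pi * (r ^+ n) ^+ 2 * cmod (g 0) / 2 <=
    2 * r ^+ n * (2 * pi * (M - complex.Re (h 0))).
  apply: H => t _; first by rewrite subr_ge0 hM // cmod_circle.
  by rewrite /u cmodX cmod_conj cmod_circle.
have q0 : 0 < pi * r ^+ n :> R by rewrite mulr_gt0 ?pi_gt0 ?exprn_gt0.
rewrite -(ler_pM2l q0); move: H.
by move: (pi : R) (r ^+ n) (cmod (g 0)) => P Q G; lra.
Qed.

Lemma taylor_division h n : cdiff h -> exists (p : {poly C}) g,
  [/\ (size p <= n)%N, cdiff g & forall z, h z = p.[z] + z ^+ n * g z].
Proof.
move=> dh; elim: n => [|n [p [g [pn dg E]]]].
  by exists 0, h; rewrite size_poly0; split => // z; rewrite horner0 add0r mul1r.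
have dg0 : cdiff (fun z => g z - g 0) by apply: cdiffB => //; exact: cdiff_cst.
have [k dk Ek] := cdiff_divide0 dg0 (subrr _).
exists (p + (g 0)%:P * 'X^n), k; split => //.
  rewrite (leq_trans (size_polyD _ _)) // geq_max (leq_trans pn) //=.
  by rewrite mul_polyC (leq_trans (size_scale_leq _ _)) // size_polyXn.
move=> z; rewrite E hornerD hornerM hornerC hornerXn exprSr -mulrA -Ek; ring.
Qed.

(** A form of Liouville's theorem: were the Taylor remainder nonzero, its first nonzero coefficient
    [g' 0], of index [N.+1 + k], would satisfy [coef_bound] with [M = r ^+ N] for all large [r]. *)
Theorem Re_growth_poly h N r0 : cdiff h ->
  (forall z, r0 <= cmod z -> complex.Re (h z) <= cmod z ^+ N) ->
  exists p : {poly C}, forall z, h z = p.[z].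
Proof.
move=> dh H; have [p [g [pn dg E]]] := taylor_division N.+1 dh.
exists p => z; rewrite E; suff -> : g z = 0 by rewrite mulr0 addr0.
apply: contrapT => gz.
have [|k [g' [dg' g'0 E']]] := cdiff_order0 dg; first by exists z; apply/eqP.
have c0 : 0 < cmod (g' 0) by rewrite cmod_gt0.
(* For [r >= 1], [r ^+ N * D] dominates the right side of [coef_bound], which then reduces to
   [r * c <= D]. *)
pose c := cmod (g' 0); pose D := 4 * (1 + `|complex.Re (h 0)|).
pose r := Num.max (Num.max 1 r0) (D / c + 1).
have r1 : 1 <= r by rewrite !le_max lexx.
have rr0 : r0 <= r by rewrite !le_max lexx !orbT.
have rD : D / c < r by rewrite lt_max ltrDl ltr01 orbT.
have rp : 0 < r by apply: lt_le_trans r1.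
have := @coef_bound h p g' (N.+1 + k) r (r ^+ N).
rewrite addSn => /(_ isT) H1.
have {}H1 : r ^+ (N + k).+1 * c <= 4 * (r ^+ N - complex.Re (h 0)).
  apply: H1 => //.
  - by rewrite (leq_trans pn) // ltnS leq_addr.
  - by move=> w; rewrite E E' mulrA -exprD addSn.
  - by move=> w wr; have := H w; rewrite wr; apply.
have rN : 1 <= r ^+ N by rewrite exprn_ege1.
have H2 : r ^+ N * (r * c) <= r ^+ (N + k).+1 * c.
  rewrite mulrA -exprSr ler_wpM2r ?cmod_ge0 // ler_weXn2l //.
  by rewrite ltnS leq_addr.
have H3 : 4 * (r ^+ N - complex.Re (h 0)) <= r ^+ N * D.
  rewrite /D; have := ler_norm (- complex.Re (h 0)); rewrite normrN => a1.
  have : `|complex.Re (h 0)| <= r ^+ N * `|complex.Re (h 0)| by rewrite ler_peMl.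
  by lra.
have : r * c <= D.
  rewrite -(@ler_pM2l _ (r ^+ N)) ?exprn_gt0 //.
  by apply: le_trans H3; apply: le_trans H1.
by rewrite leNgt -ltr_pdivrMr // rD.
Qed.

End PolynomialGrowth.

(** * The Fejer kernel as the real part of a polynomial *)

Section Fejer.
Context {R : realType}.
Local Notation C := R[i].
Implicit Types (z w : C) (r s t x y : R) (N : nat).

Definition dist_ord N (p : 'I_N * 'I_N) : nat := (p.1 - p.2) + (p.2 - p.1).

(** The exponents are [|k - l|] rather than [k - l]: this gives a polynomial in [w] whose real part
    on the unit circle is the Fejer kernel. *)
Definition fejer N w : C :=
  N%:R^-1 * \sum_(p <- enum {: 'I_N * 'I_N}) w ^+ dist_ord p.

Lemma fejer_pairs N w :
  fejer N w = N%:R^-1 * \sum_(k < N) \sum_(l < N) w ^+ ((k - l) + (l - k)).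
Proof. by rewrite /fejer big_enum pair_bigA. Qed.

Lemma natC n : n%:R = (n%:R : R)%:C :> C.
Proof. by rewrite rmorph_nat. Qed.

Lemma Re_sum (I : Type) (s : seq I) (F : I -> C) :
  complex.Re (\sum_(i <- s) F i) = \sum_(i <- s) complex.Re (F i).
Proof. by elim: s => [|i s IH]; rewrite ?big_nil ?big_cons // ReD IH. Qed.

Lemma Re_fejer N w : cmod w = 1 ->
  complex.Re (fejer N w) = N%:R^-1 * cmod (\sum_(k < N) w ^+ k) ^+ 2.
Proof.
move=> w1; have ww : w * w^* = 1 by rewrite mul_conjc w1 expr1n.
rewrite fejer_pairs natC -fmorphV Re_realM; congr (_ * _).
have -> : cmod (\sum_(k < N) w ^+ k) ^+ 2 =
    complex.Re ((\sum_(k < N) w ^+ k) * (\sum_(l < N) w ^+ l)^*).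
  by rewrite mul_conjc.
rewrite mulr_suml !Re_sum; apply: eq_bigr => k _.
rewrite rmorph_sum mulr_sumr !Re_sum; apply: eq_bigr => l _ /=.
rewrite rmorphXn /=; case: (leqP l k) => kl.
  have -> : ((k - l) + (l - k) = k - l)%N by move: kl; rewrite -subn_eq0 => /eqP ->; rewrite addn0.
  rewrite -{2}(subnK kl) exprD -mulrA -exprMn ww expr1n mulr1 //.
have -> : ((k - l) + (l - k) = l - k)%N by move: (ltnW kl); rewrite -subn_eq0 => /eqP ->.
rewrite -{2}(subnK (ltnW kl)) exprD mulrCA -exprMn ww expr1n mulr1.
by rewrite -rmorphXn; case: (w ^+ (l - k)).
Qed.

Lemma Re_fejer_ge0 N w : cmod w = 1 -> 0 <= complex.Re (fejer N w).
Proof. by move=> w1; rewrite Re_fejer // mulr_ge0 ?invr_ge0 ?ler0n ?exprn_ge0 ?cmod_ge0. Qed.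

(** The geometric sum times [w - 1] is [w ^+ N - 1], of modulus at most 2. *)
Lemma Re_fejer_far N w d : cmod w = 1 -> 0 < d -> d <= cmod (w - 1) ->
  complex.Re (fejer N w) <= 4 / (N%:R * d ^+ 2).
Proof.
move=> w1 d0 wd; rewrite Re_fejer // invfM [X in _ <= X]mulrCA ler_wpM2l ?invr_ge0 ?ler0n //.
rewrite ler_pdivlMr ?exprn_gt0 // -exprMn.
have : cmod (\sum_(k < N) w ^+ k) * d <= 2.
  apply: (le_trans (ler_wpM2l (cmod_ge0 _) wd)).
  rewrite -cmodM mulrC -subrX1; apply: (le_trans (ler_cmodB _ _)).
  by rewrite cmodX w1 expr1n cmod1.
move=> H; rewrite [4](_ : _ = 2 ^+ 2); last by ring.
by rewrite lerXn2r ?nnegrE // mulr_ge0 ?cmod_ge0 // ltW.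
Qed.

Lemma geometric_left (k : nat) : \sum_(0 <= l < k) (2^-1 : R) ^+ (k - l) <= 1.
Proof.
elim: k => [|k IH]; first by rewrite big_geq.
rewrite big_nat_recr //= subSnn expr1.
rewrite (eq_big_nat _ _ (F2 := fun l => 2^-1 * 2^-1 ^+ (k - l))); last first.
  by move=> l /andP[_ lk]; rewrite -exprS subSn // ltnW.
by rewrite -mulr_sumr; lra.
Qed.

Lemma geometric_right (n : nat) : \sum_(0 <= l < n) (2^-1 : R) ^+ l <= 2.
Proof.
elim: n => [|n IH]; first by rewrite big_geq.
rewrite big_nat_recl // expr0.
rewrite (eq_bigr (fun l => 2^-1 * 2^-1 ^+ l)); last by move=> l _; rewrite exprS.
by rewrite -mulr_sumr; lra.
Qed.

(** Each of the [N] inner sums is bounded by two geometric series of ratio [1/2], and the factor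
    [1/N] averages them. The point is that the bound does not depend on [N]. *)
Lemma fejer_half N w : (0 < N)%N -> cmod w <= 2^-1 -> cmod (fejer N w) <= 4.
Proof.
move=> N0 w2; rewrite fejer_pairs cmodM natC -fmorphV cmodr.
have Np : 0 < N%:R :> R by rewrite ltr0n.
rewrite gtr0_norm ?invr_gt0 // ler_pdivrMl //.
apply: (le_trans (ler_cmod_sum _ _ _)).
apply: (@le_trans _ _ (\sum_(k < N) (4 : R))); last first.
  by rewrite sumr_const card_ord -[_ *+ N]mulr_natl.
apply: ler_sum => k _; apply: (le_trans (ler_cmod_sum _ _ _)).
apply: (@le_trans _ _ (\sum_(l < N) (2^-1 : R) ^+ ((k - l) + (l - k)))).
  by apply: ler_sum => l _; rewrite cmodX lerXn2r ?nnegrE ?cmod_ge0 ?invr_ge0.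
rewrite -(big_mkord xpredT (fun l => (2^-1 : R) ^+ ((k - l) + (l - k)))).
rewrite (@big_cat_nat _ _ _ k) //=; last by rewrite ltnW.
have -> : \sum_(0 <= l < k) (2^-1 : R) ^+ ((k - l) + (l - k)) =
    \sum_(0 <= l < k) 2^-1 ^+ (k - l).
  apply: eq_big_nat => l /andP[_ lk].
  by move: (ltnW lk); rewrite -subn_eq0 => /eqP ->; rewrite addn0.
have -> : \sum_(k <= l < N) (2^-1 : R) ^+ ((k - l) + (l - k)) =
    \sum_(0 <= l < N - k) 2^-1 ^+ l.
  rewrite -{1}[val k]add0n big_addn; apply: eq_big_nat => l _.
  rewrite addnK (_ : (k - (l + k) = 0)%N) //.
  by apply/eqP; rewrite subn_eq0 leq_addl.
by have := geometric_left k; have := geometric_right (N - k); lra.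
Qed.

Lemma cis_conj t : cis (- t) = (1%:C * cis t)^* :> C.
Proof. by rewrite mul1r cisNi. Qed.

(** Off-diagonal pairs give positive powers of [cis (- t)], of mean 0, so only the [N] diagonal
    pairs count, for every [z]. *)
Lemma cint_fejer N z : (0 < N)%N ->
  cint 0 (2 * pi) (fun t => fejer N (z * cis (- t))) = (2 * pi)%:C.
Proof.
move=> N0; have NC : N%:R != 0 :> C by rewrite pnatr_eq0 -lt0n.
have cI n : curve 0 (2 * pi) (fun t => (z * cis (- t)) ^+ n).
  rewrite (_ : (fun t => _) = fun t => (z * (cis t)^*) ^+ n); last first.
    by apply/funext => t; rewrite cisNi.
  move=> t _; apply: (rcont_comp (F := fun w => (z * w^*) ^+ n) (g := @cis R)).
    by apply: ccontX; apply: ccontM; [exact: ccont_cst|exact: ccont_conj].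
  exact: rcont_cis.
rewrite /fejer cintZ; last by apply: curve_sum => p; exact: cI.
rewrite cint_sum ?twopi_ge0 //.
rewrite (eq_bigr (fun p : 'I_N * 'I_N => if p.1 == p.2 then (2 * pi)%:C else 0)); last first.
  move=> p _; case: eqVneq => [E|E].
    rewrite /dist_ord E subnn (eq_cint (h := fun=> 1)); last by move=> t _; rewrite expr0.
    by rewrite cint_cst ?twopi_ge0 // subr0 mulr1.
  have e0 : (0 < dist_ord p)%N.
    rewrite lt0n /dist_ord addn_eq0 !subn_eq0 -eqn_leq.
    by apply: contraNneq E => H; apply/eqP/val_inj.
  have K : curve 0 (2 * pi) (fun t => (1%:C * cis t)^* ^+ dist_ord p).
    apply: (@curve_circle _ (fun w => w^* ^+ dist_ord p)) => // w _.
    by apply: ccontX; exact: ccont_conj.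
  rewrite (eq_cint (h := fun t => z ^+ dist_ord p * (1%:C * cis t)^* ^+ dist_ord p)).
    rewrite cintZ // -[cint _ _ _]/(circ (fun w => w^* ^+ dist_ord p) 1).
    by rewrite circ_conjX // mulr0.
  by move=> t _; rewrite exprMn cis_conj.
rewrite big_enum /=.
rewrite -(pair_bigA _ (fun k l : 'I_N => if k == l then (2 * pi)%:C else 0)) /=.
rewrite (eq_bigr (fun=> (2 * pi)%:C)); last first.
  by move=> k _; rewrite -big_mkcond /= (big_pred1 k) // => l; rewrite eq_sym.
by rewrite sumr_const card_ord -[X in _ * X]mulr_natl mulKf.
Qed.

End Fejer.

(** * From the proximity function to a pointwise bound *)

Section Growth.
Context {R : realType}.
Local Notation C := R[i].
Implicit Types (f : C -> C) (z w : C) (r s t x y : R) (N : nat).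

Lemma logp_ge0 x : 0 <= logp x.
Proof. by rewrite /logp le_max lexx orbT. Qed.

Lemma ler_expR_logp x : 0 <= x -> x <= expR (logp x).
Proof.
rewrite le_eqVlt => /predU1P[<-|x0]; first exact: expR_ge0.
by rewrite -{1}[x]lnK ?posrE // ler_expR /logp le_max lexx.
Qed.

Lemma logpE x : 0 <= x -> logp x = ln (Num.max x 1).
Proof.
move=> x0; rewrite /logp; case: (leP x 1) => x1.
  by rewrite ln1; apply/max_idPr; exact: ln_le0.
by apply/max_idPl/ln_ge0/ltW.
Qed.

(** From [ln (b / a) <= b / a - 1 <= b - a] for [1 <= a <= b]. It makes [logp (cmod f)] continuous,
    also at the zeros of [f]. *)
Lemma logp_lipschitz x y : 0 <= x -> 0 <= y -> `|logp x - logp y| <= `|x - y|.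
Proof.
wlog xy : x y / x <= y.
  move=> H x0 y0; case: (leP x y) => [|/ltW] xy; first exact: H.
  by rewrite distrC [leRHS]distrC; exact: H.
move=> x0 y0; rewrite !logpE //.
set a := Num.max x 1; set b := Num.max y 1.
have a1 : 1 <= a by rewrite le_max lexx orbT.
have ab : a <= b by rewrite /a ge_max !le_max xy lexx orbT.
have ap : 0 < a by apply: lt_le_trans a1.
have bp : 0 < b by apply: lt_le_trans ab.
have bay : b - a <= y - x.
  rewrite /a /b; case: (leP x 1) => ?; case: (leP y 1) => ?; lra.
rewrite distrC ger0_norm ?subr_ge0 ?ler_ln ?posrE // distrC ger0_norm ?subr_ge0 //.
rewrite -ln_div ?posrE //; apply: le_trans bay.
have : 1 + ln (b / a) <= b / a.
  by rewrite -[leRHS]lnK ?posrE ?divr_gt0 // expR_ge1Dx.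
have : b / a - 1 <= b - a.
  by rewrite -[1 in leLHS](divff (lt0r_neq0 ap)) -mulrBl ler_pdivrMr // ler_peMr // subr_ge0.
lra.
Qed.

Lemma proximity_circle f r : proximity_function f r =
  (2 * pi)^-1 * rint 0 (2 * pi) (fun t => logp (cmod (f (r%:C * cis t)))).
Proof.
congr (_ * _); apply: eq_Rintegral => t _; by rewrite cpolarE.
Qed.

(* On the circle, [log+ |f|] is dominated by the real part of a polynomial [W]
   (its convolution with a Fejer kernel, up to a constant) whose mean is that of
   [log+ |f|] plus one; then [f * exp (- W)] has modulus at most 1 there. *)
Theorem growth_proximity f r z : cdiff f -> 0 < r -> cmod z <= r / 2 ->
  cmod (f z) <= expR (4 * (proximity_function f r + 1)).
Proof.
move=> df r0 zr; have r0' := ltW r0.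
pose V w := logp (cmod (f (r%:C * w))).
have cV w e : 0 < e -> exists2 d : R, 0 < d &
    forall v, cmod (v - w) < d -> `|V v - V w| < e.
  move=> e0; have [d d0 Hd] := cdiff_ccont w (cdiff_scale r%:C df) e0.
  exists d => // v /Hd H; apply: (le_lt_trans (logp_lipschitz (cmod_ge0 _) (cmod_ge0 _))).
  apply: le_lt_trans H; rewrite ler_norml lerB_cmod andbT lerNl opprB cmodB.
  exact: lerB_cmod.
pose U t := V (cis t).
have cU t : {for t, continuous U}.
  apply/(@cvgrPdist_lt R R R (nbhs t)) => e e0; apply/near_realP.
  have [d d0 Hd] := cV (cis t) e e0.
  have [d' d'0 Hd'] := rcont_cis t d0.
  by exists d' => // s /Hd'/Hd; rewrite distrC.
have sU : segment_continuous 0 (2 * pi) U by move=> t _.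
have U0 t : 0 <= U t by exact: logp_ge0.
have mE : rint 0 (2 * pi) U = 2 * pi * proximity_function f r.
  by rewrite proximity_circle mulVKf // gt_eqF ?twopi_gt0.
have [b0 _ Hb0] := @EVT_max R U 0 (2 * pi) twopi_ge0 (continuous_in_subspaceT (fun t _ => cU t)).
pose B := U b0.
have UB t : 0 <= t <= 2 * pi -> U t <= B.
  by move=> ht; apply: Hb0; rewrite in_itv.
have B0 : 0 <= B by exact: U0.
(* [h] serves only as a radius: within distance [|h|] of any point of the circle, [V] varies by at
   most 1/2. *)
have [|d d0 Hd] := @segment_tube R 0 (2 * pi)
    (fun h s => forall w, cmod (w - cis s) < `|h| -> `|V w - V (cis s)| <= 1/2).
  move=> t _; have [d d0 Hd] := cV (cis t) (1/4) (ltac:(lra)).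
  have d20 : 0 < d / 2 by rewrite divr_gt0.
  have [d' d'0 Hd'] := rcont_cis t d20.
  exists (Num.min d' (d / 2)); first by rewrite lt_min d'0.
  move=> s h; rewrite !lt_min => /andP[s1 _] /andP[_ h2] w ws.
  have st := Hd' s s1.
  have B1 : `|V (cis s) - V (cis t)| < 1/4 by apply: Hd; lra.
  have B2 : `|V w - V (cis t)| < 1/4.
    apply: Hd; rewrite -(subrKA (cis s)); apply: le_lt_trans (ler_cmodD _ _) _; lra.
  rewrite -(subrKA (V (cis t))); apply: le_trans (ler_normD _ _) _.
  by rewrite [`|V (cis t) - _|]distrC; lra.
pose e := d / 2; have e0 : 0 < e by rewrite divr_gt0.
have near t s : 0 <= s <= 2 * pi -> cmod (cis t - cis s : C) < e -> `|U t - U s| <= 1/2.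
  by move=> hs ts; apply: (Hd e s) => //; rewrite gtr0_norm // /e; lra.
(* [N] is so large that even the maximum [B] of [U], times the kernel away from its peak, stays
   below 1/2. *)
have [N N0 HN] : exists2 N, (0 < N)%N & B * (4 / (N%:R * e ^+ 2)) <= 1/2.
  exists (Num.bound (8 * B / e ^+ 2)).+1 => //.
  set n := Num.bound _.
  have : 8 * B / e ^+ 2 <= n.+1%:R.
    apply: le_trans (ltW (archi_boundP _)) _; last by rewrite ler_nat.
    by rewrite divr_ge0 ?mulr_ge0 // ltW.
  rewrite ler_pdivrMr ?exprn_gt0 // => H.
  by rewrite mulrA ler_pdivrMr ?mulr_gt0 ?ltr0n ?exprn_gt0 //; lra.
pose k z t := complex.Re (fejer N (z * cis (- t))).
(* The added 1 pays for two losses of 1/2, one from the variation of [U] near the peak of the kernel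
   and one from its tail. *)
pose W z := cint 0 (2 * pi) (fun t => (U t + 1)%:C * fejer N (z * cis (- t))).
have cU1 t : rcont (fun t => (U t + 1)%:C) t.
  by apply: rcont_real; apply: continuousD => //; exact: cst_continuous.
have cpow v n t : rcont (fun t => (v * cis (- t)) ^+ n) t.
  rewrite (_ : (fun t => _) = fun t => (v * (cis t)^*) ^+ n); last first.
    by apply/funext => s; rewrite cisNi.
  apply: (rcont_comp (F := fun w => (v * w^*) ^+ n) (g := @cis R)).
    by apply: ccontX; apply: ccontM; [exact: ccont_cst|exact: ccont_conj].
  exact: rcont_cis.
have cF v t : rcont (fun t => fejer N (v * cis (- t))) t.
  apply: rcontM; first exact: rcont_cst.
  have := @curve_sum R t t _ (enum {: 'I_N * 'I_N})
    (fun p t => (v * cis (- t)) ^+ dist_ord p) (fun p t' _ => cpow _ _ t') t.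
  by rewrite lexx => /(_ isT).
have ck v t : {for t, continuous (k v)} by exact: rcont_Re (cF v t).
have dW : cdiff W.
  (* [W] is a polynomial because [fejer] is one; no differentiation under the integral is
     involved. *)
  rewrite (_ : W = fun v => N%:R^-1 * \sum_(p <- enum {: 'I_N * 'I_N})
      cint 0 (2 * pi) (fun t => (U t + 1)%:C * (1 * cis (- t)) ^+ dist_ord p) *
      v ^+ dist_ord p).
    apply: cdiffM; first exact: cdiff_cst.
    apply: cdiff_sum => p; apply: cdiffM; first exact: cdiff_cst.
    by apply: cdiffX; exact: cdiff_id.
  apply/funext => v; rewrite /W.
  have cT p : curve 0 (2 * pi) (fun t => (U t + 1)%:C * (1 * cis (- t)) ^+ dist_ord p : C).
    by move=> t _; apply: rcontM.
  rewrite (eq_cint (h := fun t => N%:R^-1 * \sum_(p <- enum {: 'I_N * 'I_N})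
     v ^+ dist_ord p * ((U t + 1)%:C * (1 * cis (- t)) ^+ dist_ord p))); last first.
    move=> t _; rewrite /fejer mulrCA mulr_sumr; congr (_ * _); apply: eq_bigr => p _.
    by rewrite exprMn mul1r mulrCA.
  have cT' p : curve 0 (2 * pi) (fun t => v ^+ dist_ord p *
      ((U t + 1)%:C * (1 * cis (- t)) ^+ dist_ord p) : C).
    by move=> t ht; apply: rcontM; [exact: rcont_cst|exact: cT].
  rewrite cintZ; last exact: curve_sum.
  rewrite cint_sum ?twopi_ge0 //; congr (_ * _); apply: eq_bigr => p _.
  by rewrite cintZ // mulrC.
have ReW v : complex.Re (W v) = rint 0 (2 * pi) (fun t => (U t + 1) * k v t).
  by apply: eq_rint => t _; rewrite Re_realM.
have sk v : segment_continuous 0 (2 * pi) (k v) by move=> t _.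
have sU1 : segment_continuous 0 (2 * pi) (fun t => U t + 1).
  by move=> t _; apply: continuousD => //; exact: cst_continuous.
have kint v : rint 0 (2 * pi) (k v) = 2 * pi.
  by have := cint_fejer v N0 => /(congr1 (@complex.Re R)).
have unit s t : cmod (cis s * cis (- t) : C) = 1 by rewrite -cisD cmod_cis.
have lower s : 0 <= s <= 2 * pi -> 2 * pi * U s <= complex.Re (W (cis s)).
  move=> hs; rewrite ReW.
  (* Near [s], [U t + 1 >= U s + 1/2]; far from [s], [U s] times the kernel is at most 1/2. The
     kernel having mean 1, the left side integrates to exactly [2 * pi * U s]. *)
  have L t : 0 <= t <= 2 * pi ->
      (U s + 1/2) * k (cis s) t - 1/2 <= (U t + 1) * k (cis s) t.
    move=> ht; have k0 : 0 <= k (cis s) t by exact: Re_fejer_ge0.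
    case: (ltP (cmod (cis t - cis s : C)) e) => ts.
      have := near t s hs ts; rewrite ler_norml => /andP[h1 h2].
      have : (U s - 1/2) * k (cis s) t <= U t * k (cis s) t by rewrite ler_wpM2r //; lra.
      lra.
    have far : k (cis s) t <= 4 / (N%:R * e ^+ 2).
      apply: Re_fejer_far => //.
      have -> : cis s * cis (- t) - 1 = (cis s - cis t) * cis (- t) :> C.
        by rewrite mulrBl -(cisD t) subrr cis0.
      by rewrite cmodM cmod_cis mulr1 cmodB.
    have h1 : U s * k (cis s) t <= B * (4 / (N%:R * e ^+ 2)).
      by apply: ler_pM => //; exact: UB.
    have h2 : 0 <= U t * k (cis s) t by rewrite mulr_ge0.
    lra.
  apply: (@le_trans _ _ (rint 0 (2 * pi) (fun t => (U s + 1/2) * k (cis s) t - 1/2))).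
    rewrite rintB; last 2 first.
    - by move=> t _; apply: continuousM => //; exact: cst_continuous.
    - by move=> t _; exact: cst_continuous.
    rewrite rintZ // kint rint_cst ?twopi_ge0 // subr0.
    by rewrite [leRHS](_ : _ = 2 * pi * U s) //; move: (pi : R) => P; ring.
  apply: ler_rint => //.
    move=> t _; apply: continuousB; last exact: cst_continuous.
    by apply: continuousM => //; exact: cst_continuous.
  by move=> t ht; apply: continuousM; [exact: sU1|exact: ck].
pose F w := f (r%:C * w) * cexp (- ((2 * pi)%:C^-1 * W w)).
have ReE w : complex.Re (- ((2 * pi)%:C^-1 * W w)) = - ((2 * pi)^-1 * complex.Re (W w)).
  by rewrite ReN -fmorphV Re_realM.
have dF : cdiff F.
  apply: cdiffM; first exact: cdiff_scale.
  apply: cdiff_comp cdiff_cexp; apply: cdiffN; apply: cdiffM => //; exact: cdiff_cst.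
have F1 w : cmod w = 1 -> cmod (F w) <= 1.
  move=> /cis_onto[s hs <-]; rewrite cmodM cmod_cexp ReE expRN ler_pdivrMr ?expR_gt0 //.
  rewrite mul1r; apply: (le_trans (ler_expR_logp (cmod_ge0 _))).
  rewrite ler_expR [leRHS]mulrC ler_pdivlMr ?twopi_gt0 // [leLHS]mulrC.
  exact: lower.
pose z' := z / r%:C.
have rC : r%:C != 0 by rewrite -cmod_eq0 cmodr normr_eq0 gt_eqF.
have z'2 : cmod z' <= 2^-1.
  by rewrite cmodM cmodV cmodr gtr0_norm // ler_pdivrMr // mulrC.
have zE : f z = f (r%:C * z') by rewrite /z' mulrC divfK.
have : cmod (F z') <= 1 by apply: maximum_modulus F1 _ => //; lra.
rewrite cmodM cmod_cexp ReE expRN ler_pdivrMr ?expR_gt0 // mul1r -zE.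
move=> /le_trans; apply; rewrite ler_expR mulrC ler_pdivrMr ?twopi_gt0 //.
(* On the half disc the kernel is bounded by 4 whatever [N] is; this is the 4 of the statement. *)
rewrite ReW; apply: (@le_trans _ _ (rint 0 (2 * pi) (fun t => 4 * (U t + 1)))).
  apply: ler_rint.
  - by move=> t ht; apply: continuousM; [exact: sU1|exact: ck].
  - by move=> t ht; apply: continuousM; [exact: cst_continuous|exact: sU1].
  - move=> t ht; rewrite mulrC ler_wpM2r //; first by rewrite addr_ge0.
    apply: (le_trans (ler_norm _)); apply: (le_trans (ler_Re_cmod _)).
    by apply: fejer_half => //; rewrite cmodM cmod_cis mulr1.
rewrite rintZ // rintD //; last by move=> t _; exact: cst_continuous.
rewrite rint_cst ?twopi_ge0 // mE subr0.
by rewrite [leLHS](_ : _ = 4 * (proximity_function f r + 1) * (2 * pi)) //; move: (pi : R) => P; ring.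
Qed.

End Growth.

(** * Finite order, growth classes and Hadamard factorization with finitely many zeros *)

Section FiniteOrder.
Context {R : realType}.
Local Notation C := R[i].
Implicit Types (f g : C -> C) (z w a : C) (r s t x y c : R) (k n : nat).

(** A factor [(z - a) ^+ n] with [n > 0] forces the limit 0, against [l != 0]. *)
Lemma entire_pole_order f a : cdiff f -> pole_order f a = 0%N.
Proof.
move=> df; rewrite /pole_order; case: xgetP => // n _ [n0 [l l0 H]]; exfalso.
have {}H := H : (fun z : R[i]^o => ((z - a) ^+ n * f z : R[i]^o)) @ (a : R[i]^o)^' --> (l : R[i]^o).
have P := @cvg_cmodP R _ (a : R[i]^o)^' _ (fun z : C => (z - a) ^+ n * f z) l.
have e0 : 0 < cmod l / 2 by rewrite divr_gt0 // cmod_gt0.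
have /P /(_ _ e0) /dnbhs_cmodP[d d0 Hd] := H.
have dg : cdiff (fun z => (z - a) ^+ n * f z).
  by apply: cdiffM => //; apply: cdiffX; apply: cdiffB; [exact: cdiff_id|exact: cdiff_cst].
have [d' d'0 Hd'] := cdiff_ccont a dg e0.
pose m := Num.min d d' / 2; have m0 : 0 < m by rewrite divr_gt0 // lt_min d0.
have mm : m < Num.min d d'.
  have h : 0 < Num.min d d' by rewrite lt_min d0.
  by rewrite /m; move: h; move: (Num.min _ _) => *; lra.
have ma : a + m%:C != a by rewrite -subr_eq0 addrC addKr -cmod_eq0 cmodr normr_eq0 gt_eqF.
have md : cmod (a + m%:C - a) = m by rewrite addrC addKr cmodr gtr0_norm.
move: mm; rewrite lt_min => /andP[m1 m2].
have := Hd (a + m%:C) ma; have := Hd' (a + m%:C); rewrite md => /(_ m2) B1 /(_ m1) B2.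
move: B1; rewrite subrr expr0n (gtn_eqF n0) mulr0n mul0r subr0 => B1.
have := ler_cmodB ((a + m%:C - a) ^+ n * f (a + m%:C)) ((a + m%:C - a) ^+ n * f (a + m%:C) - l).
by rewrite subKr; lra.
Qed.

Lemma entire_characteristic f r : cdiff f ->
  characteristic f r = proximity_function f r.
Proof.
move=> df.
have p0 t : pole_count f t = 0%N.
  by rewrite /pole_count fsbig1 // => a _; exact: entire_pole_order.
rewrite /characteristic /counting_function p0 mul0r addr0.
rewrite [X in _ + X](_ : _ = 0) ?addr0 //.
under eq_Rintegral do rewrite p0 subrr mul0r.
by rewrite Rintegral_cst // mul0r.
Qed.

Lemma proximity_ge0 f r : 0 <= proximity_function f r.
Proof.
rewrite proximity_circle mulr_ge0 ?invr_ge0 ?twopi_ge0 //.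
by apply: rint_ge0 => t _; exact: logp_ge0.
Qed.

Lemma finite_order_proximity f : cdiff f -> finite_order f ->
  exists k r0, 1 <= r0 /\ forall r, r0 <= r -> proximity_function f r <= r ^+ k.
Proof.
move=> df; rewrite /finite_order /growth_order /limf_esup.
move=> /ereal_inf_lt[_ [V [M [_ HM]] <-] Vfin].
have [K HK] : exists K : R, forall r, V r -> logp (characteristic f r) / ln r <= K.
  move: Vfin; case E : (ereal_sup _) => [K| |] // _.
    exists K => r Vr; rewrite -lee_fin -E; apply: ereal_sup_ubound.
    by exists r.
  (* A supremum equal to [-oo] means that [V] is empty, so this case is vacuous. *)
  exists 0 => r Vr; have : ((logp (characteristic f r) / ln r)%:E <= -oo)%E.
    by rewrite -E; apply: ereal_sup_ubound; exists r.
  by rewrite leeNy_eq.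
(* Beyond [M] the point lies in [V], and from 2 on [ln r > 0]; the bound by [K * ln r] on the
   logarithm then exponentiates to a power of [r]. *)
exists (Num.bound `|K|), (Num.max (M + 1) 2); split.
  by rewrite le_max ler1n orbT.
move=> r; rewrite ge_max => /andP[r1 r2].
have rM : M < r by lra.
have rp : 0 < r by lra.
have lr : 0 < ln r by apply: ln_gt0; lra.
have := HK r (HM r rM); rewrite entire_characteristic // ler_pdivrMr // => H.
apply: (le_trans (ler_expR_logp (proximity_ge0 f r))).
rewrite -[leRHS]lnK ?posrE ?exprn_gt0 // ler_expR (le_trans H) // lnXn //.
rewrite -[leRHS]mulr_natl ler_wpM2r ?(ltW lr) //.
by apply: (le_trans (ler_norm _)); apply/ltW/archi_boundP.
Qed.

(** The bound holds at every point, not just for large [z], and its base is at least 1, so exponents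
    can be raised freely when two such bounds are combined. *)
Definition fin_growth f := exists k c, [/\ (0 < k)%N, 1 <= c &
  forall z, cmod (f z) <= expR ((c + cmod z) ^+ k)].

Lemma finite_order_growth f : cdiff f -> finite_order f -> fin_growth f.
Proof.
move=> df /(finite_order_proximity df)[k [r0 [r01 H]]].
(* [2 * X <= Y ^+ 2] turns the exponent [k] into [2 * k], and one further factor [Y >= 8] absorbs
   the constants of [growth_proximity]. *)
exists (2 * k).+1, (8 + r0); split => //; first by lra.
move=> z; set x := cmod z; have x0 : 0 <= x by exact: cmod_ge0.
pose X := x + r0; have X1 : 1 <= X by rewrite /X; lra.
apply: (@le_trans _ _ (expR (4 * (proximity_function f (2 * X) + 1)))).
  by apply: growth_proximity => //; rewrite /X -/x; lra.
rewrite ler_expR.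
have HX : proximity_function f (2 * X) <= (2 * X) ^+ k by apply: H; rewrite /X; lra.
pose Y := 8 + r0 + x; rewrite -/Y; have Y8 : 8 <= Y by rewrite /Y; lra.
have Y2 : 2 * X <= Y ^+ 2.
  have h1 : X <= Y by rewrite /X /Y; lra.
  have h2 : 2 * X <= Y * Y by apply: ler_pM; lra.
  by rewrite expr2.
have Yk : 1 <= Y ^+ (2 * k) by rewrite exprn_ege1 //; lra.
have : (2 * X) ^+ k <= Y ^+ (2 * k).
  by rewrite exprM lerXn2r ?nnegrE ?exprn_ge0 //; lra.
have : 8 * Y ^+ (2 * k) <= Y ^+ (2 * k).+1.
  by rewrite exprS ler_wpM2r // (le_trans ler01).
lra.
Qed.

(** Serves sums and products alike. With [Z = c + d + |z| >= 2] both exponents are at most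
    [Z ^+ (k + m)], and the extra power of [Z] absorbs their doubling. *)
Lemma fin_growth_op f g h : fin_growth f -> fin_growth g ->
  (forall z (a b : R), 1 <= a -> 1 <= b -> cmod (f z) <= expR a ->
     cmod (g z) <= expR b -> cmod (h z) <= expR (a + b)) -> fin_growth h.
Proof.
move=> [k [c [k0 c1 Hf]]] [m [d [m0 d1 Hg]]] H.
exists (k + m).+1, (c + d); split => //; first by lra.
move=> z; set x := cmod z; have x0 : 0 <= x by exact: cmod_ge0.
apply: le_trans (H z _ _ _ _ (Hf z) (Hg z)) _; try by rewrite exprn_ege1 //; lra.
rewrite ler_expR -/x; set Z := c + d + x; have Z2 : 2 <= Z by rewrite /Z; lra.
have ab (a : R) n : 0 <= a -> a <= Z -> (n <= k + m)%N -> a ^+ n <= Z ^+ (k + m).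
  move=> a0 aZ nkm; apply: (@le_trans _ _ (Z ^+ n)).
    by rewrite lerXn2r ?nnegrE //; lra.
  by rewrite ler_weXn2l //; lra.
have h1 : (c + x) ^+ k <= Z ^+ (k + m).
  by apply: ab; rewrite ?leq_addr // /Z; lra.
have h2 : (d + x) ^+ m <= Z ^+ (k + m).
  by apply: ab; rewrite ?leq_addl // /Z; lra.
have h3 : 2 * Z ^+ (k + m) <= Z ^+ (k + m).+1.
  by rewrite exprS ler_wpM2r // exprn_ge0 //; lra.
lra.
Qed.

Lemma fin_growthM f g : fin_growth f -> fin_growth g ->
  fin_growth (fun z => f z * g z).
Proof.
move=> gf gg; apply: (fin_growth_op gf gg) => z a b _ _ Ha Hb.
by rewrite cmodM expRD ler_pM ?cmod_ge0.
Qed.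

Lemma fin_growthD f g : fin_growth f -> fin_growth g ->
  fin_growth (fun z => f z + g z).
Proof.
move=> gf gg; apply: (fin_growth_op gf gg) => z a b a1 b1 Ha Hb.
apply: (le_trans (ler_cmodD _ _)); rewrite expRD.
have e2 (x : R) : 1 <= x -> 2 <= expR x.
  by move=> x1; apply: le_trans (expR_ge1Dx x); lra.
have := e2 _ a1; have := e2 _ b1.
have : (expR a - 2) * (expR b - 2) >= 0 by rewrite mulr_ge0 // subr_ge0 e2.
move: (expR a) (expR b) Ha Hb => A B; lra.
Qed.

Lemma fin_growth_cst a : fin_growth (fun=> a).
Proof.
exists 1%N, (1 + cmod a); split => //; first by rewrite lerDl cmod_ge0.
move=> z; rewrite expr1; apply: le_trans (expR_ge1Dx _).
by have := cmod_ge0 z; lra.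
Qed.

Lemma fin_growth_id : fin_growth id.
Proof.
exists 1%N, 1; split => // z; rewrite expr1; apply: le_trans (expR_ge1Dx _).
by have := cmod_ge0 z; lra.
Qed.

Lemma fin_growth_poly (p : {poly C}) : fin_growth (fun z => p.[z]).
Proof.
elim/poly_ind: p => [|p a IH].
  rewrite (_ : (fun z => _) = fun=> 0); first exact: fin_growth_cst.
  by apply/funext => z; rewrite horner0.
rewrite (_ : (fun z => _) = fun z => p.[z] * z + a); last first.
  by apply/funext => z; rewrite hornerMXaddC.
apply: fin_growthD (fin_growth_cst a); exact: fin_growthM fin_growth_id.
Qed.

Lemma fin_growthB f g : fin_growth f -> fin_growth g ->
  fin_growth (fun z => f z - g z).
Proof.
move=> gf [k [c [k0 c1 Hg]]]; apply: fin_growthD => //.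
by exists k, c; split => // z; rewrite cmodN.
Qed.

Lemma fin_growth_shift f a : fin_growth f -> fin_growth (fun z => f (z + a)).
Proof.
move=> [k [c [k0 c1 H]]]; exists k, (c + cmod a); split => //.
  by have := cmod_ge0 a; lra.
move=> z; apply: (le_trans (H _)); rewrite ler_expR.
have := ler_cmodD z a; have := cmod_ge0 z; have := cmod_ge0 a; have := cmod_ge0 (z + a).
by move=> *; rewrite lerXn2r ?nnegrE //; lra.
Qed.

Lemma poly_asymptotic (p : {poly C}) n (e : R) : (size p <= n.+1)%N -> 0 < e ->
  exists2 r0 : R, 1 <= r0 & forall z, r0 <= cmod z ->
    cmod (p.[z] - p`_n * z ^+ n) <= e * cmod z ^+ n.
Proof.
move=> pn e0.
pose S : R := \sum_(i < n) cmod p`_i.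
have S0 : 0 <= S by apply: sumr_ge0 => i _; exact: cmod_ge0.
exists (Num.max 1 (S / e)); first by rewrite le_max lexx.
move=> z; rewrite ge_max => /andP[z1 zS].
have zp : 0 < cmod z by lra.
rewrite (horner_coef_wide _ pn) big_ord_recr /= addrK.
case: n pn @S S0 zS => [|n] pn S S0 zS.
  by rewrite big_ord0 cmod0 mulr_ge0 // ltW.
apply: (le_trans (ler_cmod_sum _ _ _)).
apply: (@le_trans _ _ (S * cmod z ^+ n)).
  rewrite mulr_suml; apply: ler_sum => i _; rewrite cmodM cmodX.
  by rewrite ler_wpM2l ?cmod_ge0 // ler_weXn2l // -ltnS.
rewrite exprS mulrA ler_wpM2r ?exprn_ge0 ?cmod_ge0 //.
by rewrite mulrC -ler_pdivrMr.
Qed.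

Lemma poly_lower (p : {poly C}) : p != 0 -> exists r0 c : R,
  [/\ 1 <= r0, 0 < c & forall z, r0 <= cmod z ->
    c * cmod z ^+ (size p).-1 <= cmod p.[z]].
Proof.
move=> p0; have l0 : 0 < cmod (lead_coef p) by rewrite cmod_gt0 lead_coef_eq0.
have l20 : 0 < cmod (lead_coef p) / 2 by rewrite divr_gt0.
have [r0 r01 H] := poly_asymptotic (leqSpred (size p)) l20.
exists r0, (cmod (lead_coef p) / 2); split => // z /H; rewrite -lead_coefE.
have := lerB_cmod (lead_coef p * z ^+ (size p).-1) (lead_coef p * z ^+ (size p).-1 - p.[z]).
rewrite subKr cmodB cmodM cmodX.
by move: (cmod _) (cmod z ^+ _) => *; lra.
Qed.

Lemma poly_upper (p : {poly C}) : exists (r0 c : R) n,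
  [/\ 1 <= r0, 0 < c & forall z, r0 <= cmod z -> cmod p.[z] <= c * cmod z ^+ n].
Proof.
have [r0 r01 H] := poly_asymptotic (leqSpred (size p)) ltr01.
exists r0, (cmod p`_(size p).-1 + 1), (size p).-1; split => //.
  by rewrite ltr_wpDl ?cmod_ge0.
move=> z /H; rewrite mul1r; set l := p`__; set Z := z ^+ _ => h.
rewrite -[p.[z]](subrK (l * Z)); apply: (le_trans (ler_cmodD _ _)).
by rewrite cmodM [cmod Z]cmodX mulrDl mul1r addrC lerD2l.
Qed.

Lemma poly_lower_cst (p : {poly C}) : p != 0 -> exists r0 c : R,
  [/\ 1 <= r0, 0 < c & forall z, r0 <= cmod z -> c <= cmod p.[z]].
Proof.
move=> /poly_lower[r0 [c [r01 c0 H]]]; exists r0, c; split => // z zr.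
apply: le_trans (H z zr); rewrite ler_peMr ?(ltW c0) // exprn_ege1 //.
exact: le_trans zr.
Qed.

Lemma finite_bounded (A : set C) : finite_set A ->
  exists2 M : R, 0 <= M & forall z, A z -> cmod z <= M.
Proof.
move=> /finite_seqP[s ->]; elim: s => [|a s [M M0 IH]]; first by exists 0.
exists (Num.max M (cmod a)); first by rewrite le_max M0.
move=> z /=; rewrite inE le_max => /orP[/eqP ->|zs]; first by rewrite lexx orbT.
by rewrite IH.
Qed.

Lemma cdiff_order f a : cdiff f -> (exists z, f z != 0) ->
  exists n g, [/\ cdiff g, g a != 0 & forall z, f z = (z - a) ^+ n * g z].
Proof.
move=> df [z fz].
have [|n [g [dg g0 E]]] := cdiff_order0 (cdiff_shift a df).
  by exists (z - a); rewrite subrKC.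
exists n, (fun w => g (- a + w)); split; first exact: cdiff_shift.
  by rewrite addNr.
by move=> w; rewrite [- a + w]addrC -E subrKC.
Qed.

(** Induction on a list that only has to contain the zeros: at an entry that is not a zero the order
    is 0 and nothing is divided out. *)
Lemma peel_zeros f (s : seq C) : cdiff f -> (exists z, f z != 0) ->
  (forall z, f z = 0 -> z \in s) ->
  exists (p : {poly C}) g, [/\ p != 0, cdiff g, forall z, g z != 0 &
    forall z, f z = p.[z] * g z].
Proof.
elim: s f => [|a s IH] f df fne fs.
  exists 1, f; split => //; first exact: oner_neq0.
    by move=> z; apply/eqP => /fs.
  by move=> z; rewrite hornerC mul1r.
have [n [g [dg ga E]]] := cdiff_order a df fne.
have [||p [h [p0 dh h0 Eh]]] := IH g dg.
- by exists a.
- move=> z gz; have : z \in a :: s by apply: fs; rewrite E gz mulr0.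
  by rewrite inE => /orP[/eqP za|//]; move: ga; rewrite -za gz eqxx.
exists (('X - a%:P) ^+ n * p), h; split => //.
  by rewrite mulf_neq0 // expf_neq0 // polyXsubC_eq0.
by move=> z; rewrite E Eh hornerM horner_exp hornerXsubC mulrA.
Qed.

(** Dividing out the zeros leaves [cexp h]. Far out the polynomial factor is bounded below, so the
    growth of [f] bounds [Re h] by a power of [|z|], and [h] is a polynomial. *)
Theorem hadamard_finite f : cdiff f -> fin_growth f ->
  finite_set [set z | f z = 0] ->
  exists p A : {poly C}, p != 0 /\ forall z, f z = p.[z] * cexp A.[z].
Proof.
move=> df [k [c [k0 c1 Hf]]] ffin.
have [M M0 HM] := finite_bounded ffin.
have fne : exists z, f z != 0.
  exists (M + 1)%:C; apply/eqP => /HM; rewrite cmodr ger0_norm; lra.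
have [s Hs] : exists s : seq C, [set z | f z = 0] = [set` s] by apply/finite_seqP.
have [|p [g [p0 dg g0 E]]] := @peel_zeros f s df fne.
  by move=> z fz; have : [set z | f z = 0] z by []; rewrite Hs.
have [h dh Eh] := nonvanishing_exp dg g0.
have [r0 [d [r01 d0 Hp]]] := poly_lower_cst p0.
(* The exponent leaves room: [(c + x) ^+ k <= x ^+ (k + k)] once [x] exceeds 2 and [c], and the last
   factor [x] absorbs [- ln d]. *)
have [|A HA] := @Re_growth_poly R h (k + k).+1 (Num.max r0 (Num.max (Num.max 2 c) (1 + `|ln d|))) dh.
  move=> z; rewrite !ge_max => /andP[z1 /andP[/andP[z2 zc] zd]].
  set x := cmod z in z1 z2 zc zd *.
  have H1 : expR (complex.Re (h z)) <= expR ((c + x) ^+ k - ln d).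
    rewrite expRB lnK ?posrE // ler_pdivlMr // mulrC.
    apply: le_trans (Hf z); rewrite E Eh cmodM cmod_cexp ler_wpM2r ?expR_ge0 //.
    exact: Hp.
  move: H1; rewrite ler_expR => /le_trans; apply.
  have x0 : 0 <= x by lra.
  have h1 : (c + x) ^+ k <= x ^+ (k + k).
    have -> : x ^+ (k + k) = (x * x) ^+ k by rewrite exprD exprMn.
    rewrite lerXn2r ?nnegrE ?mulr_ge0 //; try lra.
    apply: (@le_trans _ _ (2 * x)); first lra.
    by rewrite ler_wpM2r.
  have h2 : 1 <= x ^+ (k + k) by rewrite exprn_ege1 //; lra.
  have h3 : x ^+ (k + k).+1 = x ^+ (k + k) * x by rewrite exprSr.
  have h4 : x <= x ^+ (k + k).
    by rewrite -{1}[x]expr1 ler_weXn2l //; [lra|rewrite addn_gt0 k0].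
  have h5 : 2 * x ^+ (k + k) <= x ^+ (k + k).+1.
    by rewrite exprS ler_wpM2r // exprn_ge0.
  have := ler_norm (- ln d); rewrite normrN; lra.
exists p, A; split => // z; by rewrite E Eh HA.
Qed.

End FiniteOrder.

(** * Behaviour of polynomials in a cone about a ray *)

Section Rays.
Context {R : realType}.
Local Notation C := R[i].
Implicit Types (f g : C -> C) (z w a om : C) (r s t x y c e : R) (k n d : nat)
  (p q P A : {poly C}).

(** Validity in a truncated cone about the ray: the radius is proportional to [t], so bounded shifts
    of [w] stay inside once [t] is large. *)
Definition ray_near om (Q : R -> C -> Prop) := exists eta T : R,
  [/\ 0 < eta, 1 <= T &
    forall t w, T <= t -> cmod (w - t%:C * om) <= eta * t -> Q t w].

Lemma ray_nearI om (Q1 Q2 : R -> C -> Prop) : ray_near om Q1 -> ray_near om Q2 ->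
  ray_near om (fun t w => Q1 t w /\ Q2 t w).
Proof.
move=> [e1 [T1 [e10 T11 H1]]] [e2 [T2 [e20 T21 H2]]].
exists (Num.min e1 e2), (Num.max T1 T2); split; rewrite ?lt_min ?le_max ?e10 ?T11 //.
move=> t w; rewrite ge_max => /andP[t1 t2] h.
have t0 : 0 <= t by lra.
by split; [apply: H1|apply: H2] => //; apply: (le_trans h);
   rewrite ler_wpM2r // ge_min lexx ?orbT.
Qed.

(** After rescaling by [t] this is continuity of [v ^+ n] at [om] together with the smallness of the
    lower terms; each takes half of [e]. *)
Lemma poly_ray P n om e : (size P <= n.+1)%N -> om != 0 -> 0 < e ->
  ray_near om (fun t w => cmod (P.[w] - P`_n * (t%:C * om) ^+ n) <= e * t ^+ n).
Proof.
move=> Pn om0 e0; have o0 : 0 < cmod om by rewrite cmod_gt0.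
pose K := (cmod om + 1) ^+ n.
have K0 : 0 < K by rewrite exprn_gt0 // ltr_wpDl ?cmod_ge0.
have e10 : 0 < e / (2 * K) by rewrite divr_gt0 // mulr_gt0.
have [r0 r01 H] := poly_asymptotic Pn e10.
have l0 : 0 < cmod P`_n + 1 by rewrite ltr_wpDl ?cmod_ge0.
have e20 : 0 < e / (2 * (cmod P`_n + 1)) by rewrite divr_gt0 // mulr_gt0.
have [d d0 Hd] := cdiff_ccont om (cdiffX n (@cdiff_id R)) e20.
exists (Num.min (Num.min 1 (d / 2)) (cmod om / 2)), (Num.max 1 (2 * r0 / cmod om)).
split; first by rewrite !lt_min ltr01 !divr_gt0.
  by rewrite le_max lexx.
move=> t w; rewrite ge_max => /andP[t1 tr] h.
have t0 : 0 < t by lra.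
have {}h : cmod (w / t%:C - om) <= Num.min (Num.min 1 (d / 2)) (cmod om / 2).
  have -> : w / t%:C - om = (w - t%:C * om) / t%:C.
    by field; rewrite -cmod_eq0 cmodr normr_eq0 gt_eqF.
  by rewrite cmodM cmodV cmodr gtr0_norm // ler_pdivrMr.
move: h; rewrite !le_min => /andP[/andP[h1 h2] h3].
have wE : w = t%:C * (w / t%:C).
  by rewrite mulrC divfK // -cmod_eq0 cmodr normr_eq0 gt_eqF.
set v := w / t%:C in h1 h2 h3 wE.
have vd : cmod (v - om) < d by lra.
have v1 : cmod v <= cmod om + 1.
  by rewrite -[v](subrK om); apply: (le_trans (ler_cmodD _ _)); lra.
have v2 : cmod om / 2 <= cmod v.
  by have := lerB_cmod om (om - v); rewrite subKr [cmod (om - v)]cmodB; lra.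
have wr : r0 <= cmod w.
  rewrite wE cmodM cmodr gtr0_norm //.
  apply: (@le_trans _ _ (t * (cmod om / 2))); last by rewrite ler_wpM2l // ltW.
  by move: tr; rewrite ler_pdivrMr //; lra.
have wn : w ^+ n = (t ^+ n)%:C * v ^+ n by rewrite {1}wE exprMn rmorphXn.
have -> : P.[w] - P`_n * (t%:C * om) ^+ n =
    (P.[w] - P`_n * w ^+ n) + P`_n * (t ^+ n)%:C * (v ^+ n - om ^+ n).
  by rewrite wn exprMn rmorphXn /=; ring.
apply: (le_trans (ler_cmodD _ _)); rewrite (splitr (e * t ^+ n)) lerD //.
  apply: (le_trans (H _ wr)); rewrite wE cmodM exprMn cmodr gtr0_norm //.
  have : cmod v ^+ n <= K by rewrite lerXn2r ?nnegrE ?cmod_ge0 ?(le_trans _ v1) ?cmod_ge0.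
  move=> vK; have -> : e * t ^+ n / 2 = e / (2 * K) * (t ^+ n * K).
    by field; rewrite gt_eqF.
  by rewrite ler_wpM2l ?(ltW e10) // ler_wpM2l // exprn_ge0 // ltW.
rewrite 2!cmodM cmodr ger0_norm ?exprn_ge0 ?(ltW t0) //.
apply: (@le_trans _ _ (cmod P`_n * t ^+ n * (e / (2 * (cmod P`_n + 1))))).
  by rewrite ler_wpM2l ?mulr_ge0 ?cmod_ge0 ?exprn_ge0 ?(ltW t0) // ltW // Hd.
have -> : e * t ^+ n / 2 = (cmod P`_n + 1) * t ^+ n * (e / (2 * (cmod P`_n + 1))).
  by field; rewrite gt_eqF.
by rewrite ler_wpM2r ?(ltW e20) // ler_wpM2r ?exprn_ge0 ?(ltW t0) // lerDl.
Qed.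

Lemma poly_slow_variation p om e : p != 0 -> om != 0 -> 0 < e ->
  ray_near om (fun t w => p.[t%:C * om] != 0 /\
    cmod (p.[w] - p.[t%:C * om]) <= e * cmod p.[t%:C * om]).
Proof.
move=> p0 om0 e0; set n := (size p).-1.
pose m := cmod (lead_coef p) * cmod om ^+ n.
have m0 : 0 < m by rewrite mulr_gt0 ?exprn_gt0 ?cmod_gt0 ?lead_coef_eq0.
(* This [delta] solves [2 * delta = e * (m - delta)]: two errors against the leading term on one
   side, [e] times the resulting lower bound of [|p|] on the other. *)
have e10 : 0 < m * e / (2 + e) by rewrite divr_gt0 ?(mulr_gt0 m0 e0) // addr_gt0.
have [eta [T [eta0 T1 H]]] := poly_ray (leqSpred (size p)) om0 e10.
exists eta, T; split => // t w tT h; have t0 : 0 < t by lra.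
have H0 := H t (t%:C * om) tT.
have {H0} := H0 (ltac:(by rewrite subrr cmod0 mulr_ge0 // ltW)).
have := H t w tT h; rewrite -lead_coefE -/n.
set p0' := p.[t%:C * om]; set L := lead_coef p * _.
have LE : cmod L = m * t ^+ n.
  by rewrite cmodM cmodX cmodM cmodr gtr0_norm // exprMn /m mulrA mulrAC.
move=> h1 h2.
have B0 : (m - m * e / (2 + e)) * t ^+ n <= cmod p0'.
  by have := lerB_cmod L (L - p0'); rewrite subKr LE cmodB; lra.
have E2 : m - m * e / (2 + e) = m * 2 / (2 + e) by field; rewrite gt_eqF // addr_gt0.
split.
  rewrite -cmod_gt0; apply: lt_le_trans B0.
  rewrite E2 mulr_gt0 ?exprn_gt0 // divr_gt0 ?addr_gt0 //.
  by rewrite (@mulr_gt0 _ m 2).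
apply: (@le_trans _ _ (e * ((m - m * e / (2 + e)) * t ^+ n))); last first.
  by rewrite ler_wpM2l // ltW.
have -> : e * ((m - m * e / (2 + e)) * t ^+ n) =
    m * e / (2 + e) * t ^+ n + m * e / (2 + e) * t ^+ n.
  by rewrite E2; field; rewrite gt_eqF // addr_gt0.
have -> : p.[w] - p0' = (p.[w] - L) - (p0' - L) by ring.
by apply: (le_trans (ler_cmodB _ _)); rewrite lerD.
Qed.

Lemma cderiv_horner P z : cderiv (fun w => P.[w]) z P^`().[z].
Proof.
elim/poly_ind: P => [|P a IH].
  rewrite deriv0 horner0 (_ : (fun w => _) = fun=> 0); first exact: cderiv_cst.
  by apply/funext => w; rewrite horner0.
rewrite (_ : (fun w => _) = fun w => P.[w] * w + a); last first.
  by apply/funext => w; rewrite hornerMXaddC.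
have -> : (P * 'X + a%:P)^`().[z] = P^`().[z] * z + P.[z] * 1 + 0.
  by rewrite derivD derivC addr0 derivM derivX mulr1 hornerD hornerM hornerX mulr1 addr0.
exact: cderivD (cderivM IH (cderiv_id z)) (cderiv_cst a z).
Qed.

(* Schwarz's lemma applied to the remainder on a disc of radius comparable
   to [t]. *)
Lemma poly_taylor_ray A d om : (size A <= d.+1)%N -> om != 0 ->
  exists K eta' : R, [/\ 0 <= K, 0 < eta' & ray_near om (fun t w =>
    forall h, cmod h < eta' * t ->
      cmod (A.[w + h] - A.[w] - A^`().[w] * h) <= K * cmod h ^+ 2 * (t ^+ d / t ^+ 2))].
Proof.
move=> Ad om0; have [eta [T [eta0 T1 H]]] := poly_ray Ad om0 ltr01.
pose M := cmod A`_d * cmod om ^+ d + 1.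
have M0 : 0 <= M by rewrite addr_ge0 ?mulr_ge0 ?exprn_ge0 ?cmod_ge0.
have {}H t w : T <= t -> cmod (w - t%:C * om) <= eta * t -> cmod A.[w] <= M * t ^+ d.
  move=> tT h; have t0 : 0 < t by lra.
  have := H t w tT h; rewrite mul1r => B.
  rewrite -[A.[w]](subrK (A`_d * (t%:C * om) ^+ d)).
  apply: (le_trans (ler_cmodD _ _)); rewrite cmodM cmodX cmodM cmodr gtr0_norm // [(t * _) ^+ d]exprMn.
  by rewrite /M; move: B; move: (t ^+ d) (cmod om ^+ d) => *; lra.
have e20 : 0 < eta / 2 by rewrite divr_gt0.
exists (4 * M / (eta / 2) ^+ 2), (eta / 2); split => //.
  by rewrite divr_ge0 ?mulr_ge0 // ltW.
exists (eta / 2), T; split => // t w tT hw h hh; have t0 : 0 < t by lra.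
pose S := eta / 2 * t; have S0 : 0 < S by rewrite mulr_gt0.
pose F v := A.[w + v] - A.[w].
have dF : cdiff F.
  by apply: cdiffB; [exact: (cdiff_shift w (cdiff_poly A))|exact: cdiff_cst].
have F0 : F 0 = 0 by rewrite /F addr0 subrr.
have [E1 dE1 FE] := cdiff_divide0 dF F0.
have [E2 dE2 E1E] := cdiff_divide0 (cdiffB dE1 (cdiff_cst (E1 0))) (subrr _).
have E10 : A^`().[w] = E1 0.
  have h1 : cderiv F 0 (A^`().[w + 0] * 1).
    rewrite -[X in cderiv _ _ X]addr0; apply: cderivD; last exact: cderiv_cst.
    apply: (cderiv_comp (g := fun v => A.[v])) (cderiv_horner _ _).
    by rewrite -[1]add0r; apply: cderivD; [exact: cderiv_cst|exact: cderiv_id].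
  have h2 : cderiv F 0 (E1 0).
    have [l Hl] := dE1 0; have := cderivM (cderiv_id 0) Hl.
    by rewrite mul1r mul0r addr0 (_ : (fun v => _) = F) //; apply/funext => v; rewrite FE.
  by have := cderiv_unique h1 h2; rewrite addr0 mulr1.
have in_disc v : cmod v <= S -> cmod (w + v - t%:C * om) <= eta * t.
  move=> vS; rewrite addrAC; apply: (le_trans (ler_cmodD _ _)).
  by move: vS hw; rewrite /S; lra.
(* Each division by [v] costs a factor [S] on the circle of radius [S]: [m1] bounds the first
   quotient and [2 * m1 / S] the second, whence the constant [K]. *)
pose m1 := 2 * M * t ^+ d / S.
have B1 v : cmod v = S -> cmod (E1 v) <= m1.
  move=> vS; rewrite ler_pdivlMr // -[S in _ * S]vS -cmodM mulrC -FE.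
  apply: (le_trans (ler_cmodB _ _)).
  have := H t (w + v) tT (in_disc v (ltac:(by rewrite vS))).
  have := H t w tT; rewrite -{1}[w]addr0 => /(_ (in_disc 0 _)).
  by rewrite cmod0 => /(_ (ltW S0)); lra.
have B10 : cmod (E1 0) <= m1.
  by apply: (maximum_modulus dE1 B1); rewrite cmod0.
have B2 v : cmod v = S -> cmod (E2 v) <= 2 * m1 / S.
  move=> vS; rewrite ler_pdivlMr // -[S in _ * S]vS -cmodM mulrC -E1E.
  by apply: (le_trans (ler_cmodB _ _)); have := B1 v vS; lra.
have := maximum_modulus dE2 B2 hh => B.
have -> : A.[w + h] - A.[w] - A^`().[w] * h = h ^+ 2 * E2 h.
  by rewrite -[A.[w + h] - A.[w]]/(F h) FE E10 expr2 -mulrA -E1E; ring.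
rewrite cmodM cmodX.
have -> : 4 * M / (eta / 2) ^+ 2 * cmod h ^+ 2 * (t ^+ d / t ^+ 2) =
    cmod h ^+ 2 * (2 * m1 / S).
  by rewrite /m1 /S; field; rewrite !gt_eqF.
by rewrite ler_wpM2l // exprn_ge0 // cmod_ge0.
Qed.

(** Otherwise all [d] factors [|z0 - r|] would exceed [rho], and their product would exceed
    [rho ^+ d]. *)
Lemma near_root P d z0 (rho : R) : size P = d.+1 -> (0 < d)%N -> 0 < rho ->
  cmod P.[z0] <= cmod (lead_coef P) * rho ^+ d ->
  exists2 r : C, P.[r] = 0 & cmod (r - z0) <= rho.
Proof.
move=> Pd d0 rho0 H.
have P0 : P != 0 by rewrite -size_poly_gt0 Pd.
have l0 : lead_coef P != 0 by rewrite lead_coef_eq0.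
have [rs E] := closed_field_poly_normal P.
have rsd : size rs = d.
  by apply: succn_inj; rewrite -Pd E size_scale // size_prod_XsubC.
apply: contrapT => Hno.
have far (r : C) : r \in rs -> rho < cmod (z0 - r).
  move=> rrs; rewrite ltNge; apply/negP => h; apply: Hno; exists r; last by rewrite cmodB.
  by apply/eqP; rewrite -/(root P r) E rootZ // root_prod_XsubC.
move: H; rewrite {1}E hornerZ cmodM ler_pM2l ?cmod_gt0 //.
rewrite horner_prod -rsd.
have {}d0 : (0 < size rs)%N by rewrite rsd.
apply/negP; rewrite -ltNge.
case: rs {E rsd} d0 far => [//|r rs] _ far; rewrite big_cons /= exprS cmodM.
have hr : rho < cmod (z0 - r) by apply: far; rewrite inE eqxx.
have {far} far (r' : C) : r' \in rs -> rho <= cmod (z0 - r').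
  by move=> h; apply/ltW/far; rewrite inE h orbT.
have IH : rho ^+ size rs <= cmod (\prod_(j <- rs) ('X - j%:P).[z0]).
  elim: rs far {Hno} => [|s rs IH] far; first by rewrite big_nil cmod1.
  rewrite big_cons /= exprS cmodM ler_pM ?exprn_ge0 ?(ltW rho0) //.
    by rewrite hornerXsubC far // inE eqxx.
  by apply: IH => r' h; apply: far; rewrite inE h orbT.
have pos : 0 < cmod (\prod_(j <- rs) ('X - j%:P).[z0]).
  by apply: lt_le_trans IH; rewrite exprn_gt0.
rewrite hornerXsubC; apply: (@le_lt_trans _ _ (rho * cmod (\prod_(j <- rs) ('X - j%:P).[z0]))).
  by rewrite ler_wpM2l // ltW.
by rewrite ltr_pM2r.
Qed.

End Rays.

(** * Comparing polynomials with exponentials, and zeros of a perturbed [1 - exp s] *)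

Section ZerosOfExponentialPolynomials.
Context {R : realType}.
Local Notation C := R[i].
Implicit Types (f g : C -> C) (z w a om : C) (s t x y c e : R) (k n d : nat)
  (p q P A : {poly C}).

Lemma expR_dominates e c n : 0 < e -> exists2 T : R, 1 <= T &
  forall t, T <= t -> c * t ^+ n <= expR (e * t).
Proof.
move=> e0; have en : 0 < e ^+ n.+1 by rewrite exprn_gt0.
have f0 : 0 < n.+1`!%:R :> R by rewrite ltr0n fact_gt0.
exists (Num.max 1 (c * n.+1`!%:R / e ^+ n.+1)); first by rewrite le_max lexx.
move=> t; rewrite ge_max => /andP[t1 tc]; have t0 : 0 <= t by lra.
have et : 0 <= e * t by rewrite mulr_ge0 // ltW.
apply: (@le_trans _ _ ((e * t) ^+ n.+1 / n.+1`!%:R)); last first.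
  by apply: le_trans (expR_ge1Dxn n et); rewrite lerDr.
have -> : (e * t) ^+ n.+1 = (e ^+ n.+1 * t) * t ^+ n.
  by rewrite exprMn [t ^+ n.+1]exprS mulrA.
rewrite ler_pdivlMr // mulrAC ler_wpM2r ?exprn_ge0 //.
by rewrite [leRHS]mulrC -ler_pdivrMr.
Qed.

(** A quotient of polynomials is subexponential along a ray; for the zeros of [q + p exp A] this
    makes the logarithm of the quotient negligible. *)
Lemma poly_ratio_bound p q om e : q != 0 -> om != 0 -> 0 < e ->
  exists2 T : R, 1 <= T & forall t, T <= t ->
    cmod p.[t%:C * om] <= expR (e * t) * cmod q.[t%:C * om].
Proof.
move=> q0 om0 e0; have o0 : 0 < cmod om by rewrite cmod_gt0.
have [r1 [b [n [r11 b0 Hp]]]] := poly_upper p.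
have [r2 [c [r21 c0 Hq]]] := poly_lower_cst q0.
have [T T1 HT] := expR_dominates (b * cmod om ^+ n / c) n e0.
exists (Num.max T (Num.max (r1 / cmod om) (r2 / cmod om))).
  by rewrite le_max T1.
move=> t; rewrite !ge_max => /andP[tT /andP[tr1 tr2]]; have t0 : 0 < t by lra.
have E : cmod (t%:C * om) = t * cmod om by rewrite cmodM cmodr gtr0_norm.
have {}Hp := Hp (t%:C * om); have {}Hq := Hq (t%:C * om); rewrite E in Hp Hq.
move: tr1 tr2; rewrite !ler_pdivrMr // => /Hp{}Hp /Hq{}Hq.
apply: (le_trans Hp); have h := HT t tT.
apply: (@le_trans _ _ (b * cmod om ^+ n / c * t ^+ n * c)).
  by rewrite exprMn le_eqVlt; apply/orP; left; apply/eqP; field; rewrite gt_eqF.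
by rewrite ler_pM ?(ltW c0) // mulr_ge0 ?exprn_ge0 ?(ltW t0) // divr_ge0 ?mulr_ge0 ?exprn_ge0 ?cmod_ge0 ?(ltW b0) ?(ltW c0).
Qed.

(* If [g] had no zero in the disc, the mean value property of [1 / g] would
   bound [1 / |g 0|] by twice the maximum of [1 / |g|] on the circle. *)
Lemma perturbed_exp_zero : exists rho e : R, [/\ 0 < rho, 0 < e &
  forall g (K : C) (al be de : C -> C), K != 0 ->
    (forall s : C, cmod s <= rho -> exists l, cderiv g s l) ->
    (forall s : C, cmod s <= rho ->
      [/\ cmod (al s) <= e, cmod (be s) <= e, cmod (de s) <= e &
        g s = K * ((1 + be s) - (1 + al s) * cexp (s + de s))]) ->
    exists2 s : C, cmod s <= rho & g s = 0].
Proof.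
have [d0 d00 H0] := (proj1 (cderivP _ _ _) (@cderiv_cexp0 R)) (1/2) (ltac:(lra)).
pose rho := Num.min (d0 / 2) (1/2).
have rho0 : 0 < rho by rewrite lt_min divr_gt0 //; lra.
have rho1 : rho <= 1/2 by rewrite ge_min lexx orbT.
have rhod : rho < d0 by rewrite gt_min; apply/orP; left; lra.
have H (s : C) : cmod s <= rho -> cmod (cexp s - 1 - s) <= 1/2 * cmod s.
  move=> hs; have := H0 s; rewrite subr0 cexp0 mul1r; apply; lra.
have expB (s : C) : cmod s <= rho -> cmod (cexp s - 1) <= 3/2 * cmod s.
  move=> hs; have -> : cexp s - 1 = (cexp s - 1 - s) + s by rewrite subrK.
  by apply: (le_trans (ler_cmodD _ _)); have := H s hs; lra.
have expL (s : C) : cmod s <= rho -> cmod s / 2 <= cmod (cexp s - 1).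
  move=> hs; have := H s hs; have := lerB_cmod s (s - (cexp s - 1)).
  by rewrite subKr [cmod (s - _)]cmodB; lra.
(* Since [rho / 2 = 20 * e], [|g|] is at most [5 * e * |K|] at [0] and at least [(20 - 9) * e * |K|]
   on the circle. As [11 > 2 * 5], the factor 2 lost in [ler_circ] is affordable. *)
pose e := rho / 40; have e0 : 0 < e by rewrite divr_gt0.
exists rho, e; split => // g K al be de K0 dg Hg.
apply: contrapT => Hno.
have gn0 (s : C) : cmod s <= rho -> g s != 0.
  by move=> hs; apply/eqP => gs; apply: Hno; exists s.
have k0 : 0 < cmod K by rewrite cmod_gt0.
have small (s : C) : cmod s <= rho -> cmod (cexp (de s) - 1) <= 2 * e.
  move=> hs; have [_ _ h _] := Hg s hs.
  by apply: (le_trans (expB _ _)); rewrite /e in h *; lra.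
have g0 : cmod (g 0) <= cmod K * (5 * e).
  have z0 : cmod (0 : C) <= rho by rewrite cmod0 ltW.
  have [h1 h2 h3 ->] := Hg 0 z0; have h4 := small 0 z0.
  rewrite add0r cmodM ler_pM2l //; set E := cexp (de 0) in h4 *.
  have -> : 1 + be 0 - (1 + al 0) * E = be 0 - (E - 1) - al 0 * E by ring.
  apply: (le_trans (ler_cmodB _ _)); have := ler_cmodB (be 0) (E - 1); rewrite cmodM.
  have E2 : cmod E <= 2.
    by rewrite -[E](subrK 1); apply: (le_trans (ler_cmodD _ _)); rewrite cmod1 /e in h4 *; lra.
  have : cmod (al 0) * cmod E <= e * 2 by rewrite ler_pM ?cmod_ge0.
  lra.
have gc (s : C) : cmod s = rho -> cmod K * (11 * e) <= cmod (g s).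
  move=> hs; have hs' : cmod s <= rho by rewrite hs.
  have [h1 h2 h3 ->] := Hg s hs'; have h4 := small s hs'.
  rewrite cexpD cmodM ler_pM2l //; set E := cexp (de s) in h4 *; set S := cexp s.
  have := expL s hs'; have := expB s hs'; rewrite -/S hs => b1 b2.
  have S2 : cmod S <= 2.
    by rewrite -[S](subrK 1); apply: (le_trans (ler_cmodD _ _)); rewrite cmod1; lra.
  have E2 : cmod E <= 2.
    by rewrite -[E](subrK 1); apply: (le_trans (ler_cmodD _ _)); rewrite cmod1 /e in h4 *; lra.
  have -> : 1 + be s - (1 + al s) * (S * E) =
      - ((S - 1) - (be s - S * ((E - 1) + al s * E))) by ring.
  rewrite cmodN; apply: le_trans (lerB_cmod _ _).
  have := ler_cmodB (be s) (S * ((E - 1) + al s * E)); rewrite cmodM.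
  have hE : cmod ((E - 1) + al s * E) <= 2 * e + e * 2.
    apply: (le_trans (ler_cmodD _ _)); rewrite lerD // cmodM.
    by rewrite ler_pM ?cmod_ge0.
  have : cmod S * cmod ((E - 1) + al s * E) <= 2 * (2 * e + e * 2).
    by rewrite ler_pM ?cmod_ge0.
  by rewrite /e in h2 *; lra.
have dinv (s : C) : cmod s <= rho -> exists l, cderiv (fun v => (g v)^-1) s l.
  move=> hs; have [l Hl] := dg s hs; eexists.
  exact: (cderiv_comp (g := fun v => v^-1)) Hl (cderivV (gn0 s hs)).
have := mean_value rho0 dinv => /(congr1 (@cmod R)).
rewrite cmodM cmodr ger0_norm ?twopi_ge0 // => E.
have : cmod (circ (fun v => (g v)^-1) rho) <= 4 * pi * (cmod K * (11 * e))^-1.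
  apply: ler_circ; first exact: ltW.
    by move=> s hs; have [|l] := dinv s; [rewrite hs|exact: cderiv_ccont].
  move=> s hs; rewrite cmodV lef_pV2 ?posrE ?mulr_gt0 //; first exact: gc.
  by rewrite cmod_gt0 gn0 // hs.
rewrite E cmodV.
have : (cmod K * (5 * e))^-1 <= (cmod (g 0))^-1.
  rewrite lef_pV2 ?posrE ?mulr_gt0 // cmod_gt0 gn0 // cmod0 ltW //.
rewrite -(ler_pM2l (@twopi_gt0 R)) => h1 h2; have := le_trans h1 h2.
have -> : 4 * pi * (cmod K * (11 * e))^-1 = 2 * pi * (2 * (cmod K * (11 * e))^-1).
  by move: (pi : R) => P; ring.
rewrite ler_pM2l ?twopi_gt0 //.
have ke : 0 < cmod K * e by rewrite mulr_gt0.
have -> : (cmod K * (5 * e))^-1 = (cmod K * e)^-1 / 5 by field; rewrite !gt_eqF.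
have -> : (cmod K * (11 * e))^-1 = (cmod K * e)^-1 / 11 by field; rewrite !gt_eqF.
have : 0 < (cmod K * e)^-1 by rewrite invr_gt0.
lra.
Qed.

End ZerosOfExponentialPolynomials.

(** * Zeros of [q + p exp A] near critical rays *)

Section ExistenceOfZeros.
Context {R : realType}.
Local Notation C := R[i].
Implicit Types (f g : C -> C) (z w a om : C) (t x y c e kappa eta : R) (k n d : nat)
  (p q P A : {poly C}).

Lemma ray_near_large om (Q : R -> C -> Prop) (T0 : R) : ray_near om Q ->
  ray_near om (fun t w => T0 <= t /\ Q t w).
Proof.
move=> [eta [T [eta0 T1 H]]]; exists eta, (Num.max T T0); split => //.
  by rewrite le_max T1.
by move=> t w; rewrite ge_max => /andP[tT tT0] h; split => //; exact: H.
Qed.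

Lemma bounded_log u (M : R) : u != 0 -> cmod u <= expR M -> cmod u^-1 <= expR M ->
  exists2 L, cexp L = u & cmod L <= M + 2 * pi.
Proof.
move=> u0 h1 h2; have m0 : 0 < cmod u by rewrite cmod_gt0.
have [|t /andP[t0 t1] tE] := @cis_onto R (u / (cmod u)%:C).
  by rewrite cmodM cmodV cmodr gtr0_norm // divff // gt_eqF.
exists (ln (cmod u) +i* t).
  by rewrite cexp_ln // tE mulrC divfK // -cmod_eq0 cmodr normr_eq0 gt_eqF.
apply: (le_trans (ler_cmod_ReIm _)) => /=; rewrite lerD //; last by rewrite ger0_norm.
rewrite ler_norml lerNl; apply/andP; split.
  by rewrite -lnV ?posrE // -cmodV -ler_expR lnK ?posrE // cmodV invr_gt0.
by rewrite -ler_expR lnK.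
Qed.

Lemma cis_2pin (kappa : R) n : kappa = 1 \/ kappa = -1 ->
  cis (kappa * (2 * pi * n%:R)) = 1 :> C.
Proof.
have H : cis (2 * pi * n%:R) = 1 :> C by rewrite mulr_natr cisMn cis_2pi expr1n.
by move=> [->|->]; [rewrite mul1r|rewrite mulN1r cisN H invr1].
Qed.

(** Radii at which the leading term ['i * kappa * t ^+ d] is an exact multiple of [2 * pi * 'i],
    hence invisible to [cexp]. *)
Lemma large_power d (T : R) : (0 < d)%N -> 1 <= T ->
  exists t n, T <= t /\ t ^+ d = 2 * pi * n%:R.
Proof.
move=> d0 T1; pose n := (Num.bound (T ^+ d)).+1.
have nT : T ^+ d <= n%:R.
  apply: le_trans (ltW (archi_boundP _)) _; last by rewrite ler_nat.
  by rewrite exprn_ge0 // (le_trans ler01).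
have N0 : 0 < 2 * pi * n%:R :> R by rewrite mulr_gt0 ?twopi_gt0 ?ltr0n.
have dR : 0 < d%:R :> R by rewrite ltr0n.
have td : expR (ln (2 * pi * n%:R) / d%:R) ^+ d = 2 * pi * n%:R :> R.
  have := expRM_natl d (ln (2 * pi * n%:R) / d%:R : R).
  by rewrite mulrC divfK ?gt_eqF // lnK // => <-.
exists (expR (ln (2 * pi * n%:R) / d%:R)), n; split => //.
rewrite -(@ler_pXn2r _ d) ?nnegrE ?expR_ge0 ?(le_trans ler01 T1) // td.
apply: (le_trans nT); rewrite ler_peMl ?ler0n //.
by have := @pi_ge2 R; lra.
Qed.

(* [A z = i kappa N + L] is solved exactly near [t * om], with [exp L] the value
   of [- q / p] at [t * om]; at the scale [1 / A'], the function [q + p exp A] is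
   then a small perturbation of [q (1 - exp s)]. *)
Theorem exp_poly_zeros p q A d om kappa eta T0 :
  p != 0 -> q != 0 -> size A = d.+1 -> (0 < d)%N ->
  kappa = 1 \/ kappa = -1 -> lead_coef A * om ^+ d = 0 +i* kappa -> 0 < eta ->
  exists t w, [/\ T0 <= t, cmod (w - t%:C * om) <= eta * t &
    q.[w] + p.[w] * cexp A.[w] = 0].
Proof.
move=> p0 q0 Ad d0 kap lom eta0.
have A0 : A != 0 by rewrite -size_poly_gt0 Ad.
have lA : 0 < cmod (lead_coef A) by rewrite cmod_gt0 lead_coef_eq0.
have lAE : lead_coef A = A`_d by rewrite lead_coefE Ad.
have kap1 : `|kappa| = 1 by case: kap => ->; rewrite ?normrN normr1.
have kapC : 0 +i* kappa != 0 :> C.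
  rewrite -cmod_eq0 cmodE /= expr0n add0r sqrtr_sqr kap1; exact: oner_neq0.
have om0 : om != 0.
  by apply: contraNneq kapC => om0; rewrite -lom om0 expr0n (gtn_eqF d0) mulr0n mulr0.
have [rho [e [rho0 e0 HP]]] := @perturbed_exp_zero R.
have [K [eta1 [K0 eta10 Htay]]] := @poly_taylor_ray R A d om (eq_leq Ad) om0.
have [dd dE] : exists dd, d = dd.+1 by exists d.-1; rewrite prednK.
have sA' : (size A^`() <= dd.+1)%N by rewrite -dE -ltnS -Ad lt_size_deriv.
pose lc := A^`()`_dd * om ^+ dd.
have lc0 : lc != 0.
  rewrite mulf_neq0 ?expf_neq0 // coef_deriv -dE -lAE.
  by rewrite -mulr_natr mulf_neq0 ?lead_coef_eq0 // natC -cmod_eq0 cmodr normr_nat pnatr_eq0 dE.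
pose cl := cmod lc / 2.
have cl0 : 0 < cl by rewrite divr_gt0 // cmod_gt0.
have Hder := poly_ray sA' om0 cl0.
have Hp := poly_slow_variation p0 om0 e0.
have Hq := poly_slow_variation q0 om0 e0.
(* The last two entries put the displacements [sg * s], of size at most [rho / cl], within reach of
   the Taylor estimate and make its error at most [e]. *)
pose Tbig : R := Num.max T0 (Num.max ((rho / cl + 1) / eta1) (K * (rho / cl) ^+ 2 / e)).
have [eta2 [T2 [eta20 T21 HH]]] := ray_near_large Tbig (ray_nearI Htay (ray_nearI Hder (ray_nearI Hp Hq))).
pose etam := Num.min eta eta2.
have etam0 : 0 < etam by rewrite lt_min eta0.
have etam1 : etam <= eta by rewrite ge_min lexx.
have etam2 : etam <= eta2 by rewrite ge_min lexx orbT.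
pose eta3 := etam / 2.
have eta30 : 0 < eta3 by rewrite divr_gt0.
(* At [t * om] the polynomial [B] below has three contributions of at most [e2 * t ^+ d]: the lower
   terms of [A] and the two parts of the bound on [L]. The 4 keeps their sum under the threshold of
   [near_root] for radius [eta3 * t]. *)
pose e2 := cmod (lead_coef A) * eta3 ^+ d / 4.
have e20 : 0 < e2 by rewrite divr_gt0 // mulr_gt0 // exprn_gt0.
have [eta4 [T4 [eta40 T41 HA]]] := poly_ray (eq_leq Ad) om0 e20.
have [T5 T51 HT5] := poly_ratio_bound p q0 om0 e20.
have [T6 T61 HT6] := poly_ratio_bound q p0 om0 e20.
pose T : R := Num.max (Num.max T2 T4) (Num.max (Num.max T5 T6)
  (Num.max (2 * pi / e2) (2 * (rho / cl) / etam))).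
have T1 : 1 <= T by rewrite !le_max T21.
have [t [n [tT tn]]] := large_power d0 T1.
move: tT; rewrite !ge_max => /andP[/andP[tT2 tT4] /andP[/andP[tT5 tT6] /andP[tpi trho]]].
have t1 : 1 <= t := le_trans T21 tT2.
have t0 : 0 < t := lt_le_trans ltr01 t1.
have tom : cmod (t%:C * om - t%:C * om) <= eta2 * t.
  by rewrite subrr cmod0 mulr_ge0 // ltW.
have [_ [_ [_ [[pt _] [qt _]]]]] := HH t _ tT2 tom.
set p0' := p.[t%:C * om] in pt HT5 HT6 *; set q0' := q.[t%:C * om] in qt *.
pose u : C := - (q0' / p0').
have u0 : u != 0 by rewrite oppr_eq0 mulf_neq0 // invr_eq0.
have [L LE Lb] : exists2 L, cexp L = u & cmod L <= e2 * t + 2 * pi.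
  apply: bounded_log => //.
    by rewrite cmodN cmodM cmodV ler_pdivrMr ?cmod_gt0 // HT6.
  by rewrite cmodV cmodN cmodM cmodV invfM invrK mulrC ler_pdivrMr ?cmod_gt0 // HT5.
pose b : C := 0 +i* (kappa * (2 * pi * n%:R)) + L.
pose B : {poly C} := A - b%:P.
have sB : (size (- b%:P)%R < size A)%N.
  by rewrite size_polyN (leq_ltn_trans (size_polyC_leq1 _)) // Ad ltnS.
have Bd : size B = d.+1 by rewrite size_polyDl.
have lB : lead_coef B = lead_coef A by rewrite lead_coefDl.
have B0 : cmod B.[t%:C * om] <= cmod (lead_coef B) * (eta3 * t) ^+ d.
  have -> : B.[t%:C * om] = (A.[t%:C * om] - A`_d * (t%:C * om) ^+ d) - L.
    rewrite /B /b hornerD hornerN hornerC opprD addrA; congr (_ - _ - L).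
    have -> : A`_d * (t%:C * om) ^+ d = (t ^+ d)%:C * (0 +i* kappa).
      by rewrite exprMn mulrCA -lAE lom rmorphXn.
    by rewrite tn; apply: eqC; rewrite ?ReM ?ImM /=; ring.
  apply: (le_trans (ler_cmodB _ _)).
  have h1 : cmod (A.[t%:C * om] - A`_d * (t%:C * om) ^+ d) <= e2 * t ^+ d.
    by apply: HA => //; rewrite subrr cmod0 mulr_ge0 // ltW.
  have h2 : t <= t ^+ d by rewrite -{1}[t]expr1 ler_weXn2l.
  have h3 : 2 * pi <= e2 * t by move: tpi; rewrite ler_pdivrMr // [t * _]mulrC.
  have h4 : e2 * t <= e2 * t ^+ d by rewrite ler_wpM2l // ltW.
  have -> : cmod (lead_coef B) * (eta3 * t) ^+ d = 4 * (e2 * t ^+ d).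
    by rewrite lB exprMn /e2; field.
  have : 0 <= e2 * t ^+ d by rewrite mulr_ge0 ?exprn_ge0 // ltW.
  by move: h1 Lb h3 h4; clear; lra.
have et0 : 0 < eta3 * t by rewrite mulr_gt0.
have [z Bz zt] := near_root Bd d0 et0 B0.
have Az : cexp A.[z] = u.
  move: Bz; rewrite /B /b hornerD hornerN hornerC => /eqP; rewrite subr_eq0 => /eqP ->.
  by rewrite cexpD LE cexp_i cis_2pin // mul1r.
have eta32 : eta3 <= eta2 by rewrite /eta3; move: etam2 etam0; clear; lra.
have [Tb [Hz1 [Hz2 _]]] := HH t z tT2 (le_trans zt (ler_wpM2r (ltW t0) eta32)).
move: Tb; rewrite !ge_max => /andP[tT0 /andP[tr1 tr2]].
have tdd : 1 <= t ^+ dd by rewrite exprn_ege1.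
have A'z : cl * t ^+ dd <= cmod A^`().[z].
  have := lerB_cmod (A^`()`_dd * (t%:C * om) ^+ dd) (A^`()`_dd * (t%:C * om) ^+ dd - A^`().[z]).
  rewrite subKr cmodB.
  have -> : A^`()`_dd * (t%:C * om) ^+ dd = (t ^+ dd)%:C * lc.
    by rewrite /lc exprMn rmorphXn /= mulrCA.
  have := Hz2; rewrite -/cl.
  have -> : A^`()`_dd * (t%:C * om) ^+ dd = (t ^+ dd)%:C * lc.
    by rewrite /lc exprMn rmorphXn /= mulrCA.
  have -> : cmod ((t ^+ dd)%:C * lc) = 2 * (cl * t ^+ dd).
    by rewrite cmodM cmodr ger0_norm ?exprn_ge0 ?(ltW t0) // /cl; field.
  by clear; lra.
have A'0 : 0 < cmod A^`().[z].
  by apply: lt_le_trans A'z; rewrite mulr_gt0 // exprn_gt0.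
(* On this scale [A] is nearly linear: [A.[z + sg * s]] is [A.[z] + s] up to the small error
   [de s]. *)
pose sg := (A^`().[z])^-1.
have sgb (s : C) : cmod s <= rho -> cmod (sg * s) * t ^+ dd <= rho / cl.
  move=> hs; rewrite cmodM cmodV ler_pdivlMr //.
  set m := cmod A^`().[z] in A'z A'0 *.
  have -> : m^-1 * cmod s * t ^+ dd * cl = cmod s * ((cl * t ^+ dd) / m).
    by field; rewrite gt_eqF.
  have q0'' : 0 <= cl * t ^+ dd / m.
    by rewrite divr_ge0 ?(ltW A'0) // ltW // mulr_gt0 // exprn_gt0.
  by rewrite -[leRHS]mulr1 ler_pM ?cmod_ge0 // ler_pdivrMr // mul1r.
have sgs (s : C) : cmod s <= rho -> cmod (sg * s) <= rho / cl.
  by move=> hs; apply: le_trans (sgb s hs); rewrite ler_peMr ?cmod_ge0.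
have disc (s : C) : cmod s <= rho -> cmod (z + sg * s - t%:C * om) <= etam * t.
  move=> hs; rewrite addrAC; apply: (le_trans (ler_cmodD _ _)); have := sgs s hs.
  have : 2 * (rho / cl) <= t * etam by move: trho; rewrite ler_pdivrMr.
  by move: zt; rewrite /eta3; clear; lra.
pose g s := q.[z + sg * s] + p.[z + sg * s] * cexp A.[z + sg * s].
(* Because [p0' * cexp A.[z] = - q0'], these errors put [g s] exactly into the form required by
   [perturbed_exp_zero], with [K = q0']. *)
pose al s := (p.[z + sg * s] - p0') / p0'.
pose be s := (q.[z + sg * s] - q0') / q0'.
pose de s := A.[z + sg * s] - A.[z] - s.
have [||s hs gs] := HP g q0' al be de qt.
- move=> s hs; have dg : cdiff g.
    have ds : cdiff (fun s => z + sg * s).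
      by apply: cdiffD; [exact: cdiff_cst|exact: (cdiff_scale sg (@cdiff_id R))].
    apply: cdiffD; first exact: (cdiff_comp ds (cdiff_poly q)).
    apply: cdiffM; first exact: (cdiff_comp ds (cdiff_poly p)).
    by apply: cdiff_comp cdiff_cexp; exact: (cdiff_comp ds (cdiff_poly A)).
  exact: dg.
- move=> s hs; have [_ [_ [_ [[_ hp] [_ hq]]]]] := HH t _ tT2 (le_trans (disc s hs) (ler_wpM2r (ltW t0) etam2)); split.
  + by rewrite cmodM cmodV ler_pdivrMr ?cmod_gt0.
  + by rewrite cmodM cmodV ler_pdivrMr ?cmod_gt0.
  + have -> : de s = A.[z + sg * s] - A.[z] - A^`().[z] * (sg * s).
      by rewrite /de /sg mulVKf // -cmod_gt0.
    apply: (le_trans (Hz1 _ _)).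
      apply: (le_lt_trans (sgs s hs)); move: tr1; rewrite ler_pdivrMr // mulrC.
      by move: (rho / cl) => rc; clear; lra.
    have -> : t ^+ d = t * t ^+ dd by rewrite dE exprS.
    set m := cmod (sg * s).
    have -> : K * m ^+ 2 * (t * t ^+ dd / t ^+ 2) = K * (m * t ^+ dd) * m / t.
      by field; rewrite gt_eqF.
    rewrite ler_pdivrMr //.
    apply: (@le_trans _ _ (K * (rho / cl) ^+ 2)); last first.
      by move: tr2; rewrite ler_pdivrMr // [t * e]mulrC.
    have m0 : 0 <= m by exact: cmod_ge0.
    rewrite -[K * _ * m]mulrA ler_wpM2l // expr2.
    by apply: ler_pM; rewrite ?sgb ?sgs // mulr_ge0 ?exprn_ge0 ?(ltW t0).
  + have -> : cexp (s + de s) = cexp A.[z + sg * s] / u.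
      by rewrite -Az -cexpB; congr cexp; rewrite /de; ring.
    rewrite /g /al /be /u; field.
    by rewrite pt qt.
exists t, (z + sg * s); split => //.
by apply: (le_trans (disc s hs)); rewrite ler_wpM2r // ltW.
Qed.

End ExistenceOfZeros.

(** * Products [f z * f (z + c)] and the degree of the exponent *)

Section ShiftedProducts.
Context {R : realType}.
Local Notation C := R[i].
Implicit Types (f g : C -> C) (z w a c om : C) (t x y e kappa eta : R) (k n d : nat)
  (p q P Q A B : {poly C}).

Lemma nth_root a d : (0 < d)%N -> exists om, om ^+ d = a.
Proof.
move=> d0; have [->|a0] := eqVneq a 0; first by exists 0; rewrite expr0n (gtn_eqF d0).
have [w Hw] := cexp_onto a0; exists (cexp (w / d%:R)).
by rewrite -cexpMn -(mulr_natr (w / d%:R)) divfK // natC -cmod_eq0 cmodr normr_nat pnatr_eq0 -lt0n.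
Qed.

Lemma poly_zeros_finite P : P != 0 -> finite_set [set z | P.[z] = 0].
Proof.
move=> P0; have [rs E] := closed_field_poly_normal P.
apply: (@sub_finite_set _ _ [set` rs]); last exact: finite_seq.
move=> z /= /eqP; rewrite -/(root P z) E rootZ ?lead_coef_eq0 //.
by rewrite root_prod_XsubC.
Qed.

Lemma poly_large_zeros P : (forall T : R, exists2 z, T <= cmod z & P.[z] = 0) -> P = 0.
Proof.
move=> H; apply/eqP/negP => /negP /poly_lower_cst[r [b [_ b0 Hb]]].
have [z zr Pz] := H r; have := Hb z zr; rewrite Pz cmod0 leNgt b0 //.
Qed.

Lemma shift_poly p c : exists2 pc : {poly C}, forall z, pc.[z] = p.[z + c] &
  lead_coef pc = lead_coef p.
Proof.
exists (p \Po ('X + c%:P)); first by move=> z; rewrite horner_comp !hornerE.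
rewrite lead_coef_comp ?size_XaddC //.
by rewrite lead_coefXaddC expr1n mulr1.
Qed.

(** On the ray where the leading term of [B] is a positive real, [Re B] is at least [t / 2] both at
    [z] and at [z + c]; the product of the two exponentials outgrows any quotient of polynomials. *)
Lemma exp_shift_not_poly P Q B d c : P != 0 -> size B = d.+1 -> (0 < d)%N ->
  ~ (forall z, Q.[z] = P.[z] * cexp B.[z] * (P.[z + c] * cexp B.[z + c])).
Proof.
move=> P0 Bd d0 H.
have b0 : lead_coef B != 0 by rewrite lead_coef_eq0 -size_poly_gt0 Bd.
have [om Hom] := nth_root (lead_coef B)^-1 d0.
have om0 : om != 0.
  by apply: contraNneq b0 => E; move: Hom; rewrite E expr0n (gtn_eqF d0) mulr0n => /eqP; rewrite eq_sym invr_eq0.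
have o0 : 0 < cmod om by rewrite cmod_gt0.
have [pc Hpc _] := shift_poly P c.
have pc0 : pc != 0.
  apply/eqP => E; move/eqP: P0; apply; apply: poly_large_zeros => T.
  exists (`|T|%:C); first by rewrite cmodr normr_id ler_norm.
  by rewrite -[_%:C](subrK c) -Hpc E horner0.
have PP0 : P * pc != 0 by rewrite mulf_neq0.
have h12 : 0 < 1/2 :> R by lra.
have [eta [T [eta0 T1 HB]]] := poly_ray (eq_leq Bd) om0 h12.
have h14 : 0 < 1/4 :> R by lra.
have h18 : 0 < 1/8 :> R by lra.
have [T2 T21 HT2] := poly_ratio_bound Q PP0 om0 h14.
have [T3 T31 HT3] := expR_dominates 2 0 h14.
have [r [b [r1 bp Hb]]] := poly_lower_cst PP0.
pose t : R := Num.max (Num.max T (r / cmod om)) (Num.max (Num.max T2 T3) (cmod c / eta)).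
have [[tT tr] [[tT2 tT3] tc]] : (T <= t /\ r / cmod om <= t) /\ ((T2 <= t /\ T3 <= t) /\ cmod c / eta <= t).
  by rewrite !le_max !lexx !orbT.
have t1 : 1 <= t := le_trans T1 tT.
have t0 : 0 < t := lt_le_trans ltr01 t1.
have td : t <= t ^+ d by rewrite -{1}[t]expr1 ler_weXn2l.
have ReB w : cmod (w - t%:C * om) <= eta * t -> t / 2 <= complex.Re B.[w].
  move=> /(HB t w tT); have -> : B`_d * (t%:C * om) ^+ d = (t ^+ d)%:C.
    have -> : B`_d = lead_coef B by rewrite lead_coefE Bd.
    by rewrite exprMn Hom rmorphXn /= mulrCA divff // mulr1.
  move=> h; have := le_trans (ler_Re_cmod _) h.
  by rewrite ReB /= ler_norml => /andP[h1 _]; lra.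
have q1 : t / 2 <= complex.Re B.[t%:C * om].
  by apply: ReB; rewrite subrr cmod0 mulr_ge0 // ltW.
have q2 : t / 2 <= complex.Re B.[t%:C * om + c].
  by apply: ReB; rewrite addrAC subrr add0r -ler_pdivrMl // mulrC.
set z := t%:C * om in q1 q2.
have zr : r <= cmod z by rewrite /z cmodM cmodr gtr0_norm // -ler_pdivrMr.
have E : cmod Q.[z] = cmod (P * pc).[z] * (expR (complex.Re B.[z]) * expR (complex.Re B.[z + c])).
  by rewrite H hornerM Hpc -!cmod_cexp -!cmodM; congr cmod; ring.
have := HT2 t tT2; rewrite -/z E mulrC ler_pM2r; last first.
  by apply: lt_le_trans (Hb z zr).
rewrite -expRD leNgt => /negP; apply; rewrite ltr_expR.
have := t0; move: q1 q2; clear; lra.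
Qed.

(** For nonzero [Q] the zeros of [f] are among those of [Q], so [f = P * exp B]; a constant [B]
    contradicts transcendence, any other contradicts [exp_shift_not_poly]. *)
Lemma product_not_poly f c Q : cdiff f -> fin_growth f -> transcendental f ->
  ~ (forall z, f z * f (z + c) = Q.[z]).
Proof.
move=> df gf tf H; have dfc := cdiff_shiftr c df.
have [Q0|Q0] := eqVneq Q 0.
  have f0 : forall z, f z = 0.
    have [//|h] := cdiff_integral df dfc (fun z => etrans (H z) (ltac:(by rewrite Q0 horner0))).
    by move=> z; have := h (z - c); rewrite subrK.
  by apply: tf; exists 0 => z; rewrite horner0.
have [|P [B [P0 E]]] := hadamard_finite df gf.
  apply: sub_finite_set (poly_zeros_finite Q0) => z /= fz.
  by rewrite -H fz mul0r.
case sB : (size B) => [|[|d]].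
- apply: tf; exists P => z; rewrite E.
  by move/eqP: sB; rewrite size_poly_eq0 => /eqP ->; rewrite horner0 cexp0 mulr1.
- apply: tf; exists (cexp B`_0 *: P) => z; rewrite E hornerZ mulrC.
  by have := size1_polyC (eq_leq sB) => ->; rewrite hornerC coefC.
- by apply: (@exp_shift_not_poly P Q B d.+1 c) => // z; rewrite -!E H.
Qed.

(** If a root of [a * om ^+ d = 'i] is parallel to [c], turning it by [pi / d] reaches the
    neighbouring critical ray, and [sin (pi / d)] is nonzero as soon as [d >= 2]. *)
Lemma good_direction a c d : a != 0 -> c != 0 -> (1 < d)%N ->
  exists om kappa, [/\ kappa = 1 \/ kappa = -1, a * om ^+ d = 0 +i* kappa &
    complex.Im (c / om) != 0].
Proof.
move=> a0 c0 d1; have d0 : (0 < d)%N by rewrite ltnW.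
have [om Hom] := nth_root ('i / a) d0.
have i0 : 'i != 0 :> C by rewrite eq_complex /= oner_eq0 andbF.
have om0 : om != 0.
  apply: contraNneq i0 => E; move: Hom; rewrite E expr0n (gtn_eqF d0) mulr0n.
  by move=> /esym/eqP; rewrite mulf_eq0 invr_eq0 (negbTE a0) orbF.
have [I0|I0] := eqVneq (complex.Im (c / om)) 0; last first.
  by exists om, 1; split => //; [left|rewrite Hom mulrC divfK].
have dR : 0 < d%:R :> R by rewrite ltr0n.
pose mu : C := cis (pi / d%:R).
have mud : mu ^+ d = -1.
  rewrite /mu -cisMn -(mulr_natr (pi / d%:R)) divfK ?gt_eqF // /cis cospi sinpi.
  by apply: eqC; rewrite ?ReN ?ImN //= oppr0.
exists (om * mu), (-1); split; first by right.
  rewrite exprMn mud Hom mulrN1 mulrN mulrC divfK //.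
  by apply: eqC; rewrite ?ReN ?ImN //= oppr0.
rewrite invfM mulrA -cisN ImM I0 mul0r addr0 /= sinN mulf_neq0 ?oppr_eq0 //.
  apply: contraNneq c0 => R0; rewrite -(divfK om0 c).
  by rewrite (_ : c / om = 0) ?mul0r //; apply: eqC.
rewrite gt_eqF // sin_gt0_pi // divr_gt0 ?pi_gt0 //=.
by rewrite ltr_pdivrMr // ltr_pMr ?pi_gt0 // ltr1n.
Qed.

(* At a zero [w] with [w + c] or [w - c] also a zero, [exp (A w)] and
   [exp (A (w +- c))] are comparable, which forces [Re (A (w +- c) - A w)] to be
   bounded; for zeros along a ray not parallel to [c] this difference grows. *)
Theorem degree_le1 p q A d c : p != 0 -> q != 0 -> size A = d.+1 -> c != 0 ->
  (forall w, q.[w] + p.[w] * cexp A.[w] = 0 ->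
     q.[w + c] + p.[w + c] * cexp A.[w + c] = 0 \/
     q.[w - c] + p.[w - c] * cexp A.[w - c] = 0) -> (d <= 1)%N.
Proof.
move=> p0 q0 Ad c0 Hsym; rewrite leqNgt; apply/negP => d1.
have d0 : (0 < d)%N by rewrite ltnW.
have A0 : A != 0 by rewrite -size_poly_gt0 Ad.
have lA0 : lead_coef A != 0 by rewrite lead_coef_eq0.
have [om [kappa [kap lom I0]]] := good_direction lA0 c0 d1.
have lAE : lead_coef A = A`_d by rewrite lead_coefE Ad.
have kap1 : `|kappa| = 1 by case: kap => ->; rewrite ?normrN normr1.
have om0 : om != 0 by apply: contraNneq I0 => ->; rewrite invr0 mulr0.
have c00 : 0 < cmod c by rewrite cmod_gt0.
have [dd dE] : exists dd, d = dd.+1 by exists d.-1; rewrite prednK.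
have dd0 : (0 < dd)%N by move: d1; rewrite dE ltnS.
have sA' : (size A^`() <= dd.+1)%N by rewrite -dE -ltnS -Ad lt_size_deriv.
(* [k * t ^+ dd] is the size of the real part of [A' * c] along the ray; the constants below keep
   each of the two errors under a quarter of it. *)
pose k : R := d%:R * `|complex.Im (c / om)|.
have k0 : 0 < k by rewrite mulr_gt0 ?ltr0n ?normr_gt0.
have ek : 0 < k / (4 * cmod c) by rewrite divr_gt0 // mulr_gt0.
have h12 : 0 < 1/2 :> R by lra.
have [K [eta1 [K0 eta10 Htay]]] := @poly_taylor_ray R A d om (eq_leq Ad) om0.
have Hder := poly_ray sA' om0 ek.
have Hp := poly_slow_variation p0 om0 h12.
have Hq := poly_slow_variation q0 om0 h12.
have [eta2 [T2 [eta20 T21 HH]]] := ray_nearI Htay (ray_nearI Hder (ray_nearI Hp Hq)).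
(* [17 / k] contradicts the bound [k * t <= 16] that the comparison of exponentials will leave. *)
pose T : R := Num.max (Num.max T2 (cmod c / eta1 + 1)) (Num.max (2 * cmod c / eta2)
  (Num.max (4 * (K * cmod c ^+ 2) / k) (17 / k))).
have eta220 : 0 < eta2 / 2 by rewrite divr_gt0.
have [t [w [tT wt Gw]]] := exp_poly_zeros T p0 q0 Ad d0 kap lom eta220.
move: tT; rewrite !ge_max => /andP[/andP[tT2 tc1] /andP[tc2 /andP[tK tk]]].
have t1 : 1 <= t := le_trans T21 tT2.
have t0 : 0 < t := lt_le_trans ltr01 t1.
have eta22 : eta2 / 2 <= eta2 by move: eta20; clear; lra.
have w2 : cmod (w - t%:C * om) <= eta2 * t.
  by apply: (le_trans wt); rewrite ler_wpM2r // ltW.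
have [Htw [Hdw [[pt pw] [qt qw]]]] := HH t w tT2 w2.
have cmp (P : {poly C}) v : P.[t%:C * om] != 0 ->
    cmod (P.[v] - P.[t%:C * om]) <= 1/2 * cmod P.[t%:C * om] ->
    cmod P.[t%:C * om] / 2 <= cmod P.[v] /\ cmod P.[v] <= 3/2 * cmod P.[t%:C * om].
  move=> Pt Pv; have := lerB_cmod P.[t%:C * om] (P.[t%:C * om] - P.[v]).
  rewrite subKr [cmod (_ - P.[v])]cmodB.
  have := ler_cmodD (P.[v] - P.[t%:C * om]) P.[t%:C * om]; rewrite subrK.
  by move: Pv; clear; lra.
pose rr := cmod q.[t%:C * om] / cmod p.[t%:C * om].
have rr0 : 0 < rr by rewrite divr_gt0 // cmod_gt0.
have rr3 : 0 < rr / 3 by apply: divr_gt0.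
have alg (X Y Z r : R) : 0 < Z -> 0 < X -> Z / 2 <= Y -> Y <= 3/2 * Z ->
    r * Z / 2 <= Y * X -> Y * X <= 3/2 * (r * Z) -> r / 3 <= X /\ X <= 3 * r.
  move=> Z0 X0 h1 h2 h3 h4.
  have h5 : Y * X <= 3/2 * Z * X by rewrite ler_wpM2r // ltW.
  have h6 : Z / 2 * X <= Y * X by rewrite ler_wpM2r // ltW.
  split; rewrite -(ler_pM2l Z0); first by move: h3 h5; clear; lra.
  by move: h4 h6; clear; lra.
have expA v : cmod (v - t%:C * om) <= eta2 * t -> q.[v] + p.[v] * cexp A.[v] = 0 ->
    rr / 3 <= expR (complex.Re A.[v]) /\ expR (complex.Re A.[v]) <= 3 * rr.
  move=> vt Gv; have [_ [_ [[_ pv] [_ qv]]]] := HH t v tT2 vt.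
  have [p1 p2] := cmp _ _ pt pv; have [q1 q2] := cmp _ _ qt qv.
  have pp : 0 < cmod p.[t%:C * om] by rewrite cmod_gt0.
  have E : cmod q.[v] = cmod p.[v] * expR (complex.Re A.[v]).
    rewrite -cmod_cexp -cmodM; move/eqP: Gv; rewrite addr_eq0 => /eqP ->.
    by rewrite cmodN.
  rewrite E in q1 q2.
  have X0 := expR_gt0 (complex.Re A.[v]).
  have qe : cmod q.[t%:C * om] = rr * cmod p.[t%:C * om] by rewrite /rr divfK ?gt_eqF.
  rewrite qe in q1 q2.
  exact: (alg _ _ _ _ pp X0 p1 p2 q1 q2).
have key (c' : C) : c' = c \/ c' = - c ->
    q.[w + c'] + p.[w + c'] * cexp A.[w + c'] <> 0.
  move=> c'E Gc'.
  have cc' : cmod c' = cmod c by case: c'E => ->; rewrite ?cmodN.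
  have Ic' : `|complex.Im (c' / om)| = `|complex.Im (c / om)|.
    by case: c'E => ->; rewrite ?mulNr ?ImN ?normrN.
  have wc : cmod (w + c' - t%:C * om) <= eta2 * t.
    rewrite addrAC; apply: (le_trans (ler_cmodD _ _)); rewrite cc'.
    move: tc2; rewrite ler_pdivrMr // [t * _]mulrC; move: wt; clear; lra.
  have [a1 a2] := expA _ w2 Gw; have [b1 b2] := expA _ wc Gc'.
  set D := A.[w + c'] - A.[w].
  have ED : expR (complex.Re A.[w + c']) = expR (complex.Re A.[w]) * expR (complex.Re D).
    by rewrite -expRD; congr expR; rewrite /D ReB; ring.
  have EDN : expR (complex.Re A.[w]) = expR (complex.Re A.[w + c']) * expR (- complex.Re D).
    by rewrite ED -mulrA -expRD subrr expR0 mulr1.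
  (* The bounds [rr / 3] and [3 * rr] differ by a factor 9, and [1 + x <= expR x <= 9]. *)
  have up (x X Y : R) : rr / 3 <= X -> Y <= 3 * rr -> Y = X * expR x -> x <= 8.
    move=> h1 h2 E; have hx := expR_ge1Dx x; have hX := expR_gt0 x.
    have : rr / 3 * expR x <= 3 * rr.
      by apply: le_trans h2; rewrite E ler_wpM2r // ltW.
    have -> : 3 * rr = rr / 3 * 9 by field.
    by rewrite (ler_pM2l rr3); move: hx; clear; lra.
  have D8 : `|complex.Re D| <= 8.
    rewrite ler_norml lerNl (up _ _ _ a1 b2 ED) (up _ _ _ b1 a2 EDN) //.
  have tdE : t ^+ d / t ^+ 2 = t ^+ dd / t by rewrite dE exprS; field; rewrite gt_eqF.
  have tt : t <= t ^+ dd by rewrite -{1}[t]expr1 ler_weXn2l.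
  have td0 : 0 < t ^+ dd by rewrite exprn_gt0.
  have H1 : cmod (D - A^`().[w] * c') <= k / 4 * t ^+ dd.
    apply: (le_trans (Htw c' _)).
      rewrite cc'; move: tc1; rewrite -lerBrDr ler_pdivrMr //.
      by rewrite mulrBl mul1r; move: eta10; clear; rewrite mulrC; lra.
    rewrite cc' tdE; set c2 := K * _ in tK *.
    have -> : c2 * (t ^+ dd / t) = c2 / t * t ^+ dd by field; rewrite gt_eqF.
    rewrite ler_wpM2r ?(ltW td0) // ler_pdivrMr //.
    by move: tK; rewrite ler_pdivrMr //; clear; lra.
  have H2 : cmod ((A^`().[w] - A^`()`_dd * (t%:C * om) ^+ dd) * c') <= k / 4 * t ^+ dd.
    rewrite cmodM cc'; apply: (le_trans (ler_wpM2r (cmod_ge0 _) Hdw)).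
    by rewrite le_eqVlt; apply/orP; left; apply/eqP; field; rewrite gt_eqF.
  (* [lead_coef A * om ^+ d] is traded for ['i * kappa], so the real part of this term is
     [d * t ^+ dd * Im (c' / om)] up to sign. *)
  have main : A^`()`_dd * (t%:C * om) ^+ dd * c' =
      (d%:R * kappa * t ^+ dd)%:C * ('i * (c' / om)).
    rewrite coef_deriv -dE -lAE exprMn -(mulr_natr (lead_coef A)) natC.
    have -> : (d%:R * kappa * t ^+ dd)%:C * ('i * (c' / om)) =
        d%:R%:C * (t ^+ dd)%:C * (0 +i* kappa) * (c' / om).
      have -> : 0 +i* kappa = kappa%:C * 'i.
        by apply: eqC; rewrite ?ReM ?ImM /=; ring.
      by rewrite !rmorphM /=; ring.
    by rewrite -lom dE exprS rmorphXn /=; field.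
  have Hm : `|complex.Re (A^`()`_dd * (t%:C * om) ^+ dd * c')| = k * t ^+ dd.
    rewrite main Re_realM ReM /= mul0r mul1r sub0r normrM normrN Ic'.
    by rewrite !normrM kap1 mulr1 normr_nat gtr0_norm // /k; ring.
  have H3 : cmod (D - A^`()`_dd * (t%:C * om) ^+ dd * c') <= k / 2 * t ^+ dd.
    have -> : D - A^`()`_dd * (t%:C * om) ^+ dd * c' =
      (D - A^`().[w] * c') + (A^`().[w] - A^`()`_dd * (t%:C * om) ^+ dd) * c' by ring.
    by apply: (le_trans (ler_cmodD _ _)); move: H1 H2; clear; lra.
  have := le_trans (ler_Re_cmod _) H3; rewrite ReB => H4.
  have H5 : k * t ^+ dd - 8 <= k / 2 * t ^+ dd.
    apply: le_trans H4; rewrite distrC; apply: le_trans (lerB_dist _ _).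
    by rewrite Hm lerD2l lerN2.
  have H6 : k * t <= k * t ^+ dd by rewrite ler_wpM2l // ltW.
  have H7 : 17 <= t * k by move: tk; rewrite ler_pdivrMr.
  by move: H5 H6 H7; clear; lra.
case: (Hsym w Gw) => h; first exact: (key c (or_introl erefl) h).
exact: (key (- c) (or_intror erefl) h).
Qed.

End ShiftedProducts.

(** * Linear exponents, periodicity and comparison of growth *)

Section Periodicity.
Context {R : realType}.
Local Notation C := R[i].
Implicit Types (f g : C -> C) (z w a b c om lambda mu kappa : C) (t x y e : R) (k n d : nat)
  (p q P Q A B : {poly C}).

Lemma large_multiples a b (T : R) : b != 0 ->
  exists n0, forall n, (n0 <= n)%N -> T <= cmod (a + b *+ n).
Proof.
move=> b0; have bp : 0 < cmod b by rewrite cmod_gt0.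
exists (Num.bound ((`|T| + cmod a) / cmod b)) => n hn.
have : (`|T| + cmod a) / cmod b <= n%:R.
  apply: le_trans (ltW (archi_boundP _)) _; last by rewrite ler_nat.
  by rewrite divr_ge0 ?addr_ge0 ?cmod_ge0.
rewrite ler_pdivrMr // => h.
have := lerB_cmodD (b *+ n) a; rewrite [b *+ n + a]addrC.
rewrite -(mulr_natr b n) natC cmodM cmodr normr_nat.
by have := ler_norm T; lra.
Qed.

(** [p / q] has period [c], so along a progression of step [c] started beyond all zeros it keeps its
    first value; polynomials agreeing on such a progression are equal. *)
Lemma shift_ratio_constant p q c : p != 0 -> q != 0 -> c != 0 ->
  (forall z, q.[z] * p.[z + c] = p.[z] * q.[z + c]) ->
  exists2 kappa, kappa != 0 & forall z, p.[z] = kappa * q.[z].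
Proof.
move=> p0 q0 c0 H.
have [r [b [r1 b0 Hb]]] := poly_lower_cst (mulf_neq0 p0 q0).
have [n0 Hn0] := @large_multiples 0 c r c0.
pose z0 := c *+ n0.
have nz n : p.[z0 + c *+ n] != 0 /\ q.[z0 + c *+ n] != 0.
  have : (p * q).[z0 + c *+ n] != 0.
    rewrite -cmod_gt0; apply: lt_le_trans b0 (Hb _ _).
    by rewrite /z0 -mulrnDr -[_ *+ _]add0r Hn0 // leq_addr.
  by rewrite hornerM mulf_eq0 negb_or => /andP[].
have [pz0 qz0] : p.[z0] != 0 /\ q.[z0] != 0 by have := nz 0%N; rewrite mulr0n addr0.
have E n : q.[z0] * p.[z0 + c *+ n] = p.[z0] * q.[z0 + c *+ n].
  elim: n => [|n IH]; first by rewrite mulr0n addr0 mulrC.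
  have [_ qn] := nz n; apply: (mulfI qn).
  rewrite mulrSr addrA mulrCA H [q.[z0] * _]mulrA IH.
  by ring.
have P0 : q.[z0] *: p - p.[z0] *: q = 0.
  apply: poly_large_zeros => T; have [n1 Hn1] := @large_multiples z0 c T c0.
  by exists (z0 + c *+ n1); rewrite ?Hn1 // hornerD hornerN !hornerZ E subrr.
exists (p.[z0] / q.[z0]); first by rewrite mulf_neq0 // invr_eq0.
move=> z; have := congr1 (fun P => P.[z]) P0.
rewrite hornerD hornerN !hornerZ horner0 => /eqP; rewrite subr_eq0 => /eqP E'.
by apply: (mulfI qz0); rewrite E'; field.
Qed.

(** [X1] and [X2] result from eliminating the exponential between the conditions at [w] and at
    [w + c] or [w - c], which is possible because [cexp (lambda * a)] relates the two
    exponentials. *)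
Theorem linear_exponent p q A c : p != 0 -> q != 0 -> size A = 2 -> c != 0 ->
  (forall w, q.[w] + p.[w] * cexp A.[w] = 0 ->
     q.[w + c] + p.[w + c] * cexp A.[w + c] = 0 \/
     q.[w - c] + p.[w - c] * cexp A.[w - c] = 0) ->
  exists kappa lambda, [/\ kappa != 0, lambda != 0, cexp (lambda * c) = 1 &
    forall z, p.[z] * cexp A.[z] = q.[z] * (kappa * cexp (lambda * z))].
Proof.
move=> p0 q0 A2 c0 Hsym.
pose lambda := A`_1; pose mu := A`_0.
have AE z : A.[z] = lambda * z + mu.
  by rewrite horner_coef A2 big_ord_recr big_ord1 /= expr0 expr1 mulr1 addrC.
have lE : lead_coef A = lambda by rewrite lead_coefE A2.
have l0 : lambda != 0 by rewrite -lE lead_coef_eq0 -size_poly_gt0 A2.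
have AD z a : cexp A.[z + a] = cexp A.[z] * cexp (lambda * a).
  by rewrite -cexpD !AE; congr cexp; ring.
have [pc Hpc lpc] := shift_poly p c; have [qc Hqc lqc] := shift_poly q c.
have [pd Hpd lpd] := shift_poly p (- c); have [qd Hqd lqd] := shift_poly q (- c).
pose X1 := cexp (lambda * c) *: (q * pc) - p * qc.
pose X2 := cexp (lambda * - c) *: (q * pd) - p * qd.
have vanish w a : q.[w] + p.[w] * cexp A.[w] = 0 ->
    q.[w + a] + p.[w + a] * cexp A.[w + a] = 0 ->
    cexp (lambda * a) * (q.[w] * p.[w + a]) - p.[w] * q.[w + a] = 0.
  move=> /eqP; rewrite addr_eq0 AD => /eqP -> /eqP; rewrite addr_eq0 => /eqP ->.
  by ring.
have large (T : R) : exists2 w, T <= cmod w & (X1 * X2).[w] = 0.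
  have i0 : lambda^-1 * 'i != 0.
    by rewrite mulf_neq0 ?invr_eq0 // eq_complex /= oner_eq0 andbF.
  have lom : lead_coef A * (lambda^-1 * 'i) ^+ 1 = 0 +i* 1.
    by rewrite lE expr1 mulrA divff // mul1r.
  pose om := lambda^-1 * 'i; have o0 : 0 < cmod om by rewrite cmod_gt0.
  have o20 : 0 < cmod om / 2 by rewrite divr_gt0.
  have [t [w [tT wt Gw]]] := exp_poly_zeros (Num.max 1 (2 * T / cmod om)) p0 q0 A2 (ltn0Sn 0)
    (or_introl erefl) lom o20.
  move: tT; rewrite ge_max => /andP[t1 tT].
  exists w.
    have := lerB_cmod (t%:C * om) (t%:C * om - w); rewrite subKr [cmod (_ - w)]cmodB.
    rewrite cmodM cmodr ger0_norm; last by lra.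
    by move: tT wt; rewrite ler_pdivrMr // -/om; lra.
  rewrite hornerM /X1 /X2 !hornerD !hornerN !hornerZ !hornerM Hpc Hqc Hpd Hqd.
  case: (Hsym w Gw) => h; apply/eqP; rewrite mulf_eq0; apply/orP; [left|right];
    apply/eqP; exact: vanish.
(* Each large zero kills [X1] or [X2], so their product is the zero polynomial. As [X2] is a nonzero
   multiple of [X1] shifted by [- c], both cases give [X1 = 0]. *)
have EX : X1 = 0.
  have := poly_large_zeros large => /eqP; rewrite mulf_eq0 => /orP[/eqP //|/eqP X20].
  apply: poly_large_zeros => T; exists `|T|%:C; first by rewrite cmodr normr_id ler_norm.
  set z := _%:C; have := congr1 (fun P => P.[z + c]) X20.
  rewrite /X1 /X2 !hornerD !hornerN !hornerZ !hornerM Hpc Hqc Hpd Hqd addrK horner0.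
  rewrite mulrN cexpN => /eqP; rewrite subr_eq0 => /eqP H.
  apply/eqP; rewrite subr_eq0; apply/eqP.
  rewrite mulrC -(mulrC p.[z + c]) -H.
  by field; exact: cexp_neq0.
have EXz z : cexp (lambda * c) * (q.[z] * p.[z + c]) = p.[z] * q.[z + c].
  have := congr1 (fun P => P.[z]) EX.
  rewrite /X1 hornerD hornerN hornerZ !hornerM Hpc Hqc horner0.
  by move=> /eqP; rewrite subr_eq0 => /eqP.
(* Shifting preserves leading coefficients, so both products in [X1] have the same one. *)
have e1 : cexp (lambda * c) = 1.
  move/eqP: EX; rewrite subr_eq0 => /eqP /(congr1 lead_coef).
  rewrite lead_coefZ !lead_coefM lpc lqc [lead_coef q * _]mulrC -[RHS]mul1r.
  by apply: mulIf; rewrite mulf_neq0 // lead_coef_eq0.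
have [|kappa k0 Hk] := shift_ratio_constant p0 q0 c0.
  by move=> z; rewrite -EXz e1 mul1r.
exists (kappa * cexp mu), lambda; split => //.
  by rewrite mulf_neq0 // cexp_neq0.
by move=> z; rewrite Hk AE cexpD; ring.
Qed.

(** Sizes 0 and 1 of [A] mean a constant exponential and are excluded by [product_not_poly];
    [degree_le1] excludes sizes above 2. *)
Theorem finite_zeros_structure f q c : cdiff f -> fin_growth f -> transcendental f ->
  c != 0 -> q != 0 -> finite_set [set z | f z * f (z + c) - q.[z] = 0] ->
  exists kappa lambda, [/\ kappa != 0, lambda != 0, cexp (lambda * c) = 1 &
    forall z, f z * f (z + c) = q.[z] * (1 + kappa * cexp (lambda * z))].
Proof.
move=> df gf tf c0 q0 fin.
have dfc := cdiff_shiftr c df.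
have gfc := fin_growth_shift c gf.
have [p [A [p0 E]]] := hadamard_finite
  (cdiffB (cdiffM df dfc) (cdiff_poly q)) (fin_growthB (fin_growthM gf gfc) (fin_growth_poly q)) fin.
have F z : f z * f (z + c) = q.[z] + p.[z] * cexp A.[z].
  by rewrite -E subrKC.
have Hsym w : q.[w] + p.[w] * cexp A.[w] = 0 ->
    q.[w + c] + p.[w + c] * cexp A.[w + c] = 0 \/
    q.[w - c] + p.[w - c] * cexp A.[w - c] = 0.
  rewrite -!F => /eqP; rewrite mulf_eq0 => /orP[/eqP h|/eqP h].
    by right; rewrite subrK h mulr0.
  by left; rewrite h mul0r.
case sA : (size A) => [|[|d]].
- exfalso; apply: (@product_not_poly _ f c (q + p) df gf tf) => z.
  by move/eqP: sA; rewrite F size_poly_eq0 => /eqP ->; rewrite horner0 cexp0 mulr1 hornerD.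
- exfalso; apply: (@product_not_poly _ f c (q + cexp A`_0 *: p) df gf tf) => z.
  rewrite F hornerD hornerZ; have -> := size1_polyC (eq_leq sA).
  by rewrite hornerC coefC mulrC.
- have := degree_le1 p0 q0 sA c0 Hsym; case: d sA => // sA _.
  have [kappa [lambda [k0 l0 e1 H]]] := linear_exponent p0 q0 sA c0 Hsym.
  by exists kappa, lambda; split => // z; rewrite F H; ring.
Qed.

(* Compare growth along the ray where [lambda * z] is a positive real. *)
Lemma growth_comparison P Q lambda mu a a' b b' : P != 0 -> lambda != 0 ->
  a != 0 -> a' != 0 ->
  (forall z, P.[z] * ((1 + a * cexp (lambda * z)) * (1 + a' * cexp (lambda * z))) =
             Q.[z] * ((1 + b * cexp (mu * z)) * (1 + b' * cexp (mu * z)))) ->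
  1 <= complex.Re (mu / lambda).
Proof.
move=> P0 l0 a0 a'0 H; rewrite leNgt; apply/negP; set y := complex.Re _ => y1.
(* The maximum with 0 covers a decaying [exp (mu z)], where [1 + b exp (mu z)] is still of size 1.
   The left side grows like [expR (2 * de * t + 2 * y' * t)]: one [expR (de * t)] pays for [Q / P],
   the other exceeds the constant [K]. *)
pose y' := Num.max y 0; pose de := 1 - y'.
have y'0 : 0 <= y' by rewrite le_max lexx orbT.
have yy' : y <= y' by rewrite le_max lexx.
have de0 : 0 < de by rewrite subr_gt0 gt_max y1 ltr01.
have li0 : lambda^-1 != 0 by rewrite invr_eq0.
have [T T1 HT] := poly_ratio_bound Q P0 li0 de0.
have [r [c [r1 c0 Hc]]] := poly_lower_cst P0.
have ac : 0 < cmod a by rewrite cmod_gt0.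
have ac' : 0 < cmod a' by rewrite cmod_gt0.
pose K := 4 * ((1 + cmod b) * (1 + cmod b')) / (cmod a * cmod a').
have [T2 T21 HT2] := expR_dominates (K + 1) 0 de0.
have [T3 T31 HT3] := expR_dominates (2 / cmod a) 0 (@ltr01 R).
have [T4 T41 HT4] := expR_dominates (2 / cmod a') 0 (@ltr01 R).
pose t : R := Num.max (Num.max T (r * cmod lambda)) (Num.max T2 (Num.max T3 T4)).
have [[tT tr] [tT2 [tT3 tT4]]] : (T <= t /\ r * cmod lambda <= t) /\ (T2 <= t /\ T3 <= t /\ T4 <= t).
  by rewrite !le_max !lexx !orbT.
have t1 : 1 <= t := le_trans T1 tT.
have t0 : 0 < t := lt_le_trans ltr01 t1.
pose z := t%:C * lambda^-1.
have zr : r <= cmod z.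
  by rewrite cmodM cmodV cmodr gtr0_norm // ler_pdivlMr // cmod_gt0.
have X : cexp (lambda * z) = (expR t)%:C.
  by rewrite /z mulrC -mulrA mulVf // mulr1 /cexp /= cis0 mulr1.
have Y : cmod (cexp (mu * z)) <= expR (y' * t).
  rewrite cmod_cexp ler_expR.
  have -> : mu * z = t%:C * (mu / lambda) by rewrite /z; ring.
  by rewrite Re_realM mulrC ler_wpM2r // ltW.
have Pz : 0 < cmod P.[z] by apply: lt_le_trans (Hc z zr).
have lowX (u : C) : 0 < cmod u -> 2 / cmod u * t ^+ 0 <= expR (1 * t) ->
    cmod u * expR t / 2 <= cmod (1 + u * cexp (lambda * z)).
  move=> u0; rewrite expr0 mulr1 mul1r ler_pdivrMr // => h.
  have := lerB_cmodD (u * cexp (lambda * z)) 1.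
  rewrite [_ + 1]addrC X cmodM cmodr ger0_norm ?expR_ge0 // cmod1.
  by move: h; clear; lra.
have upY (u : C) : cmod (1 + u * cexp (mu * z)) <= (1 + cmod u) * expR (y' * t).
  apply: (le_trans (ler_cmodD _ _)); rewrite cmod1 cmodM mulrDl mul1r lerD //.
    by rewrite -expR0 ler_expR mulr_ge0 // ltW.
  by rewrite ler_wpM2l ?cmod_ge0.
have := congr1 (@cmod R) (H z); rewrite !cmodM => E.
have L1 := lowX a ac (HT3 t tT3); have L2 := lowX a' ac' (HT4 t tT4).
have U1 := upY b; have U2 := upY b'.
have e0 := expR_gt0 t.
have L : cmod P.[z] * ((cmod a * expR t / 2) * (cmod a' * expR t / 2)) <=
    expR (de * t) * cmod P.[z] * (((1 + cmod b) * expR (y' * t)) * ((1 + cmod b') * expR (y' * t))).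
  apply: (@le_trans _ _ (cmod Q.[z] * (cmod (1 + b * cexp (mu * z)) * cmod (1 + b' * cexp (mu * z))))).
    rewrite -E ler_wpM2l ?cmod_ge0 // ler_pM //.
      by rewrite divr_ge0 // mulr_ge0 ?cmod_ge0 // ltW.
    by rewrite divr_ge0 // mulr_ge0 ?cmod_ge0 // ltW.
  apply: ler_pM; rewrite ?mulr_ge0 ?cmod_ge0 //; first exact: HT.
  by apply: ler_pM; rewrite ?cmod_ge0.
have := HT2 t tT2; rewrite expr0 mulr1 leNgt => /negP; apply.
apply: (@le_lt_trans _ _ K); last by rewrite ltrDl.
rewrite /K ler_pdivlMr ?mulr_gt0 //.
have EE : expR (de * t) * (expR (y' * t)) = expR t.
  by rewrite -expRD; congr expR; rewrite /de; ring.
move: L; rewrite -EE -/y'.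
move: (expR_gt0 (de * t)) (expR_gt0 (y' * t)); rewrite [expR (de * t) * cmod P.[z]]mulrC.
move: (expR (de * t)) (expR (y' * t)) (cmod P.[z]) Pz (cmod a) (cmod a') (1 + cmod b) (1 + cmod b').
clear => D Y p p0 u u' v v' D0 Y0.
rewrite -(mulrA p D) ler_pM2l // => h.
have q0 : 0 < D * Y * Y by rewrite !mulr_gt0.
rewrite -(ler_pM2l q0); lra.
Qed.

End Periodicity.

Theorem theorem1p1 (R : realType) (f : R[i] -> R[i])
    (f_entire : entire f) (f_transc : transcendental f)
    (f_order : finite_order f)
    (c1 c2 : R[i]) (c1_neq0 : c1 != 0) (c2_neq0 : c2 != 0)
    (f_shifts : ~ (forall z : R[i], f (z + c1) = f (z + c2)))
    (q : {poly R[i]}) (q_neq0 : q != 0) :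
  infinite_set [set z : R[i] | f z * f (z + c1) - q.[z] = 0] \/
  infinite_set [set z : R[i] | f z * f (z + c2) - q.[z] = 0].
Proof.
have df : cdiff f by exact/entireP.
have gf := finite_order_growth df f_order.
apply: contrapT => /not_orP[/contrapT fin1 /contrapT fin2].
have [k1 [l1 [k10 l10 e1 F1]]] := finite_zeros_structure df gf f_transc c1_neq0 q_neq0 fin1.
have [k2 [l2 [k20 l20 e2 F2]]] := finite_zeros_structure df gf f_transc c2_neq0 q_neq0 fin2.
have [qc1 Hq1 lq1] := shift_poly q c1; have [qc2 Hq2 lq2] := shift_poly q c2.
have qc10 : q * qc1 != 0 by rewrite mulf_neq0 // -lead_coef_eq0 lq1 lead_coef_eq0.
have qc20 : q * qc2 != 0 by rewrite mulf_neq0 // -lead_coef_eq0 lq2 lead_coef_eq0.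
(* Both sides equal [f z * f (z + c1) * f (z + c2) * f (z + c1 + c2)]. *)
have H z : (q * qc2).[z] * ((1 + k1 * cexp (l1 * z)) *
      (1 + k1 * cexp (l1 * c2) * cexp (l1 * z))) =
    (q * qc1).[z] * ((1 + k2 * cexp (l2 * z)) *
      (1 + k2 * cexp (l2 * c1) * cexp (l2 * z))).
  have := F1 (z + c2); have := F2 (z + c1).
  rewrite !mulrDr !cexpD [z + c1 + c2]addrAC -Hq1 -Hq2 => G2 G1.
  transitivity ((f z * f (z + c1)) * (f (z + c2) * f (z + c2 + c1))).
    by rewrite F1 G1 hornerM; ring.
  transitivity ((f z * f (z + c2)) * (f (z + c1) * f (z + c2 + c1))); first by ring.
  by rewrite F2 G2 hornerM; ring.
have x1 := growth_comparison qc20 l10 k10 (mulf_neq0 k10 (cexp_neq0 _)) H.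
have x2 := growth_comparison qc10 l20 k20 (mulf_neq0 k20 (cexp_neq0 _)) (fun z => esym (H z)).
have l12 : l2 = l1.
  (* For [l2 / l1 = a + i b] the comparisons say [a >= 1] and [a / (a ^+ 2 + b ^+ 2) >= 1], so
     [a ^+ 2 + b ^+ 2 <= a <= a ^+ 2]. *)
  rewrite -[l2](divfK l10); suff -> : l2 / l1 = 1 by rewrite mul1r.
  move: x2; rewrite -[l1 / l2]invf_div; move: (l2 / l1) x1 => [a b] /= a1.
  set n2 := a ^+ 2 + b ^+ 2; have n20 : 0 < n2 by rewrite ltr_pwDl ?sqr_ge0 // exprn_gt0 //; lra.
  rewrite ler_pdivlMr // mul1r /n2 => h.
  have b2 : 0 <= b ^+ 2 by exact: sqr_ge0.
  have a2 : a <= a ^+ 2 by rewrite expr2 ler_peMl //; lra.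
  have b0 : b = 0 by apply/eqP; rewrite -sqrf_eq0 eq_le b2 andbT; lra.
  have a11 : a <= 1.
    by rewrite leNgt; apply/negP => a11; have : a < a ^+ 2; [rewrite expr2 ltr_pMl //; lra|lra].
  by rewrite b0; congr Complex; apply/eqP; rewrite eq_le a11.
(* The zeros of [1 + k1 * cexp (l1 * z)] include a progression of step [2 * pi * 'i / l1], so one
   lies beyond the zeros of [q * qc1]. There the left side of [H] vanishes, and as
   [cexp (l1 * c1) = 1] the right side is a nonzero multiple of the square of
   [1 + k2 * cexp (l1 * z)]. *)
have k12 : k2 = k1.
  have nk1 : - k1^-1 != 0 by rewrite oppr_eq0 invr_eq0.
  have [w Hw] := cexp_onto nk1.
  pose b : R[i] := (0 +i* (2 * pi)) / l1.
  have b0 : b != 0.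
    by rewrite mulf_neq0 ?invr_eq0 // -cmod_eq0 cmodE /= expr0n add0r sqrtr_sqr normr_eq0 gt_eqF ?twopi_gt0.
  have [r [m [r1 m0 Hm]]] := poly_lower_cst qc10.
  have [n Hn] := large_multiples (w / l1) r b0.
  pose z := w / l1 + b *+ n.
  have qz : (q * qc1).[z] != 0.
    by rewrite -cmod_gt0; apply: lt_le_trans m0 (Hm z (Hn n (leqnn n))).
  have Xz : k1 * cexp (l1 * z) = -1.
    have -> : l1 * z = w + (0 +i* (2 * pi)) *+ n.
      rewrite /z mulrDr mulrnAr; congr (_ + _ *+ n); rewrite mulrC divfK //.
    by rewrite cexpD cexpMn cexp_2pii expr1n mulr1 Hw mulrN divff.
  have := H z; rewrite l12 e1 mulr1 Xz subrr mul0r mulr0 => /esym/eqP.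
  rewrite mulf_eq0 (negbTE qz) /= -expr2 sqrf_eq0 addrC addr_eq0 -Xz => /eqP.
  exact/mulIf/cexp_neq0.
have [f0|h] : (forall z, f z = 0) \/ (forall z, f (z + c1) - f (z + c2) = 0).
  apply: cdiff_integral => //.
    by apply: cdiffB; exact: cdiff_shiftr.
  by move=> z; rewrite mulrBr F1 F2 l12 k12 subrr.
  by apply: f_transc; exists 0 => z; rewrite horner0.
by apply: f_shifts => z; apply/eqP; rewrite -subr_eq0 h.
Qed.
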